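(* Let $\alpha\in(0,\frac12)$. Assume that $\theta^{0}\in L^{1}(\mathbb{R}^{2})\cap L^{\infty}(\mathbb{R}^{2})$ admits a generalized layer cake representation $(\Theta,\mu)$ with $L_{\mu}(\Theta)<\infty$. Then there is an open interval $I\ni 0$ and a Lagrangian solution $\theta$ to the g-SQG equation on $I$ with initial datum $\theta^{0}$, with the associated flow map $\Phi\in C\left(I;C(\mathbb{R}^{2};\mathbb{R}^{2})\right)$ such that $\sup_{t\in J}L_{\mu}(\Phi_{*}^{t}\Theta)<\infty$ for any compact interval $J\subseteq I$. Let $I$ be the maximal such interval. Then the solution $\theta$ (with these properties) is unique and independent of the choice of $(\Theta,\mu)$; for any compact interval $J\subseteq I$ we have $$\sup_{t\in J}\max\left\{\|\Phi^{t}\|_{\dot{C}^{0,1}},\|(\Phi^{t})^{-1}\|_{\dot{C}^{0,1}}\right\}<\infty;$$ and for any endpoint $T$ of $I$ we have either $|T|=\infty$ or $\lim_{t\to T}L_{\mu}(\Phi_{*}^{t}\Theta)=\infty$.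
   Context: Velocity. Fix $\alpha\in(0,\frac12)$ and write $(x_1,x_2)^\perp:=(-x_2,x_1)$, $\nabla^\perp:=(-\partial_{x_2},\partial_{x_1})$. For $\theta\in L^1(\mathbb{R}^2)\cap L^\infty(\mathbb{R}^2)$ let $$u(\theta;x):=c_\alpha\int_{\mathbb{R}^2}\frac{(x-y)^\perp}{|x-y|^{2+2\alpha}}\,\theta(y)\,dy,$$ where $c_\alpha>0$ is the constant (depending only on $\alpha$) for which $u(\theta)=-\nabla^\perp(-\Delta)^{-1+\alpha}\theta$. The g-SQG equation is $\partial_t\theta+u(\theta)\cdot\nabla\theta=0$ on $I\times\mathbb{R}^2$. Generalized layer cake representation. Let $\mathcal{L}$ be a measurable space, $\mu$ a $\sigma$-finite signed measure on $\mathcal{L}$ with total variation measure $|\mu|$, and $\Theta\subseteq\mathbb{R}^2\times\mathcal{L}$ a set in the product $\sigma$-algebra (the one generated by measurable rectangles) of finite measure with respect to the product of Lebesgue measure and $|\mu|$. For $\lambda\in\mathcal{L}$ let $\Theta^\lambda:=\{x\in\mathbb{R}^2:(x,\lambda)\in\Theta\}$. If $\theta(x)=\int_{\mathcal{L}}\mathbf{1}_{\Theta^\lambda}(x)\,d\mu(\lambda)$ for each $x\in\mathbb{R}^2$, then $(\Theta,\mu)$ is a generalized layer cake representation of $\theta$ (the space $\mathcal{L}$ is implicit in $(\Theta,\mu)$). Let $$L_\mu(\Theta):=\sup_{x\in\mathbb{R}^2}\int_{\mathcal{L}}\frac{d|\mu|(\lambda)}{d(x,\partial\Theta^\lambda)^{2\alpha}},\qquad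 \tfrac10:=\infty ,$$ with $d$ the Euclidean distance from a point to a set. Push-forward. For a (Lebesgue-)measure-preserving homeomorphism $\Phi:\mathbb{R}^2\to\mathbb{R}^2$ let $\Phi_*\theta:=\theta\circ\Phi^{-1}$ and $\Phi_*\Theta:=\{(\Phi(x),\lambda):(x,\lambda)\in\Theta\}$, so $(\Phi_*\Theta)^\lambda=\Phi(\Theta^\lambda)$. Function spaces. $C(A;B)$ is the space of all continuous (not necessarily bounded) maps $A\to B$; continuity in time of maps into $C(\mathbb{R}^2;\mathbb{R}^2)$ is with respect to $d(f,g)=\|f-g\|_{L^\infty}$. $\|F\|_{\dot C^{0,1}}$ is the best Lipschitz constant of $F$. Lagrangian solution. A Lagrangian solution to the g-SQG equation on an open interval $I\ni0$ with initial datum $\theta^0\in L^1(\mathbb{R}^2)\cap L^\infty(\mathbb{R}^2)$ is any $\theta:I\to L^1(\mathbb{R}^2)\cap L^\infty(\mathbb{R}^2)$ given by $\theta^t:=\Phi^t_*\theta^0$ for $t\in I$, where $\Phi\in C(I;C(\mathbb{R}^2;\mathbb{R}^2))$ solves $\partial_t\Phi^t=u(\theta^t)\circ\Phi^t$, $\Phi^0=\mathrm{Id}$ on $I$, with $\Phi^t$ a measure-preserving homeomorphism for each $t\in I$. $\Phi$ is called the flow map of $\theta$. *)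

(* Defs.v *)
From HB Require Import structures.
From mathcomp Require Import all_boot all_order all_algebra.
From mathcomp Require Import all_classical all_reals all_analysis.

Set Implicit Arguments.
Unset Strict Implicit.
Unset Printing Implicit Defensive.

Import Order.TTheory GRing.Theory Num.Theory.
Import numFieldNormedType.Exports.

Local Open Scope classical_set_scope.
Local Open Scope ring_scope.

(* The charges of the library are finite, whereas a sigma-finite signed        *)
(* measure may take one of the values +oo and -oo. Its Jordan decomposition    *)
(* is given by the upper and lower variations.                                 *)
Section variations.
Context d (T : measurableType d) (R : realType).
Implicit Types (nu : set T -> \bar R) (A : set T).
Local Open Scope ereal_scope.

Definition upper_variation nu A : \bar R :=
  ereal_sup [set nu B | B in [set B | measurable B /\ B `<=` A]].

Definition lower_variation nu A : \bar R := upper_variation (\- nu) A.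

Definition total_variation nu A : \bar R :=
  upper_variation nu A + lower_variation nu A.

End variations.

Record signed_measure d (T : measurableType d) (R : realType) := SignedMeasure {
  signed_measure_val :> set T -> \bar R;
  signed_measure0 : signed_measure_val set0 = 0%E;
  signed_measure_sigma_additive : semi_sigma_additive signed_measure_val;
  signed_measure_one_infinity :
    (forall A, measurable A -> signed_measure_val A != +oo%E) \/
    (forall A, measurable A -> signed_measure_val A != -oo%E);
  signed_measure_sigma_finite :
    sigma_finite setT (total_variation signed_measure_val) }.

Section variations_measure.
Context d (T : measurableType d) (R : realType).
Local Open Scope ereal_scope.

Section upper.
Variable nu : set T -> \bar R.
Hypothesis nu0 : nu set0 = 0.
Hypothesis nuS : semi_sigma_additive nu.

Let U := upper_variation nu.

Lemma upper_variation_ge A B : measurable B -> B `<=` A -> nu B <= U A.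
Proof. by move=> mB BA; apply: ereal_sup_ubound; exists B. Qed.

Lemma upper_variation_ge0 A : 0 <= U A.
Proof. by rewrite -nu0; apply: upper_variation_ge. Qed.

Lemma le_upper_variation A B : A `<=` B -> U A <= U B.
Proof.
move=> AB; apply: ge_ereal_sup => _ [C [mC CA] <-].
by apply: upper_variation_ge => //; exact: subset_trans AB.
Qed.

Lemma upper_variation0 : U set0 = 0.
Proof.
apply/eqP; rewrite eq_le upper_variation_ge0 andbT.
by apply: ge_ereal_sup => _ [C [mC C0] <-]; rewrite (_ : C = set0) ?nu0// -subset0.
Qed.

Lemma upper_variation_superadd A B : A `&` B = set0 ->
  U A + U B <= U (A `|` B).
Proof.
move=> AB0; set c := U (A `|` B).
have key A' B' : measurable A' -> A' `<=` A -> measurable B' -> B' `<=` B ->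
    nu A' + nu B' <= c.
  move=> mA' sA mB' sB.
  have dAB : A' `&` B' = set0.
    by rewrite -subset0 -AB0; exact: setISS.
  have nuA : measure_function.semi_additive2 nu.
    by apply/semi_additiveW => //; exact: semi_sigma_additive_is_additive.
  rewrite -nuA //; last exact: measurableU.
  by apply: upper_variation_ge; [exact: measurableU|exact: setUSS].
have c0 : 0 <= c by exact: upper_variation_ge0.
have UBc : U B <= c by apply: le_upper_variation; exact: subsetUr.
have key1 A' : measurable A' -> A' `<=` A -> nu A' + U B <= c.
  move=> mA' sA; case E : (nu A') => [a| |].
  - rewrite -leeBrDl//; apply: ge_ereal_sup => _ [B' [mB' sB] <-].
    by rewrite leeBrDl// -E; exact: key.
  - have := key A' set0 mA' sA measurable0 (@sub0set _ _).
    by rewrite nu0 adde0 E leye_eq => /eqP ->; rewrite leey.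
  - by rewrite addNye leNye.
have [UBy|UBy] := eqVneq (U B) +oo.
  by move: UBc; rewrite UBy leye_eq => /eqP ->; rewrite leey.
have UBfin : U B \is a fin_num.
  by rewrite ge0_fin_numE ?upper_variation_ge0// ltey.
rewrite -leeBrDr//; apply: ge_ereal_sup => _ [A' [mA' sA] <-].
by rewrite leeBrDr//; exact: key1.
Qed.

Lemma upper_variation_sigma_additive : semi_sigma_additive U.
Proof.
move=> F mF tF mUF.
have U0 n : 0 <= U (F n) by exact: upper_variation_ge0.
suff -> : U (\bigcup_n F n) = \sum_(n <oo) U (F n).
  exact: is_cvg_nneseries.
apply/eqP; rewrite eq_le; apply/andP; split.
  apply: ge_ereal_sup => _ [B [mB BF] <-].
  have BE : B = \bigcup_n (B `&` F n) by rewrite -setI_bigcupr; exact/esym/setIidl.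
  have mBF n : measurable (B `&` F n) by exact: measurableI.
  have tBF : trivIset setT (fun n => B `&` F n) by exact: trivIset_setIl.
  have mU : measurable (\bigcup_n (B `&` F n)) by rewrite -BE.
  have cv := nuS mBF tBF mU.
  rewrite BE -(cvg_lim _ cv)//; apply: lee_lim.
  - by apply/cvg_ex; exists (nu (\bigcup_n (B `&` F n))).
  - exact: is_cvg_nneseries.
  - apply: nearW => n; apply: lee_sum => i _.
    by apply: upper_variation_ge => //; exact: subIsetr.
apply: lime_le; first exact: is_cvg_nneseries.
apply: nearW => n.
apply: (@le_trans _ _ (U (\big[setU/set0]_(0 <= i < n) F i))); last first.
  by apply: le_upper_variation; rewrite big_mkord; exact: bigsetU_bigcup.
elim: n => [|n IH]; first by rewrite !big_geq// upper_variation_ge0.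
rewrite !big_nat_recr//=.
apply: (@le_trans _ _ (U (\big[setU/set0]_(0 <= i < n) F i) + U (F n))).
  exact: leeD2r.
apply: upper_variation_superadd.
rewrite big_mkord (@trivIset_bigsetUI _ xpredT)//.
by rewrite [X in trivIset X F](_ : _ = [set: nat])//; exact/seteqP.
Qed.

End upper.

Variable nu : signed_measure T R.

Let nnu0 : (\- (nu : set T -> \bar R)) set0 = 0.
Proof. by rewrite /= signed_measure0 oppe0. Qed.

Let nnuS : semi_sigma_additive (\- (nu : set T -> \bar R)).
Proof.
move=> F mF tF mUF.
have cv := signed_measure_sigma_additive mF tF mUF.
rewrite (_ : (fun n => _) = (fun n => - \sum_(0 <= i < n) nu (F i))).
  by apply: cvgeN; exact: cv.
apply/funext => n; rewrite sumeN// => i j _ _.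
have [nuy|nuNy] := signed_measure_one_infinity nu.
- by apply: ltpinfty_adde_def; rewrite inE ltey nuy.
- by apply: ltninfty_adde_def; rewrite inE ltNye nuNy.
Qed.

HB.instance Definition _ := isMeasure.Build _ _ _ (upper_variation nu)
  (upper_variation0 (signed_measure0 nu))
  (upper_variation_ge0 (signed_measure0 nu))
  (upper_variation_sigma_additive (signed_measure0 nu)
    (signed_measure_sigma_additive (s:=nu))).

HB.instance Definition _ := isMeasure.Build _ _ _ (lower_variation nu)
  (upper_variation0 nnu0) (upper_variation_ge0 nnu0)
  (upper_variation_sigma_additive nnu0 nnuS).

Let total_variationE : total_variation nu =
  measure_add (upper_variation nu) (lower_variation nu).
Proof. by apply/funext => A; rewrite measure_addE. Qed.

Let total_variation0 : total_variation nu set0 = 0.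
Proof. by rewrite /total_variation !measure0 adde0. Qed.

Let total_variation_ge0 A : 0 <= total_variation nu A.
Proof. by rewrite adde_ge0. Qed.

Let total_variation_sigma_additive :
  semi_sigma_additive (total_variation nu).
Proof. by rewrite total_variationE; apply: measure_semi_sigma_additive. Qed.

HB.instance Definition _ := isMeasure.Build _ _ _ (total_variation nu)
  total_variation0 total_variation_ge0 total_variation_sigma_additive.

HB.instance Definition _ := Measure_isSigmaFinite.Build _ _ _
  (total_variation nu) (signed_measure_sigma_finite nu).

End variations_measure.

Section signed_integral.
Context d (T : measurableType d) (R : realType).
Local Open Scope ereal_scope.

Definition signed_integral (nu : signed_measure T R) (f : T -> \bar R) :
    \bar R :=
  \int[upper_variation nu]_x f x - \int[lower_variation nu]_x f x.

End signed_integral.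

Notation plane R := (R * R)%type.

(* The plane with the sigma-algebra of its Lebesgue measurable sets; the       *)
(* carrier is convertible to plane R.                                          *)
Definition lplane (R : realType) : measurableType _ :=
  caratheodory_type ((@lebesgue_measure R \x @lebesgue_measure R)%E^*)%mu.

Definition leb2 (R : realType) : set (lplane R) -> \bar R :=
  @completed_measure_extension _ _ R (@lebesgue_measure R \x @lebesgue_measure R)%E.

HB.instance Definition _ (R : realType) := Measure.on (@leb2 R).

Section plane.
Context {R : realType}.
Implicit Types (x y z : plane R) (A : set (plane R)) (F G : plane R -> plane R).

(* The norm of the normed module R * R is the max norm. *)
Definition enorm z : R := Num.sqrt (z.1 ^+ 2 + z.2 ^+ 2).

Definition perp z : plane R := (- z.2, z.1).

Definition bd A : set (plane R) := closure A `\` interior A.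

(* +oo if A is empty *)
Definition dist_to x A : \bar R :=
  ereal_inf [set (enorm (x - y))%:E | y in A].

(* The L^oo distance of continuous maps, possibly +oo. *)
Definition sup_dist F G : \bar R :=
  ereal_sup [set (enorm (F x - G x))%:E | x in [set: plane R]].

Definition lip_const F : \bar R :=
  ereal_sup [set (enorm (F p.1 - F p.2) / enorm (p.1 - p.2))%:E |
             p in [set p : plane R * plane R | p.1 != p.2]].

Definition L1Linfty (f : plane R -> R) : Prop :=
  f \in Lfun (@leb2 R) 1%E /\ f \in Lfun (@leb2 R) +oo%E.

(* Two-sided inverse of F as soon as F is bijective. *)
Definition inverse F : plane R -> plane R := 'pinv_(fun=> 0) setT F.

Definition measure_preserving_homeo F : Prop :=
  [/\ bijective F, continuous F, continuous (inverse F),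
      measurable_fun [set: lplane R] (F : lplane R -> lplane R) &
      forall A : set (lplane R), measurable A ->
        leb2 (F @^-1` A) = leb2 A].

End plane.

Section velocity.
Context {R : realType}.
Variable alpha : R.

Definition Gamma (s : R) : R :=
  \int[@lebesgue_measure R]_(x in `]0, +oo[) (x `^ (s - 1) * expR (- x)).

(* (-Delta)^(alpha - 1) is the convolution with the Riesz kernel               *)
(*   Gamma(alpha) / (4^(1-alpha) pi Gamma(1-alpha)) |x|^(-2 alpha)             *)
(* and minus the perpendicular gradient of |x|^(-2 alpha) is                   *)
(* 2 alpha x^perp / |x|^(2 + 2 alpha).                                         *)
Definition c_alpha : R :=
  2 * alpha * Gamma alpha / (4 `^ (1 - alpha) * pi * Gamma (1 - alpha)).

Definition velocity (theta : plane R -> R) (x : plane R) : plane R :=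
  let K (y : plane R) : plane R :=
    (enorm (x - y) `^ (2 + 2 * alpha))^-1 *: perp (x - y) in
  c_alpha *: (\int[@leb2 R]_y ((K y).1 * theta y),
              \int[@leb2 R]_y ((K y).2 * theta y)).

End velocity.

Section layer_cake.
Context {R : realType} d {L : measurableType d}.
Variables (mu : signed_measure L R) (Theta : set (lplane R * L)).

Definition layer_cake (theta : plane R -> R) : Prop :=
  [/\ measurable Theta,
      ((@leb2 R \x total_variation mu) Theta < +oo)%E &
      forall x : plane R,
        (theta x)%:E =
        signed_integral mu (fun l => (\1_(ysection Theta l) x)%:E)].

(* The integral of the library is the lower integral when the integrand is     *)
(* not measurable; the integrand here may be measurable only with respect to   *)
(* the completion of |mu|. The inverse satisfies 0^-1 = +oo and (+oo)^-1 = 0.  *)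
Definition L_mu (alpha : R) : \bar R :=
  ereal_sup [set (\int[total_variation mu]_l
                    (dist_to x (bd (ysection Theta l)) `^ (2 * alpha))^-1)%E |
             x in [set: plane R]].

Definition push_set (F : plane R -> plane R) : set (lplane R * L) :=
  [set (F p.1 : lplane R, p.2) | p in Theta].

End layer_cake.

Section solutions.
Context {R : realType}.
Variable alpha : R.
Implicit Types (a b : \bar R) (theta : R -> plane R -> R)
  (Phi : R -> plane R -> plane R).

Definition open_itv a b : set R := [set t | (a < t%:E < b)%E].

(* The values of theta and Phi outside the interval are irrelevant. The flow   *)
(* equation is read at each fixed point x of the plane.                        *)
Definition lagrangian_solution (theta0 : plane R -> R) a b theta Phi : Prop :=
  [/\ (forall t, open_itv a b t -> measure_preserving_homeo (Phi t)),
      (forall t, open_itv a b t ->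
         sup_dist (Phi s) (Phi t) @[s --> t] --> 0%E),
      Phi 0 = id,
      (forall t, open_itv a b t -> L1Linfty (theta t) /\
         theta t = theta0 \o inverse (Phi t)) &
      (forall t x, open_itv a b t ->
         is_derive t 1 (Phi ^~ x) (velocity alpha (theta t) (Phi t x)))].

Context d {L : measurableType d}.
Variables (mu : signed_measure L R) (Theta : set (lplane R * L)).

Definition L_mu_solution (theta0 : plane R -> R) a b theta Phi : Prop :=
  lagrangian_solution theta0 a b theta Phi /\
  forall s t, s <= t -> `[s, t] `<=` open_itv a b ->
    (ereal_sup [set L_mu mu (push_set Theta (Phi r)) alpha | r in `[s, t]]
      < +oo)%E.

Definition solution_itv (theta0 : plane R -> R) a b : Prop :=
  (a < 0 < b)%E /\ exists theta Phi, L_mu_solution theta0 a b theta Phi.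

Definition maximal_itv (theta0 : plane R -> R) a b : Prop :=
  solution_itv theta0 a b /\
  forall a' b', solution_itv theta0 a' b' ->
    open_itv a' b' `<=` open_itv a b.

End solutions.

(* Main.v *)
(* Transport the datum by a measure-preserving homeomorphism Phi and let
   V[Phi](x) be the resulting velocity at x. The ball around x of radius r =
   d(x, bd Phi(Theta^l)) is contained in Phi(Theta^l) or disjoint from it, so
   in the difference V[Phi](x) - V[Phi'](x') the slice l only contributes the
   part of the kernel outside this ball, which is O(delta / r^(2 alpha)) when
   the arguments x - Phi y and x' - Phi' y of the kernel differ by at most
   delta. Integrating in l gives |V[Phi](x) - V[Phi'](x')| <= C delta
   L_mu(Phi_* Theta), an estimate in which only one of the two flows has to
   be controlled. By Gronwall it yields uniqueness and Lipschitz bounds on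
   the flow; the latter in turn control L_mu' for every other representation.
   For existence, the velocity is regularized at scale eps, and a symplectic
   Euler step of size h is an exactly measure-preserving homeomorphism with
   distortion 1 + O(h L_mu). Over a time tau of order 1 / L_mu the iterates
   with steps tau / 2^n have distortion at most 2 and form a Cauchy sequence;
   their limit preserves the measure and satisfies a quadratic Taylor
   estimate, hence the flow equation. The time of existence depends only on
   L_mu, whence the blow-up alternative. *)

Require Import Defs.
From HB Require Import structures.
From mathcomp Require Import all_boot all_order all_algebra.
From mathcomp Require Import all_classical all_reals all_analysis.
From mathcomp Require Import measurable_realfun ess_sup_inf ring lra.
Import Order.TTheory GRing.Theory Num.Theory.
Import numFieldNormedType.Exports.
Local Open Scope classical_set_scope.
Local Open Scope ring_scope.

Set Implicit Arguments.
Unset Strict Implicit.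
Unset Printing Implicit Defensive.

(** * Borel sets and measure-preserving homeomorphisms of the plane *)

(** The velocity is a singular integral and only Lipschitz, so area preservation cannot be read off
    a pointwise divergence, and the estimates hold only within the class of measure-preserving maps,
    which a Picard iteration on flows would leave. The symplectic step stays in this class and asks
    of the field only a small Lipschitz constant and zero flux through rectangles. The kernel is
    regularized because Fubini, over the layers and for the flux, is applied to bounded kernels. All
    constants are uniform in the scale, so at level n the scale is chosen to cost 2^-n and the limit
    sees the true kernel. In the key estimate the kernel is split at a radius rho. Outside, it is
    Lipschitz with a constant whose integral is of order rho^(-2 alpha). The inner parts are not
    small compared with delta; they cancel, because both flows transport the same measure and the
    slice does not cut the ball. Distances to boundaries are Euclidean ([enorm]), flows are
    estimated in the max norm of the library; the passage between the two causes several factors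
    2. *)

Section borel_plane.
Context {R : realType}.

Definition bplane : measurableType _ := (measurableTypeR R * measurableTypeR R)%type.

Definition bleb : {measure set bplane -> \bar R} :=
  (@lebesgue_measure R \x @lebesgue_measure R)%E.

Lemma leb2_borel (A : set bplane) : measurable A -> leb2 A = bleb A.
Proof. exact: measurable_mu_extE. Qed.

Lemma borel_lplane (A : set bplane) : measurable A ->
  measurable (A : set (lplane R)).
Proof.
by move=> mA; apply: sub_caratheodory; exact: sub_sigma_algebra.
Qed.

(** Both projections become measurable for the sigma-algebra generated by [G], which therefore
    contains all rectangles. Used with the open sets and with the half-open boxes as [G], the two
    classes on which measures are compared later. *)
Lemma bplane_sub_sigma (G : set (set bplane)) (g1 : set (set (measurableTypeR R))) :
  measurable = <<s g1 >> ->
  (forall A, g1 A -> <<s G >> (fst @^-1` A)) ->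
  (forall A, g1 A -> <<s G >> (snd @^-1` A)) ->
  (measurable : set (set bplane)) `<=` <<s G >>.
Proof.
move=> mg1 G1 G2.
have m1 : measurable_fun setT (fst : g_sigma_algebraType G -> measurableTypeR R).
  apply: (measurability g1) => // _ [A gA <-].
  by rewrite setTI; exact: G1.
have m2 : measurable_fun setT (snd : g_sigma_algebraType G -> measurableTypeR R).
  apply: (measurability g1) => // _ [A gA <-].
  by rewrite setTI; exact: G2.
rewrite measurable_prod_measurableType.
apply: smallest_sub; first exact: smallest_sigma_algebra.
move=> _ [A mA [B mB <-]].
have -> : A `*` B = fst @^-1` A `&` snd @^-1` B by [].
apply: (@measurableI _ (g_sigma_algebraType G)).
- by rewrite -[X in measurable X]setTI; exact: m1.
- by rewrite -[X in measurable X]setTI; exact: m2.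
Qed.

Lemma borel_generated_open :
  (measurable : set (set bplane)) `<=` <<s [set U : set (plane R) | open U] >>.
Proof.
apply: (@bplane_sub_sigma _ (@RGenOInfty.G R)).
- exact: RGenOInfty.measurableE.
- move=> _ [a ->]; apply: sub_sigma_algebra => /=.
  apply: open_comp => // x _; exact: cvg_fst.
- move=> _ [a ->]; apply: sub_sigma_algebra => /=.
  apply: open_comp => // x _; exact: cvg_snd.
Qed.

(** Half-open, so that the boxes are closed under intersection, have finite measure, and are mapped
    by the shears of the Euler step onto regions that are again half-open between two graphs. *)
Definition ocbox (p : R * R * (R * R)) : set (plane R) :=
  `]p.1.1, p.1.2]%classic `*` `]p.2.1, p.2.2]%classic.

Lemma ocbox_exhaust (x : R) : exists n : nat, (- n%:R < x <= n%:R).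
Proof.
exists (Num.bound `|x|); move: (archi_boundP (normr_ge0 x)).
by rewrite ltr_norml => /andP[-> /ltW ->].
Qed.

Lemma borel_generated_ocbox :
  (measurable : set (set bplane)) `<=` <<s range ocbox >>.
Proof.
have mU : forall F : nat -> set bplane, (forall n, <<s range ocbox >> (F n)) ->
    <<s range ocbox >> (\bigcup_n F n).
  move=> F mF.
  exact: (@bigcupT_measurable _ (g_sigma_algebraType (range ocbox))).
apply: (@bplane_sub_sigma _ (@ocitv R)) => //.
- move=> _ [[a b] _ <-].
  rewrite (_ : _ @^-1` _ = \bigcup_n ocbox ((a, b), (- n%:R, n%:R))).
    by apply: mU => n; apply: sub_sigma_algebra; eexists.
  apply/seteqP; split=> [[x y] /= xab|[x y] [n _ []]//].
  by have [n yn] := ocbox_exhaust y; exists n => //; split => //=; rewrite in_itv.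
- move=> _ [[a b] _ <-].
  rewrite (_ : _ @^-1` _ = \bigcup_n ocbox ((- n%:R, n%:R), (a, b))).
    by apply: mU => n; apply: sub_sigma_algebra; eexists.
  apply/seteqP; split=> [[x y] /= xab|[x y] [n _ []]//].
  by have [n yn] := ocbox_exhaust x; exists n => //; split => //=; rewrite in_itv.
Qed.

Lemma ball_oobox (x : plane R) (e : R) : 0 < e ->
  exists q : rat * rat * (rat * rat),
   (`]ratr q.1.1, ratr q.1.2[%classic `*` `]ratr q.2.1, ratr q.2.2[%classic) x /\
   `]ratr q.1.1, ratr q.1.2[%classic `*` `]ratr q.2.1, ratr q.2.2[%classic
     `<=` ball x e.
Proof.
case: x => x y e0.
have H (z : R) : exists q : rat * rat, (z \in `]ratr q.1, ratr q.2[) /\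
    `]ratr q.1, ratr q.2[%classic `<=` ball z e.
  have /rat_in_itvoo[a] : (z - e < z)%R by rewrite ltrBlDr ltrDl.
  have /rat_in_itvoo[b] : (z < z + e)%R by rewrite ltrDl.
  rewrite !in_itv/= => /andP[zb be] /andP[ea az].
  exists (a, b); split; first by rewrite in_itv /= az zb.
  move=> w; rewrite /= in_itv/= => /andP[aw wb].
  rewrite -ball_normE /ball_ /= ltr_distlC.
  by rewrite (lt_trans ea aw) (lt_trans wb be).
have [a [xa ax]] := H x.
have [b [yb by_]] := H y.
exists (a, b); split => // -[u v] [/= ua vb]; split.
- exact: ax.
- exact: by_.
Qed.

Lemma open_borel (U : set (plane R)) : open U -> measurable (U : set bplane).
Proof.
move=> oU.
pose F (q : rat * rat * (rat * rat)) : set bplane :=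
   `]ratr q.1.1, ratr q.1.2[%classic `*` `]ratr q.2.1, ratr q.2.2[%classic.
have -> : (U : set bplane) = \bigcup_(q in [set q | F q `<=` U]) F q.
  apply/seteqP; split => [x Ux|x [q qU]]; last exact: qU.
  have /nbhs_ballP[e /= e0 eU] := open_nbhs_nbhs (conj oU Ux).
  have [q [qx qe]] := ball_oobox x e0.
  by exists q => //=; exact: subset_trans eU.
rewrite bigcup_mkcond; apply: countable_bigcupT_measurable => [|q].
  exact: countableP.
case: ifPn => // _.
by apply: measurableX => //; apply: measurable_itv.
Qed.

Lemma continuous_borel (f : plane R -> R) : continuous f ->
  measurable_fun setT (f : bplane -> measurableTypeR R).
Proof.
move=> cf; apply: (measurability (@RGenOInfty.G R)).
  exact: RGenOInfty.measurableE.
move=> _ [_ [a ->] <-]; rewrite setTI; apply: open_borel.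
by apply: open_comp => [x _|]; [exact: cf|by apply: interval_open].
Qed.

Lemma ocbox_setI : setI_closed (range ocbox).
Proof.
move=> _ _ [[[a b] [c d]] _ <-] [[[a' b'] [c' d']] _ <-].
exists ((Num.max a a', Num.min b b'), (Num.max c c', Num.min d d')) => //.
apply/seteqP; split=> -[x y]; rewrite /ocbox /= !in_itv/= !gt_max !le_min.
  by move=> [/andP[/andP[-> ->] /andP[-> ->]] /andP[/andP[-> ->] /andP[-> ->]]].
by move=> [[/andP[-> ->] /andP[-> ->]] [/andP[-> ->] /andP[-> ->]]].
Qed.

End borel_plane.

Section measure_preserving.
Context {R : realType}.
Implicit Types (F G : plane R -> plane R).

Lemma continuous_borel2 F : continuous F ->
  measurable_fun setT (F : bplane -> bplane).
Proof.
move=> cF; apply/measurable_fun_pairP; split.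
- apply: (@continuous_borel R (fst \o F)) => x.
  by apply: continuous_comp; [exact: cF|exact: cvg_fst].
- apply: (@continuous_borel R (snd \o F)) => x.
  by apply: continuous_comp; [exact: cF|exact: cvg_snd].
Qed.

(** [leb2] is an outer measure, the infimum over countable Borel covers, so arbitrary sets are
    allowed: [F] pulls a cover of [A] back to a cover of the preimage with the same total
    measure. *)
Lemma leb2_preimage_le F :
  measurable_fun setT (F : bplane -> bplane) ->
  (forall B : set bplane, measurable B -> bleb (F @^-1` B) = bleb B) ->
  forall A, (leb2 (F @^-1` A) <= leb2 A)%E.
Proof.
move=> mF FE A; apply: le_ereal_inf_tmp => _ [B [mB AB] <-].
apply: ereal_inf_lbound; exists (fun n => F @^-1` B n).
  split; last by move=> x /AB[n _ Bn]; exists n.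
  by move=> n; rewrite -[X in measurable X]setTI; exact: mF.
by apply: eq_eseriesr => n _; exact: FE.
Qed.

Lemma borel_preserving_inv F G : cancel F G -> cancel G F ->
  measurable_fun setT (G : bplane -> bplane) ->
  (forall B : set bplane, measurable B -> bleb (F @^-1` B) = bleb B) ->
  forall B : set bplane, measurable B -> bleb (G @^-1` B) = bleb B.
Proof.
move=> FG GF mG FE B mB.
rewrite -[LHS]FE; last by rewrite -[X in measurable X]setTI; exact: mG.
by congr (bleb _); apply/seteqP; split=> x /=; rewrite FG.
Qed.

Lemma leb2_preimage F G : cancel F G -> cancel G F ->
  continuous F -> continuous G ->
  (forall B : set bplane, measurable B -> bleb (F @^-1` B) = bleb B) ->
  forall A, leb2 (F @^-1` A) = leb2 A.
Proof.
move=> FG GF cF cG FE A.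
have [mF mG] := (continuous_borel2 cF, continuous_borel2 cG).
apply/eqP; rewrite eq_le leb2_preimage_le//=.
rewrite [leLHS](_ : _ = leb2 (G @^-1` (F @^-1` A))); last first.
  by congr leb2; apply/seteqP; split=> x /=; rewrite GF.
by apply: leb2_preimage_le; [exact: mG|exact: (borel_preserving_inv FG GF)].
Qed.

Lemma lplane_measurableP (A : set (lplane R)) : measurable A <->
  forall X : set (plane R), leb2 X = (leb2 (X `&` A) + leb2 (X `&` ~` A))%E.
Proof. by []. Qed.

(** Continuity yields Borel measurability only. For Lebesgue measurable sets the Caratheodory
    criterion is transported: [F] is a bijection that preserves the outer measure of every set, so
    each test set is itself a preimage. *)
Lemma lplane_measurable_preimage F G : cancel F G -> cancel G F ->
  (forall A, leb2 (F @^-1` A) = leb2 A) ->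
  measurable_fun setT (F : lplane R -> lplane R).
Proof.
move=> FG GF FE _ A /lplane_measurableP mA; rewrite setTI.
apply/lplane_measurableP => X.
have XE : X = F @^-1` (G @^-1` X) by apply/seteqP; split=> x /=; rewrite FG.
rewrite XE FE mA preimage_setC -!preimage_setI; congr (_ + _)%E; exact/esym/FE.
Qed.

Lemma inverseK F : bijective F -> cancel F (inverse F).
Proof.
move=> bF x; rewrite /inverse pinvKV ?inE//.
by case: bF => G FG _ a b _ _ /(congr1 G); rewrite !FG.
Qed.

Lemma inverseVK F : bijective F -> cancel (inverse F) F.
Proof.
by move=> bF x; case: (bF) => G FG GF; rewrite -{1}(GF x) inverseK.
Qed.

Lemma inverse_unique F G : cancel F G -> cancel G F -> inverse F = G.
Proof.
move=> FG GF; apply/funext => x.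
by rewrite -{1}(GF x) inverseK//; exists G.
Qed.

(** Entry point for every homeomorphism constructed below: the measure of Borel sets determines the
    outer measure, and with it the Lebesgue measurable case. *)
Lemma homeo_of_borel F G : cancel F G -> cancel G F ->
  continuous F -> continuous G ->
  (forall B : set bplane, measurable B -> bleb (F @^-1` B) = bleb B) ->
  measure_preserving_homeo F.
Proof.
move=> FG GF cF cG FE; have FA := leb2_preimage FG GF cF cG FE.
split.
- by exists G.
- exact: cF.
- by rewrite (inverse_unique FG GF).
- exact: (lplane_measurable_preimage FG GF).
- by move=> A _; exact: FA.
Qed.

Lemma homeo_borel F : measure_preserving_homeo F ->
  forall B : set bplane, measurable B -> bleb (F @^-1` B) = bleb B.
Proof.
move=> [_ cF _ _ FE] B mB.
have := FE _ (borel_lplane mB); rewrite !leb2_borel//.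
by rewrite -[X in measurable X]setTI; exact: (continuous_borel2 cF).
Qed.

Lemma homeo_inverse F : measure_preserving_homeo F ->
  measure_preserving_homeo (inverse F).
Proof.
move=> mF; have [bF cF cG _ _] := mF.
apply: (@homeo_of_borel _ F).
- exact: inverseVK.
- exact: inverseK.
- exact: cG.
- exact: cF.
apply: (@borel_preserving_inv F); [exact: inverseK|exact: inverseVK| |].
- exact: continuous_borel2.
- exact: homeo_borel.
Qed.

Lemma homeo_comp F G : measure_preserving_homeo F ->
  measure_preserving_homeo G -> measure_preserving_homeo (F \o G).
Proof.
move=> mF mG; have [bF cF cF' _ FE] := mF; have [bG cG cG' _ GE] := mG.
apply: (@homeo_of_borel _ (inverse G \o inverse F)).
- by move=> x /=; rewrite !inverseK.
- by move=> x /=; rewrite !inverseVK.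
- by move=> x; apply: continuous_comp; [exact: cG|exact: cF].
- by move=> x; apply: continuous_comp; [exact: cF'|exact: cG'].
- move=> B mB; rewrite comp_preimage (homeo_borel mG); first exact: homeo_borel.
  by rewrite -[X in measurable X]setTI; exact: (continuous_borel2 cF).
Qed.

Lemma lebesgue_measure_reflect (c : R) (A : set (measurableTypeR R)) :
  measurable A -> lebesgue_measure ((fun y => c - y) @^-1` A) = lebesgue_measure A.
Proof.
have mr : measurable_fun setT
    ((fun y => c - y) : measurableTypeR R -> measurableTypeR R).
  exact: measurable_funB.
pose m : {measure set (measurableTypeR R) -> \bar R} :=
  measure_function_pushforward__canonical__measure_function_Measure
    (@lebesgue_measure R) mr.
move=> mA; rewrite [RHS](@lebesgue_measure_unique _ m)// => _ [[a b] _ <-].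
rewrite /m /= /pushforward.
rewrite (_ : _ @^-1` _ = `[c - b, c - a[%classic); last first.
  by apply/seteqP; split => y /=; rewrite !in_itv/= => /andP[ya yb]; apply/andP; split; lra.
rewrite !lebesgue_measure_itv/= !lte_fin ltrD2l ltrN2.
by case: ifP => // _; rewrite -!EFinB; congr _%:E; ring.
Qed.

Lemma bleb_reflect (x : plane R) (B : set bplane) : measurable B ->
  bleb ((fun y : plane R => x - y) @^-1` B) = bleb B.
Proof.
have c : continuous (fun y : plane R => x - y).
  by move=> y; apply: cvgB; [exact: cvg_cst|exact: cvg_id].
have mr := continuous_borel2 c.
pose m : {measure set bplane -> \bar R} :=
  measure_function_pushforward__canonical__measure_function_Measure bleb mr.
move=> mB; symmetry; rewrite -[RHS]/(m B).
apply: product_measure_unique => // A1 A2 mA1 mA2.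
rewrite /m /= /pushforward.
transitivity (bleb (((fun y => x.1 - y) @^-1` A1) `*` ((fun y => x.2 - y) @^-1` A2))).
  by [].
have mr1 (z : R) : measurable_fun setT
    ((fun y => z - y) : measurableTypeR R -> measurableTypeR R).
  exact: measurable_funB.
have mp z (A : set (measurableTypeR R)) : measurable A -> measurable ((fun y => z - y) @^-1` A : set (measurableTypeR R)).
  by move=> mA; rewrite -[X in measurable X]setTI; exact: mr1.
transitivity (@lebesgue_measure R ((fun y => x.1 - y)%R @^-1` A1) *
              @lebesgue_measure R ((fun y => x.2 - y)%R @^-1` A2))%E.
  by apply: product_measure1E; exact: mp.
by congr (_ * _)%E; exact: lebesgue_measure_reflect.
Qed.

(** Composed with a flow map, this makes y |-> x - Phi y, the argument of the kernel,
    measure-preserving. *)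
Lemma homeo_reflect (x : plane R) :
  measure_preserving_homeo (fun y : plane R => x - y).
Proof.
have c : continuous (fun y : plane R => x - y).
  by move=> y; apply: cvgB; [exact: cvg_cst|exact: cvg_id].
apply: (@homeo_of_borel _ (fun y => x - y)).
- by move=> y; rewrite subKr.
- by move=> y; rewrite subKr.
- exact: c.
- exact: c.
- exact: bleb_reflect.
Qed.

End measure_preserving.

(** * The Euclidean norm against the max norm *)

Section enorm.
Context {R : realType}.
Implicit Types (x y z : plane R).

Lemma enorm_ge0 x : 0 <= enorm x.
Proof. exact: sqrtr_ge0. Qed.

Lemma enorm_sqr x : enorm x ^+ 2 = x.1 ^+ 2 + x.2 ^+ 2.
Proof. by rewrite sqr_sqrtr// addr_ge0// sqr_ge0. Qed.

Lemma enormN x : enorm (- x) = enorm x.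
Proof. by rewrite /enorm/= !sqrrN. Qed.

Lemma enormB x y : enorm (x - y) = enorm (y - x).
Proof. by rewrite -enormN opprB. Qed.

Lemma le_enorm (r : R) x : 0 <= r -> x.1 ^+ 2 + x.2 ^+ 2 <= r ^+ 2 -> enorm x <= r.
Proof. by move=> r0 h; rewrite -(@ler_pXn2r _ 2) ?nnegrE ?enorm_ge0// enorm_sqr. Qed.

Lemma ler_enorm1 x : `|x.1| <= enorm x.
Proof.
rewrite -(@ler_pXn2r _ 2) ?nnegrE ?enorm_ge0//.
by rewrite enorm_sqr real_normK ?num_real// lerDl sqr_ge0.
Qed.

Lemma ler_enorm2 x : `|x.2| <= enorm x.
Proof.
rewrite -(@ler_pXn2r _ 2) ?nnegrE ?enorm_ge0//.
by rewrite enorm_sqr real_normK ?num_real// lerDr sqr_ge0.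
Qed.

Lemma ler_norm_enorm x : `|x| <= enorm x.
Proof. by rewrite prod_normE /= ge_max ler_enorm1 ler_enorm2. Qed.

Lemma ler_norm1 x : `|x.1| <= `|x|.
Proof. by rewrite prod_normE le_max lexx. Qed.

Lemma ler_norm2 x : `|x.2| <= `|x|.
Proof. by rewrite prod_normE le_max lexx orbT. Qed.

Lemma ler_prod_norm (r : R) x : `|x.1| <= r -> `|x.2| <= r -> `|x| <= r.
Proof. by rewrite prod_normE ge_max => -> ->. Qed.

Lemma ler_enorm_norm x : enorm x <= 2 * `|x|.
Proof.
apply: le_enorm; first by rewrite mulr_ge0.
have := ler_norm1 x; have := ler_norm2 x.
rewrite -(real_normK (num_real x.1)) -(real_normK (num_real x.2)).
have := normr_ge0 x.1; have := normr_ge0 x.2; nra.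
Qed.

Lemma cauchy_schwarz x y : x.1 * y.1 + x.2 * y.2 <= enorm x * enorm y.
Proof.
have [h|/ltW h] := leP (x.1 * y.1 + x.2 * y.2) 0.
  by rewrite (le_trans h)// mulr_ge0// enorm_ge0.
rewrite -(@ler_pXn2r _ 2) ?nnegrE ?mulr_ge0 ?enorm_ge0//.
rewrite exprMn !enorm_sqr -subr_ge0.
rewrite [leRHS](_ : _ = (x.1 * y.2 - x.2 * y.1) ^+ 2) ?sqr_ge0//; ring.
Qed.

Lemma enorm_triangle x y : enorm (x + y) <= enorm x + enorm y.
Proof.
apply: le_enorm; first by rewrite addr_ge0// enorm_ge0.
rewrite [leRHS]sqrrD !enorm_sqr /=.
by have := cauchy_schwarz x y; lra.
Qed.

Lemma continuous_enorm : continuous (@enorm R).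
Proof.
move=> x; rewrite /enorm.
apply: (@continuous_comp _ _ _ (fun z : plane R => z.1 ^+ 2 + z.2 ^+ 2) Num.sqrt).
  by apply: cvgD; [apply: cvgM; exact: cvg_fst|apply: cvgM; exact: cvg_snd].
exact: sqrt_continuous.
Qed.

End enorm.

(** * Integrals over dyadic shells *)

Section shells.
Context {R : realType}.
Local Open Scope ereal_scope.

Lemma measurable_ball (r : R) :
  measurable ([set w | enorm w <= r]%R : set (@bplane R)).
Proof.
have -> : [set w | enorm w <= r]%R = (@enorm R) @^-1` `]-oo, r]%classic.
  by apply/seteqP; split => x /=; rewrite in_itv.
rewrite -[X in measurable X]setTI.
by apply: continuous_borel => //; exact: continuous_enorm.
Qed.

Lemma bleb_ball (r : R) : (0 <= r)%R ->
  bleb [set w : plane R | enorm w <= r]%R <= (4 * r ^+ 2)%:E.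
Proof.
move=> r0.
have mI : measurable (`[(- r)%R, r]%classic : set (measurableTypeR R)).
  exact: measurable_itv.
pose B : set bplane := `[(- r)%R, r]%classic `*` `[(- r)%R, r]%classic.
have mB : measurable B by apply: measurableX.
apply: (@le_trans _ _ (bleb B)).
  apply: le_measure; rewrite ?inE//; first exact: measurable_ball.
  move=> w /= wr; split; rewrite /= in_itv/= -ler_norml.
  - apply: le_trans wr; exact: ler_enorm1.
  - apply: le_trans wr; exact: ler_enorm2.
have BE : bleb B = @lebesgue_measure R `[(- r)%R, r] * @lebesgue_measure R `[(- r)%R, r].
  exact: product_measure1E.
rewrite BE !lebesgue_measure_itv/= lte_fin.
case: ifPn => [_|_]; last by rewrite mule0 lee_fin mulr_ge0// sqr_ge0.
by rewrite -EFinB -EFinM lee_fin; lra.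
Qed.

(** [f] is dominated by the series of [a k] times the indicator of the disc N <= r k, since every
    point where [f] does not vanish has a suitable k. The k-th disc has measure at most 4 (r k)^2,
    and the integrals sum to a geometric series. This plays the role of polar coordinates. *)
Lemma integral_le_shells d (T : measurableType d) (mu : {measure set T -> \bar R})
    (f N : T -> R) (a r : nat -> R) (c z : R) :
  measurable_fun setT f -> measurable_fun setT N ->
  (forall s : R, 0 <= s -> (mu [set w | (N w <= s)%R] <= (4 * s ^+ 2)%:E)%E)%R ->
  (forall w, 0 <= f w)%R ->
  (forall k, 0 <= a k)%R -> (forall k, 0 <= r k)%R ->
  (forall w, exists k, f w <= a k /\ (f w != 0 -> N w <= r k))%R ->
  (0 <= c)%R -> (0 < z < 1)%R ->
  (forall k, a k * (4 * r k ^+ 2) <= c * z ^+ k)%R ->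
  \int[mu]_w (f w)%:E <= (c / (1 - z))%:E.
Proof.
move=> mf mN muN f0 a0 r0 fa c0 /andP[z0 z1] ac.
pose S k : set T := [set w | (N w <= r k)%R]%R.
pose h k (w : T) := (a k * \1_(S k) w)%:E.
have h0 k w : 0 <= h k w by rewrite lee_fin mulr_ge0.
have mS k : measurable (S k) .
  have -> : S k = setT `&` N @^-1` `]-oo, r k]%classic.
    by apply/seteqP; split => x /=; rewrite in_itv//= => -[].
  exact: mN.
have mh k : measurable_fun setT (h k).
  apply/measurable_EFinP; apply: measurable_funM => //.
apply: (@le_trans _ _ (\int[mu]_w \sum_(0 <= k <oo) h k w)).
  apply: ge0_le_integral => //.
  - by move=> w _; rewrite lee_fin.
  - exact/measurable_EFinP.
  - apply: (@ge0_emeasurable_sum _ _ _ setT h xpredT) => k; [move=> x _ _; exact: h0|move=> _; exact: mh].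
  - move=> w _; have [k [fk wk]] := fa w.
    apply: (@le_trans _ _ (h k w)).
      rewrite /h lee_fin; have [->|fw] := eqVneq (f w) 0%R.
        by rewrite mulr_ge0.
      by rewrite indicE mem_set ?mulr1//; exact: wk.
    apply: le_trans (nneseries_lim_ge k.+1 _); last by move=> i _ _; exact: h0.
    by rewrite big_nat_recr//= leeDr// sume_ge0.
rewrite integral_nneseries//.
have hk k : \int[mu]_w h k w <= (c * z ^+ k)%:E.
  under eq_integral do rewrite /h EFinM.
  rewrite ge0_integralZl ?lee_fin//=; last first.
    by apply/measurable_EFinP.
  rewrite integral_indic// setIT.
  apply: (@le_trans _ _ ((a k)%:E * (4 * r k ^+ 2)%:E)).
    by apply: lee_wpmul2l; [rewrite lee_fin|exact: muN].
  by rewrite -EFinM lee_fin.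
apply: lime_le; first by apply: is_cvg_nneseries => k _ _; exact: integral_ge0.
apply: nearW => n.
apply: (@le_trans _ _ (\sum_(0 <= k < n) (c * z ^+ k)%:E)); first exact: lee_sum.
rewrite sumEFin lee_fin.
by apply: geometric_le_lim => //; rewrite ger0_norm// ltW.
Qed.

End shells.

(** * The regularized kernel and the key estimate *)

Section powers.
Context {R : realType}.
Implicit Types a x : R.

Lemma powR_exprn a x k : 0 <= a -> (a `^ x) ^+ k = (a ^+ k) `^ x.
Proof.
by move=> a0; rewrite -powR_mulrn ?powR_ge0// -powRrM mulrC powRrM powR_mulrn.
Qed.

Lemma powRV a x : 0 <= a -> a^-1 `^ x = a `^ (- x).
Proof. by move=> a0; rewrite -powR_inv1// -powRrM mulN1r. Qed.

End powers.

Section radial.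
Context {R : realType}.
Variable alpha : R.
Hypothesis alpha_itv : 0 < alpha < 1 / 2.
Implicit Types (s t r rho eps : R).

(** At [eps = 0] this is s^-(2 + 2 alpha), the radial factor of the kernel, with value 0 at s = 0
    because the inverse of 0 is 0; monotonicity therefore asks for s^2 + eps^2 > 0. *)
Definition profile eps s : R := ((s ^+ 2 + eps ^+ 2) `^ (1 + alpha))^-1.

Let a0 : 0 < alpha. Proof. by case/andP: alpha_itv. Qed.
Let a1 : alpha < 1 / 2. Proof. by case/andP: alpha_itv. Qed.

Lemma profile_ge0 eps s : 0 <= profile eps s.
Proof. by rewrite invr_ge0 powR_ge0. Qed.

Lemma le_profile eps s t : 0 < s ^+ 2 + eps ^+ 2 -> 0 <= s <= t ->
  profile eps t <= profile eps s.
Proof.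
move=> e0 /andP[s0 st]; rewrite /profile lef_pV2 ?posrE ?powR_gt0//; last first.
  by rewrite (lt_le_trans e0)// lerD2r; nra.
rewrite ge0_ler_powR ?nnegrE ?addr_ge0 ?sqr_ge0 ?ler01 ?(ltW a0)// lerD2r; nra.
Qed.

Lemma profile_le0 eps s : 0 < s -> profile eps s <= profile 0 s.
Proof.
move=> s0; have s20 : 0 < s ^+ 2 by rewrite exprn_gt0.
have e0 := sqr_ge0 eps.
rewrite /profile expr0n addr0 lef_pV2 ?posrE ?powR_gt0//; last by rewrite ltr_wpDr.
by rewrite ge0_ler_powR ?nnegrE ?addr_ge0 ?sqr_ge0 ?ler01 ?(ltW a0)// lerDl.
Qed.

Lemma sqr_powR r : 0 <= r -> (r ^+ 2) `^ (1 + alpha) = r `^ (2 + 2 * alpha).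
Proof.
move=> r0; rewrite -powR_mulrn// -powRrM; congr (_ `^ _); ring.
Qed.

Lemma cube_profile r : 0 < r -> r ^+ 3 * profile 0 r = r `^ (1 - 2 * alpha).
Proof.
move=> r0; rewrite /profile expr0n addr0 sqr_powR ?(ltW r0)//.
rewrite -powR_mulrn ?(ltW r0)// -powRB ?(gt_eqF r0) ?implybT//.
by congr (_ `^ _); ring.
Qed.

Lemma sqr_profile r : 0 < r -> r ^+ 2 * profile 0 r = r `^ (- (2 * alpha)).
Proof.
move=> r0; rewrite /profile expr0n addr0 sqr_powR ?(ltW r0)//.
rewrite -powR_mulrn ?(ltW r0)// -powRB ?(gt_eqF r0) ?implybT//.
by congr (_ `^ _); ring.
Qed.

(** 2^(2 + 2 alpha) <= 8 as alpha < 1/2: the loss across one dyadic shell. *)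
Lemma profile_half r : 0 < r -> profile 0 (r / 2) <= 8 * profile 0 r.
Proof.
move=> r0; have r2 : 0 < r ^+ 2 by rewrite exprn_gt0.
rewrite /profile expr0n !addr0 expr_div_n powRM ?invr_ge0 ?sqr_ge0//.
rewrite invfM mulrC ler_wpM2r ?invr_ge0 ?powR_ge0//.
have -> : (((2 ^+ 2)^-1 : R) `^ (1 + alpha))^-1 = 2 `^ (2 * (1 + alpha)).
  rewrite -powRN -(@powR_mulrn _ 2)// -powRN -powRrM; congr (_ `^ _); ring.
rewrite (_ : 8 = 2 `^ 3%:R :> R); last by rewrite powR_mulrn//; ring.
have h := a1; apply: ler_powR; lra.
Qed.

(** Sums of the geometric series over the shells, here and in [far_bound]. The factor 32 = 4 * 8
    combines the area bound 4 r^2 with the loss 8 of [profile_half]; the two ratios lie below 1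
    because 0 < 2 alpha < 1. *)
Definition near_bound : R := 32 / (1 - 2 `^ (- (1 - 2 * alpha))).
Definition far_bound : R := 32 / (1 - 2 `^ (- (2 * alpha))).

Let powR2N_lt1 (x : R) : 0 < x -> 0 < 2 `^ (- x) < 1.
Proof.
move=> x0; rewrite powR_gt0//= powRN invf_lt1 ?powR_gt0//.
have /(_ 1 2) := @gt0_ltr_powR _ _ x0; rewrite powR1; apply; rewrite ?nnegrE//.
by rewrite ltr1n.
Qed.

Lemma near_bound_gt0 : 0 < near_bound.
Proof.
have h1 := a1; have /powR2N_lt1/andP[_ h] : 0 < 1 - 2 * alpha by lra.
by rewrite divr_gt0// subr_gt0.
Qed.

Lemma far_bound_gt0 : 0 < far_bound.
Proof.
have /powR2N_lt1/andP[_ h] : 0 < 2 * alpha by rewrite mulr_gt0.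
by rewrite divr_gt0// subr_gt0.
Qed.

Lemma ex_shell (u : nat -> bool) : u 0%N -> (exists n, ~~ u n) ->
  exists k, u k /\ ~~ u k.+1.
Proof.
move=> u0 ex; case: (ex_minnP ex) => -[|k]; first by rewrite u0.
move=> uk kmin; exists k; split => //.
by apply/negPn/negP => /kmin; rewrite ltnn.
Qed.

Context d (T : measurableType d) (mu : {measure set T -> \bar R}) (N : T -> R).
Hypothesis mN : measurable_fun setT N.
Hypothesis N0 : forall w, 0 <= N w.
Hypothesis muN : forall s, 0 <= s -> (mu [set w | (N w <= s)%R] <= (4 * s ^+ 2)%:E)%E.

(** The two majorants of the splitting at radius [rho]: [near_part] bounds the kernel inside the
    disc, and [far_part] is, up to a constant, a local Lipschitz constant of the kernel once it is
    flattened inside the disc. *)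
Definition near_part rho s : R := if s < rho then s * profile 0 s else 0.
Definition far_part rho s : R := profile 0 (Num.max s rho).

Lemma near_part_ge0 rho s : 0 <= s -> 0 <= near_part rho s.
Proof. by move=> s0; rewrite /near_part; case: ifP => // _; rewrite mulr_ge0// profile_ge0. Qed.

Lemma measurable_profile eps : measurable_fun setT (profile eps).
Proof.
have -> : profile eps = (fun x => x `^ (- (1 + alpha))) \o (fun s => s ^+ 2 + eps ^+ 2).
  by apply/funext => s /=; rewrite powRN.
apply: measurableT_comp; first exact: measurable_powR.
by apply: measurable_funD => //; exact: measurable_funX.
Qed.

Lemma measurable_near_part rho : measurable_fun setT (near_part rho).
Proof.
apply: measurable_fun_ifT => //.
- exact: measurable_fun_ltr.
- by apply: measurable_funM => //; exact: measurable_profile.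
Qed.

Lemma measurable_far_part rho : measurable_fun setT (far_part rho).
Proof.
apply: (measurableT_comp (f := profile 0)); first exact: measurable_profile.
exact: measurable_maxr.
Qed.

(** Shells of radii rho / 2^k shrink to the singularity. On the shell of radius r the integrand is
    at most r * profile 0 (r / 2), and after multiplication by the area the order is r^3 * profile 0
    r = r^(1 - 2 alpha), which is summable. *)
Lemma integral_near_part rho : 0 < rho ->
  (\int[mu]_w (near_part rho (N w))%:E <= (near_bound * rho `^ (1 - 2 * alpha))%:E)%E.
Proof.
move=> rho0.
have r0 k : 0 < rho / 2 ^+ k by rewrite divr_gt0// exprn_gt0.
have z01 : 0 < 2 `^ (- (1 - 2 * alpha)) < 1 by apply: powR2N_lt1; have := a1; have := a0; lra.
rewrite (_ : near_bound * _ = (32 * rho `^ (1 - 2 * alpha)) / (1 - 2 `^ (- (1 - 2 * alpha)))); last first.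
  by rewrite /near_bound; ring.
apply: (@integral_le_shells _ _ _ mu _ N
  (fun k => rho / 2 ^+ k * profile 0 (rho / 2 ^+ k / 2)) (fun k => rho / 2 ^+ k)) => //.
- by apply: measurableT_comp => //; exact: measurable_near_part.
- by move=> w; exact: near_part_ge0.
- by move=> k; rewrite mulr_ge0 ?profile_ge0// ltW.
- by move=> k; rewrite ltW.
- move=> w; rewrite /near_part; case: ifPn => [wr|_]; last first.
    by exists 0%N; rewrite eqxx; split => //; rewrite mulr_ge0 ?profile_ge0// ltW.
  (* Such a point lies in all the discs, so there is no last one; but [near_part] vanishes there
     through its factor s. *)
  have [Nw|Nw] := eqVneq (N w) 0.
    exists 0%N; rewrite Nw mul0r; split; last by rewrite eqxx.
    by rewrite mulr_ge0 ?profile_ge0// ltW.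
  have Nw0 : 0 < N w by rewrite lt_def Nw N0.
  have [||k [wk wk1]] := @ex_shell (fun k => N w <= rho / 2 ^+ k).
  + by rewrite expr0 divr1 ltW.
  + exists (Num.bound (rho / N w)); rewrite -ltNge ltr_pdivrMr ?exprn_gt0//.
    rewrite mulrC -ltr_pdivrMr//; apply: (lt_le_trans (archi_boundP _)).
      by rewrite divr_ge0// ltW.
    by rewrite -natrX ler_nat ltnW// ltn_expl.
  exists k; split => //.
  apply: ler_pM; rewrite ?profile_ge0//.
  apply: le_profile; first by rewrite expr0n addr0 exprn_gt0// divr_gt0.
  by rewrite ltW ?divr_gt0//=; move: wk1; rewrite -ltNge exprSr invfM mulrA => /ltW.
- by rewrite mulr_ge0// powR_ge0.
- move=> k; set r := rho / 2 ^+ k.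
  apply: (@le_trans _ _ (32 * (r ^+ 3 * profile 0 r))).
    have := profile_half (r0 k); rewrite -/r => h.
    have : 0 <= r ^+ 3 by rewrite exprn_ge0// ltW// r0.
    move: h; rewrite !exprS expr0; nra.
  rewrite cube_profile ?r0// -mulrA ler_wpM2l// /r powRM ?invr_ge0 ?exprn_ge0//; last exact: ltW.
  by rewrite powRV ?exprn_ge0// powR_exprn.
Qed.

(** Shells of radii rho * 2^k go to infinity; the order on the shell of radius r is r^2 * profile 0
    r = r^(-2 alpha). *)
Lemma integral_far_part rho : 0 < rho ->
  (\int[mu]_w (far_part rho (N w))%:E <= (far_bound * rho `^ (- (2 * alpha)))%:E)%E.
Proof.
move=> rho0.
have r0 k : 0 < rho * 2 ^+ k by rewrite mulr_gt0// exprn_gt0.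
have z01 : 0 < 2 `^ (- (2 * alpha)) < 1 by apply: powR2N_lt1; have := a1; have := a0; lra.
rewrite (_ : far_bound * _ = (32 * rho `^ (- (2 * alpha))) / (1 - 2 `^ (- (2 * alpha)))); last first.
  by rewrite /far_bound; ring.
apply: (@integral_le_shells _ _ _ mu _ N
  (fun k => profile 0 (rho * 2 ^+ k / 2)) (fun k => rho * 2 ^+ k)) => //.
- by apply: measurableT_comp => //; exact: measurable_far_part.
- by move=> w; exact: profile_ge0.
- by move=> k; rewrite profile_ge0.
- by move=> k; rewrite ltW.
- move=> w; rewrite /far_part; have [wr|wr] := leP (N w) rho.
    exists 0%N; rewrite expr0 mulr1; split => //.
    apply: le_profile; first by rewrite expr0n addr0 exprn_gt0// divr_gt0.
    by apply/andP; split; lra.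
  have [||k [wk wk1]] := @ex_shell (fun k => rho * 2 ^+ k < N w).
  + by rewrite expr0 mulr1.
  + exists (Num.bound (N w / rho)); rewrite -leNgt mulrC -ler_pdivrMr//.
    apply: ltW; apply: (lt_le_trans (archi_boundP _)).
      by rewrite divr_ge0// ltW.
    by rewrite -natrX ler_nat ltnW// ltn_expl.
  exists k.+1; split => //; last by move=> _; rewrite leNgt.
  rewrite exprSr mulrA mulfK//.
  apply: le_profile; first by rewrite expr0n addr0 exprn_gt0.
  by rewrite !ltW.
- by rewrite mulr_ge0// powR_ge0.
- move=> k; set r := rho * 2 ^+ k.
  apply: (@le_trans _ _ (32 * (r ^+ 2 * profile 0 r))).
    have := profile_half (r0 k); rewrite -/r => h.
    have : 0 <= r ^+ 2 by rewrite sqr_ge0.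
    move: h; nra.
  rewrite sqr_profile ?r0// -mulrA ler_wpM2l// /r powRM ?exprn_ge0//; last exact: ltW.
  by rewrite powR_exprn.
Qed.

End radial.

Section dominated.
Context d (T : measurableType d) {R : realType} (mu : {measure set T -> \bar R}).

Lemma dominated_integrable (f g : T -> R) (C : R) :
  measurable_fun setT f -> measurable_fun setT g ->
  (forall x, `|f x| <= g x) -> (\int[mu]_x (g x)%:E <= C%:E)%E ->
  mu.-integrable setT (EFin \o f).
Proof.
move=> mf mg fg gC.
have g0 x : 0 <= g x by exact: le_trans (fg x).
apply: (@le_integrable _ _ _ _ _ _ _ (EFin \o g)) => //.
- exact/measurable_EFinP.
- by move=> x _ /=; rewrite lee_fin (ger0_norm (g0 x)).
apply/integrableP; split; first exact/measurable_EFinP.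
under eq_integral do rewrite /= ger0_norm//.
by rewrite (le_lt_trans gC)// ltry.
Qed.

Lemma dominated_Rintegral_le (D : set T) (f g : T -> R) (C : R) :
  measurable D ->
  measurable_fun setT f -> measurable_fun setT g ->
  (forall x, `|f x| <= g x) -> (\int[mu]_x (g x)%:E <= C%:E)%E ->
  `|\int[mu]_(x in D) f x| <= C.
Proof.
move=> mD mf mg fg gC.
have g0 x : 0 <= g x by exact: le_trans (fg x).
have fi := dominated_integrable mf mg fg gC.
have fD : mu.-integrable D (EFin \o f) by exact: integrableS fi.
apply: (le_trans (le_normr_Rintegral mD fD)).
rewrite -lee_fin; apply: le_trans gC.
have mnf : measurable_fun D (fun x => `|f x|%:E).
  by apply/measurable_EFinP; apply: measurableT_comp => //; exact: measurable_funTS.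
rewrite /Rintegral fineK; last first.
  have /integrableP[_] := fD.
  rewrite ge0_fin_numE//; exact: integral_ge0.
apply: (@le_trans _ _ (\int[mu]_(x in D) (g x)%:E)%E).
  apply: ge0_le_integral => //.
  - by apply/measurable_EFinP; exact: measurable_funTS.
  - by move=> x _; rewrite lee_fin.
apply: (@ge0_subset_integral _ _ _ mu D setT) => //.
- exact/measurable_EFinP.
- by move=> x _; rewrite lee_fin.
Qed.

End dominated.

Section kernel.
Context {R : realType}.
Variable alpha : R.
Hypothesis alpha_itv : 0 < alpha < 1 / 2.
Implicit Types (s t r rho eps : R) (e w : plane R).

Let a0 : 0 < alpha. Proof. by case/andP: alpha_itv. Qed.
Let a1 : alpha < 1 / 2. Proof. by case/andP: alpha_itv. Qed.

Definition dotp e w : R := e.1 * w.1 + e.2 * w.2.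

Lemma dotpB e w w' : dotp e (w - w') = dotp e w - dotp e w'.
Proof. by rewrite /dotp/=; ring. Qed.

Lemma ler_dotp e w : enorm e <= 1 -> `|dotp e w| <= enorm w.
Proof.
move=> e1; have h := enorm_ge0 w.
rewrite ler_norml; apply/andP; split.
  have := cauchy_schwarz (- e) w; rewrite enormN /dotp /=; nra.
have := cauchy_schwarz e w; rewrite /dotp /=; nra.
Qed.

(** One component of the regularized kernel: [e = (0, -1)] and [e = (1, 0)] give the two components
    of [perp w] times the profile. Keeping [e] free in the unit disc treats both at once. *)
Definition ker eps e w : R := dotp e w * profile alpha eps (enorm w).

(** The profile is frozen inside radius [rho], which makes the kernel Lipschitz; [ker - cut] is
    supported in that disc. *)
Definition cut eps rho e w : R :=
  dotp e w * profile alpha eps (Num.max (enorm w) rho).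

(** Factoring out a^-(1 + alpha) leaves 1 - x^(1 + alpha) with x = a / b in ]0, 1]. As 1 + alpha <=
    2, this is at most 1 - x^2 <= 2 (1 - x). *)
Lemma inv_powR_diff (a b : R) : 0 < a -> a <= b ->
  (a `^ (1 + alpha))^-1 - (b `^ (1 + alpha))^-1 <=
  (a `^ (1 + alpha))^-1 * (2 * ((b - a) / b)).
Proof.
move=> a_gt0 ab; have b_gt0 : 0 < b by lra.
have x1 : 0 < a / b <= 1 by rewrite divr_gt0//= ler_pdivrMr// mul1r.
have bE : (b `^ (1 + alpha))^-1 = (a `^ (1 + alpha))^-1 * (a / b) `^ (1 + alpha).
  rewrite powRM ?invr_ge0 ?(ltW a_gt0) ?(ltW b_gt0)// powRV ?(ltW b_gt0)// powRN.
  by rewrite mulrA mulVf ?mul1r// gt_eqF// powR_gt0.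
rewrite bE -[X in X - _]mulr1 -mulrBr ler_wpM2l ?invr_ge0 ?powR_ge0//.
have h : (a / b) ^+ 2 <= (a / b) `^ (1 + alpha).
  have <- : (a / b) `^ 2%:R = (a / b) ^+ 2.
    by rewrite powR_mulrn// divr_ge0// ltW.
  by apply: (ger_powR x1); have := a1; lra.
have -> : (b - a) / b = 1 - a / b by rewrite mulrBl divff// gt_eqF.
by move: x1 h => /andP[]; set x := a / b; set y := _ `^ _; nra.
Qed.

(** With a = s^2 + eps^2 and b = t^2 + eps^2 one has b - a = (t - s)(t + s) <= 2 t (t - s) and b >=
    t^2: a second factor 2, and a bound uniform in [eps]. *)
Lemma profile_diff eps s t : 0 < s -> s <= t ->
  profile alpha eps s - profile alpha eps t <=
  profile alpha eps s * (4 * ((t - s) / t)).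
Proof.
move=> s0 st; have t0 : 0 < t by lra.
have e0 : 0 <= eps ^+ 2 by rewrite sqr_ge0.
apply: (le_trans (inv_powR_diff _ _)).
- by rewrite ltr_wpDr// exprn_gt0.
- by rewrite lerD2r ler_pXn2r ?nnegrE// ltW.
rewrite ler_wpM2l ?profile_ge0//.
set a := s ^+ 2 + eps ^+ 2; set b := t ^+ 2 + eps ^+ 2.
have b_gt0 : 0 < b by rewrite ltr_wpDr// exprn_gt0.
have -> : 4 * ((t - s) / t) = 2 * (2 * ((t - s) / t)) by ring.
rewrite ler_wpM2l// ler_pdivrMr//.
have z0 : 0 <= (t - s) / t by rewrite divr_ge0// ?subr_ge0// ltW.
have -> : b - a = (t - s) / t * (t * (t + s)).
  by rewrite mulrA divfK ?gt_eqF// /a /b; ring.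
rewrite [2 * _]mulrC -[leRHS]mulrA ler_wpM2l//.
have tt : t * (t + s) <= t * (2 * t) by rewrite ler_wpM2l ?(ltW t0)//; lra.
by rewrite (le_trans tt)// /b mulrCA ler_wpM2l// -expr2 lerDl.
Qed.

Lemma far_part_max rho s : far_part alpha rho s = profile alpha 0 (Num.max s rho).
Proof. by []. Qed.

(** Product rule for the dot product times the profile. The bound rho / 2 on the displacement keeps
    the truncated radius m' at least m / 2, so [profile_half] costs 8 in each term; the first
    contributes 8 and the second 8 * 4 = 32. *)
Lemma cut_lip eps rho e w w' : 0 < rho -> enorm e <= 1 ->
  enorm (w - w') <= rho / 2 ->
  `|cut eps rho e w - cut eps rho e w'| <=
  40 * enorm (w - w') * far_part alpha rho (enorm w).
Proof.
move=> rho0 e1 wr.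
set m := Num.max (enorm w) rho; set m' := Num.max (enorm w') rho.
have mr : rho <= m by rewrite le_max lexx orbT.
have mr' : rho <= m' by rewrite le_max lexx orbT.
have wm : enorm w <= m by rewrite le_max lexx.
have t1 : enorm w <= enorm w' + enorm (w - w').
  by rewrite -{1}(subrK w' w) addrC enorm_triangle.
have t2 : enorm w' <= enorm w + enorm (w - w').
  by rewrite -{1}(subrK w w') addrC enormB enorm_triangle.
have n0 := enorm_ge0 (w - w').
have mm : m <= m' + enorm (w - w').
  by rewrite ge_max; apply/andP; split; [apply: (le_trans t1); rewrite lerD2r le_max lexx|lra].
have mm' : m' <= m + enorm (w - w').
  by rewrite ge_max; apply/andP; split; [apply: (le_trans t2); rewrite lerD2r le_max lexx|lra].
have m0 : 0 < m by lra.
have m2 : 0 < m / 2 by lra.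
have half eta : m / 2 <= eta -> profile alpha eps eta <= 8 * profile alpha 0 m.
  move=> h; have := profile_half alpha_itv m0; apply: le_trans.
  apply: (@le_trans _ _ (profile alpha eps (m / 2))).
    apply: le_profile => //; last by rewrite h ltW.
    by rewrite ltr_wpDr ?sqr_ge0// exprn_gt0.
  exact: profile_le0.
have gm : profile alpha eps m' <= 8 * profile alpha 0 m by apply: half; lra.
have dg : `|profile alpha eps m - profile alpha eps m'| * m <=
    32 * enorm (w - w') * profile alpha 0 m.
  have p0 := profile_ge0 alpha 0 m.
  have [mlem|/ltW mlem] := leP m m'.
    have h := half m ltac:(lra).
    have := profile_diff eps m0 mlem.
    have q0 := profile_ge0 alpha eps m.
    rewrite ger0_norm; last first.
      by rewrite subr_ge0 le_profile ?mlem ?(ltW m0)// ltr_wpDr ?sqr_ge0// exprn_gt0.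
    have -> : (m' - m) / m' = (m' - m) / m' :> R by [].
    have : (m' - m) / m' * m <= enorm (w - w').
      rewrite mulrAC ler_pdivrMr//; last lra.
      have : (m' - m) <= enorm (w - w') by lra.
      nra.
    have : 0 <= (m' - m) / m' by rewrite divr_ge0//; lra.
    set z := _ / _; move: h q0 p0; set u := profile _ _ _; set v := profile _ _ _.
    set u' := profile _ _ _.
    move=> uv u0 v0 z0 zm du.
    have : (u - u') * m <= u * (4 * (z * m)).
      by rewrite !mulrA in du *; rewrite ler_wpM2r// ltW.
    nra.
  have m'0 : 0 < m' by lra.
  have := profile_diff eps m'0 mlem.
  have q0 := profile_ge0 alpha eps m'.
  rewrite distrC ger0_norm; last first.
    by rewrite subr_ge0 le_profile ?mlem ?(ltW m'0)// ltr_wpDr ?sqr_ge0// exprn_gt0.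
  have : (m - m') / m * m <= enorm (w - w').
    by rewrite divfK ?gt_eqF//; lra.
  have : 0 <= (m - m') / m by rewrite divr_ge0//; lra.
  set z := _ / _; move: gm q0 p0; set u := profile _ _ _; set v := profile _ _ _.
  set u' := profile _ _ _.
  move=> uv u0 v0 z0 zm du.
  have : (u - u') * m <= u * (4 * (z * m)).
    by rewrite !mulrA in du *; rewrite ler_wpM2r// ltW.
  nra.
have -> : cut eps rho e w - cut eps rho e w' =
    dotp e (w - w') * profile alpha eps m' +
    dotp e w * (profile alpha eps m - profile alpha eps m').
  by rewrite dotpB /cut -/m -/m'; ring.
apply: (le_trans (ler_normD _ _)); rewrite !normrM.
rewrite (ger0_norm (profile_ge0 _ _ _)) far_part_max -/m.
have d1 := ler_dotp (w - w') e1.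
have d2 := ler_dotp w e1.
have q0 := profile_ge0 alpha eps m'.
have h1 : `|dotp e (w - w')| * profile alpha eps m' <= enorm (w - w') * (8 * profile alpha 0 m).
  exact: ler_pM.
have h2 : `|dotp e w| * `|profile alpha eps m - profile alpha eps m'| <=
    m * `|profile alpha eps m - profile alpha eps m'|.
  by rewrite ler_wpM2r// (le_trans d2).
lra.
Qed.

Lemma ker_cut_near eps rho e w : 0 < rho -> enorm e <= 1 ->
  `|ker eps e w - cut eps rho e w| <= near_part alpha rho (enorm w).
Proof.
move=> rho0 e1; rewrite /ker /cut /near_part.
have [wr|wr] := ltP (enorm w) rho; last by rewrite subrr normr0.
rewrite -mulrBr normrM.
have [w0|w0] := eqVneq (enorm w) 0.
  have := ler_dotp w e1; rewrite w0 normr_le0 => /eqP ->.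
  by rewrite normr0 !mul0r.
have {}w0 : 0 < enorm w by rewrite lt_def w0 enorm_ge0.
apply: ler_pM => //; first exact: ler_dotp.
have h : profile alpha eps rho <= profile alpha eps (enorm w).
  by apply: le_profile; rewrite ?(ltW w0) ?(ltW wr)// ltr_wpDr ?sqr_ge0// exprn_gt0.
have h1 := profile_ge0 alpha eps rho.
have h2 := profile_le0 alpha_itv eps w0.
by rewrite ger0_norm ?subr_ge0//; lra.
Qed.

Lemma ker_near_eq0 eps rho e w : rho <= enorm w -> ker eps e w - cut eps rho e w = 0.
Proof. by move=> rw; rewrite /ker /cut max_l// subrr. Qed.

Lemma measurable_dotp e : measurable_fun setT (dotp e : bplane -> measurableTypeR R).
Proof. by apply: measurable_funD; apply: measurable_funM. Qed.

Lemma measurable_enorm : measurable_fun setT (@enorm R : bplane -> measurableTypeR R).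
Proof. by apply: continuous_borel; exact: continuous_enorm. Qed.

Lemma measurable_ker eps e : measurable_fun setT (ker eps e : bplane -> measurableTypeR R).
Proof.
apply: measurable_funM; first exact: measurable_dotp.
by apply: measurableT_comp; [exact: measurable_profile|exact: measurable_enorm].
Qed.

Lemma measurable_cut eps rho e : measurable_fun setT (cut eps rho e : bplane -> measurableTypeR R).
Proof.
apply: measurable_funM; first exact: measurable_dotp.
apply: measurableT_comp; first exact: measurable_profile.
by apply: measurable_maxr => //; exact: measurable_enorm.
Qed.

End kernel.

Section Rintegral_extra.
Context d (T : measurableType d) {R : realType} (mu : {measure set T -> \bar R}).
Implicit Types (D : set T).

Lemma Rintegral_split3 D (k n1 n2 g : T -> R) : measurable D ->
  mu.-integrable setT (EFin \o n1) -> mu.-integrable setT (EFin \o n2) ->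
  mu.-integrable setT (EFin \o g) ->
  (forall y, k y = n1 y - n2 y + g y) ->
  \int[mu]_(y in D) k y = \int[mu]_(y in D) n1 y - \int[mu]_(y in D) n2 y +
    \int[mu]_(y in D) g y.
Proof.
move=> mD j1 j2 j3 kE.
have S f : mu.-integrable setT f -> mu.-integrable D f by exact: integrableS.
have i1 := S _ j1; have i2 := S _ j2; have i3 := S _ j3.
rewrite -RintegralB// -RintegralD//; last exact: (integrableB mD i1 i2).
by apply: eq_Rintegral => y _; rewrite kE.
Qed.

(** [D] is a slice and [P] the ball. Both integrands vanish off [P], so restricting them to [D]
    either changes nothing or leaves zero. *)
Lemma Rintegral_dichotomy D (n1 n2 : T -> R) (P : T -> Prop) :
  (forall y, P y \/ (n1 y = 0 /\ n2 y = 0)) ->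
  (forall y, P y -> D y) \/ (forall y, P y -> ~ D y) ->
  \int[mu]_y n1 y = \int[mu]_y n2 y ->
  \int[mu]_(y in D) n1 y = \int[mu]_(y in D) n2 y.
Proof.
move=> small [H|H] n12; rewrite !(Rintegral_mkcond _ D).
  have E n : n = n1 \/ n = n2 -> n \_ D = n.
    move=> nE; apply/funext => y; rewrite patchE; case: ifPn => // /negP yD.
    case: (small y) => [/H yO|[h1 h2]]; first by exfalso; apply: yD; rewrite inE.
    by case: nE => ->.
  by rewrite (E n1 (or_introl erefl)) (E n2 (or_intror erefl)).
have E n : n = n1 \/ n = n2 -> n \_ D = cst 0.
  move=> nE; apply/funext => y; rewrite patchE; case: ifPn => //.
  rewrite inE => yD; case: (small y) => [/H //|[h1 h2]].
  by case: nE => ->.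
by rewrite (E n1 (or_introl erefl)) (E n2 (or_intror erefl)).
Qed.

End Rintegral_extra.

Section key.
Context {R : realType}.
Variable alpha : R.
Hypothesis alpha_itv : 0 < alpha < 1 / 2.
Context d (T : measurableType d) (lam : {measure set T -> \bar R}).

(* psi transports lam to the Lebesgue measure of the plane. *)
Definition transports (psi : T -> plane R) : Prop :=
  measurable_fun setT (psi : T -> bplane) /\
  forall B : set bplane, measurable B -> lam (psi @^-1` B) = bleb B.

Implicit Types psi : T -> plane R.

Lemma transports_ball psi (s : R) : transports psi -> 0 <= s ->
  (lam [set y | (enorm (psi y) <= s)%R] <= (4 * s ^+ 2)%:E)%E.
Proof.
move=> [mpsi psiE] s0.
by rewrite -[X in lam X]/(psi @^-1` [set w | enorm w <= s]) psiE ?bleb_ball//;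
  exact: measurable_ball.
Qed.

Lemma measurable_transports psi (h : plane R -> R) : transports psi ->
  measurable_fun setT (h : bplane -> measurableTypeR R) ->
  measurable_fun setT (fun y => h (psi y)).
Proof. by move=> [mpsi _] mh; exact: (measurableT_comp mh mpsi). Qed.

Lemma transports_near psi rho : transports psi -> 0 < rho ->
  (\int[lam]_y (near_part alpha rho (enorm (psi y)))%:E <=
    (near_bound alpha * rho `^ (1 - 2 * alpha))%:E)%E.
Proof.
move=> tpsi rho0; apply: (@integral_near_part _ _ alpha_itv _ _ lam (fun y => enorm (psi y))) => //.
- exact: (measurable_transports tpsi (@measurable_enorm R)).
- by move=> w; exact: enorm_ge0.
- by move=> s s0; exact: transports_ball.
Qed.

Lemma transports_far psi rho : transports psi -> 0 < rho ->
  (\int[lam]_y (far_part alpha rho (enorm (psi y)))%:E <=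
    (far_bound alpha * rho `^ (- (2 * alpha)))%:E)%E.
Proof.
move=> tpsi rho0; apply: (@integral_far_part _ _ alpha_itv _ _ lam (fun y => enorm (psi y))) => //.
- exact: (measurable_transports tpsi (@measurable_enorm R)).
- by move=> w; exact: enorm_ge0.
- by move=> s s0; exact: transports_ball.
Qed.

(** By change of variables both sides are the integral of [h] over the plane. *)
Lemma transports_integral psi1 psi2 (h : plane R -> R) :
  transports psi1 -> transports psi2 ->
  measurable_fun setT (h : bplane -> measurableTypeR R) ->
  lam.-integrable setT (EFin \o (h \o psi1)) ->
  lam.-integrable setT (EFin \o (h \o psi2)) ->
  \int[lam]_y h (psi1 y) = \int[lam]_y h (psi2 y).
Proof.
move=> [m1 t1] [m2 t2] mh i1 i2; rewrite /Rintegral; congr fine.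
have mh' : measurable_fun setT (EFin \o h : bplane -> \bar R) by exact/measurable_EFinP.
have H psi : measurable_fun setT (psi : T -> bplane) ->
    (forall B : set bplane, measurable B -> lam (psi @^-1` B) = bleb B) ->
    lam.-integrable setT (EFin \o (h \o psi)) ->
    (\int[lam]_y (h (psi y))%:E = \int[bleb]_w (h w)%:E)%E.
  move=> mpsi psiE ipsi.
  have := @integral_pushforward _ _ T (@bplane R) R psi mpsi lam setT (EFin \o h) mh' ipsi measurableT.
  rewrite preimage_setT /= => <-.
  pose m := measure_function_pushforward__canonical__measure_function_Measure lam mpsi.
  by apply: (@eq_measure_integral _ _ _ _ bleb m) => A mA _; exact: psiE.
by rewrite H// H.
Qed.

Variables (psi1 psi2 : T -> plane R) (eps : R) (e : plane R).
Hypotheses (t1 : transports psi1) (t2 : transports psi2) (e1 : enorm e <= 1).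
Variables (delta r : R) (Om : set T).
Hypotheses (delta0 : 0 < delta) (r0 : 0 < r) (mOm : measurable Om).
Hypothesis psi12 : forall y, enorm (psi1 y - psi2 y) <= delta.
Hypothesis ball_dichotomy :
  (forall y, enorm (psi1 y) < r -> Om y) \/ (forall y, enorm (psi1 y) < r -> ~ Om y).

Let K := ker alpha eps e.
Let F rho := cut alpha eps rho e.
Let N rho w := K w - F rho w.

Let mK psi : transports psi -> measurable_fun setT (fun y => K (psi y)).
Proof. by move=> tpsi; exact: (measurable_transports tpsi (@measurable_ker R alpha eps e)). Qed.

Let mF rho psi : transports psi -> measurable_fun setT (fun y => F rho (psi y)).
Proof. by move=> tpsi; exact: (measurable_transports tpsi (@measurable_cut R alpha eps rho e)). Qed.

Let mN rho psi : transports psi -> measurable_fun setT (fun y => N rho (psi y)).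
Proof. by move=> tpsi; apply: measurable_funB; [exact: mK|exact: mF]. Qed.

Let mnear rho psi : transports psi ->
  measurable_fun setT (fun y => near_part alpha rho (enorm (psi y))).
Proof.
move=> tpsi; apply: (measurable_transports (h := near_part alpha rho \o @enorm R) tpsi).
by apply: measurableT_comp; [exact: measurable_near_part|exact: measurable_enorm].
Qed.

Let mfar rho psi : transports psi ->
  measurable_fun setT (fun y => far_part alpha rho (enorm (psi y))).
Proof.
move=> tpsi; apply: (measurable_transports (h := far_part alpha rho \o @enorm R) tpsi).
by apply: measurableT_comp; [exact: measurable_far_part|exact: measurable_enorm].
Qed.

Let iN rho psi : 0 < rho -> transports psi ->
  lam.-integrable setT (EFin \o (fun y => N rho (psi y))).
Proof.
move=> rho0 tpsi.
apply: (dominated_integrable (mN rho tpsi) (mnear rho tpsi) _ (transports_near tpsi rho0)).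
by move=> y; exact: ker_cut_near.
Qed.

Let N_le rho psi : 0 < rho -> transports psi ->
  `|\int[lam]_(y in Om) N rho (psi y)| <= near_bound alpha * rho `^ (1 - 2 * alpha).
Proof.
move=> rho0 tpsi.
apply: (dominated_Rintegral_le mOm (mN rho tpsi) (mnear rho tpsi) _ (transports_near tpsi rho0)).
by move=> y; exact: ker_cut_near.
Qed.

Let mfar40 rho : measurable_fun setT (fun y => 40 * delta * far_part alpha rho (enorm (psi1 y))).
Proof. by apply: measurable_funM => //; exact: mfar. Qed.

Let F_dom rho y : 0 < rho -> delta <= rho / 2 ->
  `|F rho (psi1 y) - F rho (psi2 y)| <= 40 * delta * far_part alpha rho (enorm (psi1 y)).
Proof.
move=> rho0 dr; have h := psi12 y.
apply: (le_trans (cut_lip alpha_itv eps rho0 e1 (le_trans h dr))).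
by rewrite ler_wpM2r ?profile_ge0// ler_wpM2l.
Qed.

Let F_int rho : 0 < rho ->
  (\int[lam]_y (40 * delta * far_part alpha rho (enorm (psi1 y)))%:E <=
   (40 * delta * (far_bound alpha * rho `^ (- (2 * alpha))))%:E)%E.
Proof.
move=> rho0; under eq_integral do rewrite EFinM.
rewrite ge0_integralZl ?lee_fin ?mulr_ge0 ?(ltW delta0)//; last 2 first.
- by apply/measurable_EFinP; exact: mfar.
- by move=> y _; rewrite lee_fin profile_ge0.
rewrite [leRHS]EFinM; apply: lee_wpmul2l; last exact: transports_far.
by rewrite lee_fin mulr_ge0// ltW.
Qed.

Let mFF rho : measurable_fun setT (fun y => F rho (psi1 y) - F rho (psi2 y)).
Proof. by apply: measurable_funB; exact: mF. Qed.

Let F_le rho : 0 < rho -> delta <= rho / 2 ->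
  `|\int[lam]_(y in Om) (F rho (psi1 y) - F rho (psi2 y))| <=
  40 * delta * (far_bound alpha * rho `^ (- (2 * alpha))).
Proof.
move=> rho0 dr.
by apply: (dominated_Rintegral_le mOm (mFF rho) (mfar40 rho) _ (F_int rho0)) => y; exact: F_dom.
Qed.

Let iF rho : 0 < rho -> delta <= rho / 2 ->
  lam.-integrable setT (EFin \o (fun y => F rho (psi1 y) - F rho (psi2 y))).
Proof.
move=> rho0 dr.
by apply: (dominated_integrable (mFF rho) (mfar40 rho) _ (F_int rho0)) => y; exact: F_dom.
Qed.

Let splitK rho : 0 < rho -> delta <= rho / 2 ->
  \int[lam]_(y in Om) (K (psi1 y) - K (psi2 y)) =
  \int[lam]_(y in Om) N rho (psi1 y) - \int[lam]_(y in Om) N rho (psi2 y) +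
  \int[lam]_(y in Om) (F rho (psi1 y) - F rho (psi2 y)).
Proof.
move=> rho0 dr.
apply: (Rintegral_split3 mOm (iN rho0 t1) (iN rho0 t2) (iF rho0 dr)) => y.
rewrite /N; move: (K (psi1 y)) (K (psi2 y)) (F rho (psi1 y)) (F rho (psi2 y)) => ? ? ? ?; ring.
Qed.

Lemma key_integrable : lam.-integrable setT
  (EFin \o (fun y => ker alpha eps e (psi1 y) - ker alpha eps e (psi2 y))).
Proof.
(* The smallest radius that [cut_lip] admits for a displacement delta. *)
have rho0 : 0 < 2 * delta by rewrite mulr_gt0.
have dr2 : delta <= 2 * delta / 2 by lra.
have i := integrableD measurableT
  (integrableB measurableT (iN rho0 t1) (iN rho0 t2)) (iF rho0 dr2).
apply: eq_integrable i => // y _ /=; rewrite -EFinB -EFinD; congr _%:E.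
rewrite /N -/K; move: (K (psi1 y)) (K (psi2 y)) (F _ (psi1 y)) (F _ (psi2 y)) => ? ? ? ?; ring.
Qed.

(** Read off the case of a small ball, split at radius 2 delta: 80 is 40 from [cut_lip] times 2 from
    [powr_le], and 8 counts two near parts, the factor 2 in 2 delta, and again 2 from [powr_le]. *)
Definition key_constant : R := 80 * far_bound alpha + 8 * near_bound alpha.

Lemma key_constant_gt0 : 0 < key_constant.
Proof.
by rewrite addr_gt0// mulr_gt0//; [exact: far_bound_gt0|exact: near_bound_gt0].
Qed.

Let powr_le rho : r / 2 <= rho -> rho `^ (- (2 * alpha)) <= 2 * r `^ (- (2 * alpha)).
Proof.
move=> rr; have [a0 a1] := andP alpha_itv.
have r2 : 0 < r / 2 by rewrite divr_gt0.
apply: (@le_trans _ _ ((r / 2) `^ (- (2 * alpha)))).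
  rewrite !powRN lef_pV2 ?posrE ?powR_gt0//; last exact: lt_le_trans rr.
  by apply: ge0_ler_powR; rewrite ?nnegrE ?(ltW r2) ?(le_trans (ltW r2) rr)//; lra.
rewrite powRM ?invr_ge0 ?(ltW r0)// mulrC ler_wpM2r ?powR_ge0// powRV// opprK.
by rewrite -[leRHS]powRr1//; apply: ler_powR; lra.
Qed.

(* Both near parts agree when the dichotomy ball is large compared to delta;    *)
(* otherwise delta^(1 - 2 alpha) is itself of order delta r^(- 2 alpha).        *)
Lemma key_estimate :
  `|\int[lam]_(y in Om) (ker alpha eps e (psi1 y) - ker alpha eps e (psi2 y))| <=
  key_constant * delta * r `^ (- (2 * alpha)).
Proof.
have nb := near_bound_gt0 alpha_itv.
have fb := far_bound_gt0 alpha_itv.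
have p0 := powR_ge0 r (- (2 * alpha)).
have [dr|dr] := leP (4 * delta) r.
  have rho0 : 0 < r / 2 by rewrite divr_gt0.
  have dr2 : delta <= r / 2 / 2 by lra.
  rewrite -/K (splitK rho0 dr2).
  (* Where |psi1| >= r both near parts vanish, since |psi2| >= r - delta >= r / 2 there. Over the
     whole space their integrals agree, as both maps transport the same measure. *)
  have -> : \int[lam]_(y in Om) N (r / 2) (psi1 y) = \int[lam]_(y in Om) N (r / 2) (psi2 y).
    apply: (Rintegral_dichotomy _ ball_dichotomy) => [y|].
      have [|yr] := ltP (enorm (psi1 y)) r; first by left.
      right; split; apply: ker_near_eq0; first lra.
      have := psi12 y; have := enorm_triangle (psi1 y - psi2 y) (psi2 y).
      by rewrite subrK; lra.
    apply: (transports_integral (h := N (r / 2)) t1 t2 _ (iN rho0 t1) (iN rho0 t2)).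
    by apply: measurable_funB; [exact: measurable_ker|exact: measurable_cut].
  rewrite subrr add0r (le_trans (F_le rho0 dr2))//.
  have := powr_le (lexx (r / 2)).
  rewrite /key_constant => h2.
  have : far_bound alpha * (r / 2) `^ (- (2 * alpha)) <= far_bound alpha * (2 * r `^ (- (2 * alpha))).
    by rewrite ler_wpM2l// ltW.
  have : 0 <= near_bound alpha * (delta * r `^ (- (2 * alpha))).
    by rewrite mulr_ge0 ?(ltW nb)// mulr_ge0// ltW.
  set x := far_bound _; set y := (r / 2) `^ _; set z := r `^ _; set n := near_bound _.
  move=> n0 xy.
  have xy' : delta * (x * y) <= delta * (x * (2 * z)) by rewrite ler_wpM2l// ltW.
  lra.
have rho0 : 0 < 2 * delta by rewrite mulr_gt0.
have dr2 : delta <= 2 * delta / 2 by lra.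
have hp : (2 * delta) `^ (- (2 * alpha)) <= 2 * r `^ (- (2 * alpha)) by apply: powr_le; lra.
have E : (2 * delta) `^ (1 - 2 * alpha) = 2 * delta * (2 * delta) `^ (- (2 * alpha)).
  rewrite powRD; last by rewrite (gt_eqF rho0) implybT.
  by rewrite powRr1// ltW.
rewrite -/K (splitK rho0 dr2).
apply: (le_trans (ler_normD _ _)).
apply: (le_trans (lerD (ler_normB _ _) (lexx _))).
apply: (le_trans (lerD (lerD (N_le rho0 t1) (N_le rho0 t2)) (F_le rho0 dr2))).
rewrite E.
have : far_bound alpha * (2 * delta) `^ (- (2 * alpha)) <= far_bound alpha * (2 * r `^ (- (2 * alpha))).
  by rewrite ler_wpM2l// ltW.
have : near_bound alpha * (2 * delta) `^ (- (2 * alpha)) <= near_bound alpha * (2 * r `^ (- (2 * alpha))).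
  by rewrite ler_wpM2l// ltW.
rewrite /key_constant.
set x := far_bound _; set y := _ `^ _; set z := _ `^ _; set n := near_bound _.
move=> ny xy.
have ny' : delta * (n * y) <= delta * (n * (2 * z)) by rewrite ler_wpM2l// ltW.
have xy' : delta * (x * y) <= delta * (x * (2 * z)) by rewrite ler_wpM2l// ltW.
lra.
Qed.

End key.

(** * From a single slice to the whole layer cake *)

Section lower_integral.
Context d (T : measurableType d) {R : realType} (mu : {measure set T -> \bar R}).
Local Open Scope ereal_scope.
Import HBNNSimple.

(** The integral of a nonnegative function is a supremum over simple functions below it, and
    division by c maps those below [W'] to those below [W]. Measurability does not enter, so the
    distance integrand of [L_mu] is covered. *)
Lemma lower_integral_le (W' W : T -> \bar R) (c : R) : (0 < c)%R ->
  (forall x, 0 <= W' x) -> (forall x, 0 <= W x) ->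
  (forall x, W' x <= c%:E * W x) ->
  \int[mu]_x W' x <= c%:E * \int[mu]_x W x.
Proof.
move=> c0 W'0 W0 W'W.
rewrite [leLHS]ge0_integralTE// [X in _ * X]ge0_integralTE//.
apply: ge_ereal_sup => _ [h /= hW' <-].
have ci0 : (0 <= c^-1)%R by rewrite invr_ge0 ltW.
pose h' : {nnsfun T >-> R} := scale_nnsfun h ci0.
rewrite [leLHS](_ : _ = c%:E * sintegral mu h').
  apply: lee_wpmul2l; first by rewrite lee_fin ltW.
  apply: ereal_sup_ubound; exists h' => //= x.
  rewrite EFinM.
  rewrite muleC -lee_pdivlMr ?invr_gt0// invrK.
  by rewrite muleC; exact: le_trans (W'W x).
rewrite sintegralrM muleA -EFinM divff ?mul1e// gt_eqF//.
Qed.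

End lower_integral.

Section ge0_EFin.
Context d (T : measurableType d) {R : realType} (mu : {measure set T -> \bar R}).

Lemma integral_EFinD (f g : T -> R) : measurable_fun setT f -> measurable_fun setT g ->
  (forall x, 0 <= f x) -> (forall x, 0 <= g x) ->
  (\int[mu]_x (f x + g x)%:E = \int[mu]_x (f x)%:E + \int[mu]_x (g x)%:E)%E.
Proof.
move=> mf mg f0 g0; under eq_integral do rewrite EFinD.
apply: ge0_integralD => //; try exact/measurable_EFinP.
- by move=> x _; rewrite lee_fin.
- by move=> x _; rewrite lee_fin.
Qed.

Lemma integral_EFinZ (c : R) (f : T -> R) : 0 <= c -> measurable_fun setT f ->
  (forall x, 0 <= f x) ->
  (\int[mu]_x (c * f x)%:E = c%:E * \int[mu]_x (f x)%:E)%E.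
Proof.
move=> c0 mf f0; under eq_integral do rewrite EFinM.
apply: ge0_integralZl => //; first exact/measurable_EFinP.
by move=> x _; rewrite lee_fin.
Qed.

End ge0_EFin.

Section kernel_bounds.
Context {R : realType}.
Variable alpha : R.
Hypothesis alpha_itv : 0 < alpha < 1 / 2.
Implicit Types (eps : R) (e w : plane R).

Lemma ker_le_near eps e w (s : R) : enorm e <= 1 -> enorm w < s ->
  `|ker alpha eps e w| <= near_part alpha s (enorm w).
Proof.
move=> e1 ws; rewrite /near_part ws /ker normrM (ger0_norm (profile_ge0 _ _ _)).
have [w0|w0] := eqVneq (enorm w) 0.
  have := ler_dotp w e1; rewrite w0 normr_le0 => /eqP ->.
  by rewrite normr0 !mul0r.
have {}w0 : 0 < enorm w by rewrite lt_def w0 enorm_ge0.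
apply: ler_pM; rewrite ?profile_ge0//; first exact: ler_dotp.
exact: profile_le0.
Qed.

Lemma ker_le eps e w : enorm e <= 1 ->
  `|ker alpha eps e w| <= near_part alpha 1 (enorm w) + 1.
Proof.
move=> e1; have [w1|w1] := ltP (enorm w) 1.
  by rewrite (le_trans (ker_le_near eps e1 w1))// lerDl.
rewrite /near_part ltNge w1 /= add0r /ker normrM (ger0_norm (profile_ge0 _ _ _)).
have w0 : 0 < enorm w by rewrite (lt_le_trans _ w1).
apply: (@le_trans _ _ (enorm w * profile alpha 0 (enorm w))).
  by apply: ler_pM; rewrite ?profile_ge0//; [exact: ler_dotp|exact: profile_le0].
rewrite /profile expr0n addr0 ler_pdivrMr ?powR_gt0 ?exprn_gt0// mul1r.
have w2 : enorm w <= enorm w ^+ 2 by rewrite expr2 ler_peMl// ltW.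
apply: (le_trans w2); apply: le1r_powR; first exact: le_trans w2.
by have /andP[a0 _] := alpha_itv; lra.
Qed.

(** Inside radius eps the difference is at most the kernel itself. Outside, [inv_powR_diff] gives s
    * profile 0 s * 2 eps^2 / (s^2 + eps^2) with s = |w|, and s * eps^2 <= eps * s^2 because s >=
    eps. *)
Lemma ker_diff_le eps e w : 0 < eps -> enorm e <= 1 ->
  `|ker alpha eps e w - ker alpha 0 e w| <=
  near_part alpha eps (enorm w) + 2 * eps * far_part alpha eps (enorm w).
Proof.
move=> eps0 e1; rewrite /ker -mulrBr normrM.
have f0 : 0 <= 2 * eps * far_part alpha eps (enorm w).
  by rewrite mulr_ge0 ?profile_ge0// mulr_ge0// ltW.
have [w0|w0] := eqVneq (enorm w) 0.
  have := ler_dotp w e1; rewrite w0 in f0 *; rewrite normr_le0 => /eqP ->.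
  by rewrite normr0 mul0r addr_ge0// near_part_ge0.
have {}w0 : 0 < enorm w by rewrite lt_def w0 enorm_ge0.
have p1 := profile_le0 alpha_itv eps w0.
have p0 := profile_ge0 alpha eps (enorm w).
rewrite distrC (@ger0_norm _ (profile alpha 0 (enorm w) - _)) ?subr_ge0//.
apply: (@le_trans _ _ (enorm w * (profile alpha 0 (enorm w) - profile alpha eps (enorm w)))).
  by rewrite ler_wpM2r ?subr_ge0//; exact: ler_dotp.
have [we|we] := ltP (enorm w) eps.
  rewrite /near_part we (@le_trans _ _ (enorm w * profile alpha 0 (enorm w)))//.
    by rewrite ler_wpM2l ?(ltW w0)//; lra.
  by rewrite lerDl.
rewrite /near_part ltNge we /= add0r /far_part max_l//.
have w20 : 0 < enorm w ^+ 2 by rewrite exprn_gt0.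
have e20 : 0 < eps ^+ 2 by rewrite exprn_gt0.
have := @inv_powR_diff _ _ alpha_itv (enorm w ^+ 2) (enorm w ^+ 2 + eps ^+ 2) w20.
rewrite lerDl => /(_ (ltW e20)).
rewrite addrAC subrr add0r.
have -> : (((enorm w ^+ 2) `^ (1 + alpha))^-1 = profile alpha 0 (enorm w)).
  by rewrite /profile expr0n addr0.
rewrite -/(profile alpha eps (enorm w)) => h.
apply: (@le_trans _ _ (enorm w * (profile alpha 0 (enorm w) * (2 * (eps ^+ 2 / (enorm w ^+ 2 + eps ^+ 2)))))).
  by rewrite ler_wpM2l// ltW.
have q : enorm w * (eps ^+ 2 / (enorm w ^+ 2 + eps ^+ 2)) <= eps.
  rewrite mulrA ler_pdivrMr ?addr_gt0//.
  apply: (@le_trans _ _ (eps * (enorm w ^+ 2))).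
    rewrite -subr_ge0 (_ : _ - _ = enorm w * eps * (enorm w - eps)); last by ring.
    by rewrite !mulr_ge0 ?subr_ge0// ltW.
  by rewrite ler_wpM2l ?(ltW eps0)// lerDl ltW.
have := profile_ge0 alpha 0 (enorm w).
move: q; set z := _ / _; set g := profile _ _ _ => q g0.
have -> : enorm w * (g * (2 * z)) = (2 * g) * (enorm w * z) by ring.
have -> : 2 * eps * g = (2 * g) * eps by ring.
by rewrite ler_wpM2l// mulr_ge0.
Qed.

End kernel_bounds.

Section weighted.
Context {R : realType}.
Variable alpha : R.
Hypothesis alpha_itv : 0 < alpha < 1 / 2.
Context d (T : measurableType d) (lam : {measure set T -> \bar R}).
Variables (th : T -> R) (M : R).
Hypotheses (mth : measurable_fun setT th)
  (ith : lam.-integrable setT (EFin \o th))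
  (M0 : 0 <= M) (thM : {ae lam, forall y, `|th y| <= M}).
Implicit Types (psi : T -> plane R) (eps : R) (e : plane R).

(** A velocity component in Lagrangian labels: the datum [th] stays in place and only the argument
    [psi y] of the kernel moves with the flow. *)
Definition kint eps e psi : R := \int[lam]_y (ker alpha eps e (psi y) * th y).

Lemma weighted_le (g : T -> R) (C : R) : measurable_fun setT g ->
  (forall y, 0 <= g y) -> (\int[lam]_y (g y)%:E <= C%:E)%E ->
  (\int[lam]_y (g y * `|th y|)%:E <= (M * C)%:E)%E.
Proof.
move=> mg g0 gC.
apply: (@le_trans _ _ (\int[lam]_y (M * g y)%:E)%E).
  apply: ae_ge0_le_integral => //.
  - by move=> y _; rewrite lee_fin mulr_ge0.
  - by apply/measurable_EFinP; apply: measurable_funM => //; exact: measurableT_comp.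
  - by move=> y _; rewrite lee_fin mulr_ge0.
  - by apply/measurable_EFinP; exact: measurable_funM.
  - by apply: filterS thM => y yM _; rewrite lee_fin mulrC ler_wpM2r.
by rewrite integral_EFinZ// EFinM; apply: lee_wpmul2l.
Qed.

Definition mass : R := fine (\int[lam]_y `|th y|%:E)%E.

Lemma massE : (\int[lam]_y `|th y|%:E)%E = mass%:E.
Proof.
rewrite /mass fineK//; have /integrableP[_] := ith.
by rewrite ge0_fin_numE//; exact: integral_ge0.
Qed.

Lemma mass_ge0 : 0 <= mass.
Proof. by rewrite /mass fine_ge0// integral_ge0. Qed.

Let mker eps e psi : transports lam psi ->
  measurable_fun setT (fun y => ker alpha eps e (psi y)).
Proof. by move=> tpsi; exact: (measurable_transports tpsi (@measurable_ker R alpha eps e)). Qed.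

Let mnear rho psi : transports lam psi ->
  measurable_fun setT (fun y => near_part alpha rho (enorm (psi y))).
Proof.
move=> tpsi; apply: (measurable_transports (h := near_part alpha rho \o @enorm R) tpsi).
by apply: measurableT_comp; [exact: measurable_near_part|exact: measurable_enorm].
Qed.

Let mfar rho psi : transports lam psi ->
  measurable_fun setT (fun y => far_part alpha rho (enorm (psi y))).
Proof.
move=> tpsi; apply: (measurable_transports (h := far_part alpha rho \o @enorm R) tpsi).
by apply: measurableT_comp; [exact: measurable_far_part|exact: measurable_enorm].
Qed.

Definition kint_bound : R := M * near_bound alpha + mass.

Let dom psi y := near_part alpha 1 (enorm (psi y)) * `|th y| + `|th y|.

Let mdom psi : transports lam psi -> measurable_fun setT (dom psi).
Proof.
move=> tpsi; have mn : measurable_fun setT (fun y => `|th y|) by exact: measurableT_comp.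
by apply: measurable_funD => //; apply: measurable_funM => //; exact: mnear.
Qed.

Let dom_le eps e psi y : enorm e <= 1 -> `|ker alpha eps e (psi y) * th y| <= dom psi y.
Proof.
move=> e1; rewrite normrM /dom -[X in _ + X]mul1r -mulrDl.
by rewrite ler_wpM2r//; exact: ker_le.
Qed.

Let int_dom psi : transports lam psi ->
  (\int[lam]_y (dom psi y)%:E <= kint_bound%:E)%E.
Proof.
move=> tpsi.
have near0 y : 0 <= near_part alpha 1 (enorm (psi y)).
  by rewrite near_part_ge0// enorm_ge0.
have mn : measurable_fun setT (fun y => `|th y|) by exact: measurableT_comp.
rewrite integral_EFinD//; [|by apply: measurable_funM => //; exact: mnear|by move=> y; rewrite mulr_ge0].
rewrite massE /kint_bound EFinD; apply: leeD => //.
apply: weighted_le => //; first exact: mnear.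
have := transports_near alpha_itv tpsi ltr01.
by rewrite powR1 mulr1.
Qed.

Lemma kint_integrable eps e psi : enorm e <= 1 -> transports lam psi ->
  lam.-integrable setT (EFin \o (fun y => ker alpha eps e (psi y) * th y)).
Proof.
move=> e1 tpsi.
apply: (dominated_integrable _ (mdom tpsi) _ (int_dom tpsi)).
  by apply: measurable_funM => //; exact: mker.
by move=> y; exact: dom_le.
Qed.

Lemma kint_le eps e psi : enorm e <= 1 -> transports lam psi ->
  `|kint eps e psi| <= kint_bound.
Proof.
move=> e1 tpsi.
apply: (dominated_Rintegral_le measurableT _ (mdom tpsi) _ (int_dom tpsi)).
  by apply: measurable_funM => //; exact: mker.
by move=> y; exact: dom_le.
Qed.

(** Both contributions of [ker_diff_le] are of order eps^(1 - 2 alpha), the second one as eps *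
    eps^(-2 alpha). *)
Definition reg_rate eps : R :=
  M * ((near_bound alpha + 2 * far_bound alpha) * eps `^ (1 - 2 * alpha)).

Lemma kint_reg eps e psi : 0 < eps -> enorm e <= 1 -> transports lam psi ->
  `|kint eps e psi - kint 0 e psi| <= reg_rate eps.
Proof.
move=> eps0 e1 tpsi.
rewrite /kint -RintegralB//; [|exact: kint_integrable|exact: kint_integrable].
pose g y := near_part alpha eps (enorm (psi y)) + 2 * eps * far_part alpha eps (enorm (psi y)).
have near0 y : 0 <= near_part alpha eps (enorm (psi y)).
  by rewrite near_part_ge0// enorm_ge0.
have f0 y : 0 <= 2 * eps * far_part alpha eps (enorm (psi y)).
  by rewrite mulr_ge0 ?profile_ge0// mulr_ge0// ltW.
have mff : measurable_fun setT (fun y => 2 * eps * far_part alpha eps (enorm (psi y))).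
  by apply: measurable_funM => //; exact: mfar.
have mg : measurable_fun setT g.
  by apply: measurable_funD => //; exact: mnear.
have mn : measurable_fun setT (fun y => `|th y|) by exact: measurableT_comp.
have gth : (\int[lam]_y (g y * `|th y|)%:E <= (reg_rate eps)%:E)%E.
  apply: weighted_le => //; first by move=> y; rewrite addr_ge0.
  rewrite integral_EFinD//; last exact: mnear.
  rewrite (mulrDl (near_bound alpha)) EFinD; apply: leeD; first exact: transports_near.
  rewrite integral_EFinZ//; [|by rewrite mulr_ge0// ltW|exact: mfar|by move=> y; exact: profile_ge0].
  rewrite powRD; last by rewrite (gt_eqF eps0) implybT.
  rewrite powRr1 ?(ltW eps0)//.
  rewrite (_ : 2 * _ * _ = 2 * eps * (far_bound alpha * eps `^ (- (2 * alpha)))); last by ring.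
  rewrite [leRHS]EFinM; apply: lee_wpmul2l; last exact: transports_far.
  by rewrite lee_fin mulr_ge0// ltW.
apply: (dominated_Rintegral_le measurableT _ _ _ gth).
- by apply: measurable_funB; (apply: measurable_funM; [exact: mker|done]).
- exact: measurable_funM.
- move=> y; rewrite -mulrBl normrM ler_wpM2r//; exact: ker_diff_le.
Qed.

End weighted.

Section slices.
Context d (T : measurableType d) d' (L : measurableType d') {R : realType}.
Variables (lam : {sigma_finite_measure set T -> \bar R})
  (nu : {sigma_finite_measure set L -> \bar R}).
Variables (A : set (T * L)) (k : T -> R) (B : R).
Hypotheses (mA : measurable A) (Afin : ((lam \x nu) A < +oo)%E)
  (mk : measurable_fun setT k) (kB : forall y, `|k y| <= B)
  (xfin : forall y, (nu (xsection A y) < +oo)%E).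

Let f (p : T * L) : R := k p.1 * \1_A p.

Let mf : measurable_fun setT f.
Proof.
apply: measurable_funM; last exact: measurable_indic.
exact: (measurableT_comp mk measurable_fst).
Qed.

Let B0 : 0 <= B.
Proof. by have := kB point; exact: le_trans. Qed.

Let intf : (lam \x nu)%E.-integrable setT (EFin \o f).
Proof.
apply: (@dominated_integrable _ _ _ _ f (fun p => B * \1_A p)
  (B * fine ((lam \x nu) A)%E)) => //.
- exact: measurable_funM.
- by move=> p; rewrite normrM (@ger0_norm _ (\1_A p))// ler_wpM2r.
- rewrite integral_EFinZ// integral_indic// setIT EFinM fineK//.
  by rewrite ge0_fin_numE.
Qed.

Definition slice_integral (l : L) : \bar R := (\int[lam]_(y in ysection A l) (k y)%:E)%E.

Let FE y : fubini_F nu (EFin \o f) y = (k y * fine (nu (xsection A y)))%:E.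
Proof.
have xfn : nu (xsection A y) \is a fin_num by rewrite ge0_fin_numE.
rewrite /fubini_F /f /=; under eq_integral do rewrite EFinM.
have -> : (\int[nu]_x ((k y)%:E * (\1_A (y, x))%:E) =
    \int[nu]_x ((k y)%:E * (\1_(xsection A y) x)%:E))%E.
  by apply: eq_integral => x _; rewrite !indicE mem_xsection.
rewrite integralZl//; last first.
  have mx : measurable (xsection A y) by exact: measurable_xsection.
  apply/integrableP; split; first by apply/measurable_EFinP; exact: measurable_indic.
  under eq_integral do rewrite /= ger0_norm//.
  rewrite integral_indic// setIT. exact: xfin.
by rewrite integral_indic ?setIT ?EFinM ?fineK//; exact: measurable_xsection.
Qed.

Let GE l : fubini_G lam (EFin \o f) l = slice_integral l.
Proof.
rewrite /fubini_G /slice_integral /f [RHS]integral_mkcond; apply: eq_integral => y _ /=.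
rewrite patchE indicE mem_ysection; case: ifP => _; first by rewrite mulr1.
by rewrite mulr0.
Qed.

Lemma measurable_slice_integral : measurable_fun setT slice_integral.
Proof.
have := measurable_fubini_G intf; apply: eq_measurable_fun => l _; exact: GE.
Qed.

(** As [k] is bounded and [A] has finite product measure, [k] times the indicator of [A] is
    integrable on the product. Integrating first in the level gives the weight [nu (xsection A y)],
    first in y the slice integrals. *)
Lemma slice_fubini :
  lam.-integrable setT (EFin \o (fun y => k y * fine (nu (xsection A y)))) /\
  (`|\int[lam]_y (k y * fine (nu (xsection A y)))|%:E <=
   \int[nu]_l `|slice_integral l|)%E.
Proof.
have i1 : lam.-integrable setT (EFin \o (fun y => k y * fine (nu (xsection A y)))).
  by have := integrable_fubini_F intf; apply: eq_integrable => // y _; rewrite FE.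
split => //.
have fub := Fubini intf.
have E1 : (\int[lam]_y \int[nu]_l (EFin \o f) (y, l) =
    \int[lam]_y (k y * fine (nu (xsection A y)))%:E)%E.
  by apply: eq_integral => y _; exact: FE.
have E2 : (\int[nu]_l \int[lam]_y (EFin \o f) (y, l) = \int[nu]_l slice_integral l)%E.
  by apply: eq_integral => l _; exact: GE.
rewrite E1 E2 in fub.
have -> : `|\int[lam]_y (k y * fine (nu (xsection A y)))|%:E =
    `|\int[nu]_l slice_integral l|%E.
  rewrite -fub EFin_normr_Rintegral//.
apply: le_abse_integral => //; exact: measurable_slice_integral.
Qed.

End slices.

Section signed_sigma_finite.
Context d (L : measurableType d) {R : realType} (mu : signed_measure L R).
Local Open Scope ereal_scope.

Lemma upper_le_total (A : set L) : upper_variation mu A <= Defs.total_variation mu A.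
Proof. by rewrite /Defs.total_variation leeDl// measure_ge0. Qed.

Lemma lower_le_total (A : set L) : lower_variation mu A <= Defs.total_variation mu A.
Proof. by rewrite /Defs.total_variation leeDr// measure_ge0. Qed.

Lemma upper_sigma_finite : sigma_finite setT (upper_variation mu).
Proof.
have [F UF Ffin] := signed_measure_sigma_finite mu; exists F => // n.
by have [mF Fn] := Ffin n; split => //; exact: le_lt_trans (upper_le_total _) Fn.
Qed.

Lemma lower_sigma_finite : sigma_finite setT (lower_variation mu).
Proof.
have [F UF Ffin] := signed_measure_sigma_finite mu; exists F => // n.
by have [mF Fn] := Ffin n; split => //; exact: le_lt_trans (lower_le_total _) Fn.
Qed.

HB.instance Definition _ := Measure_isSigmaFinite.Build _ _ _
  (upper_variation mu) upper_sigma_finite.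
HB.instance Definition _ := Measure_isSigmaFinite.Build _ _ _
  (lower_variation mu) lower_sigma_finite.

Lemma integral_total_variation (f : L -> \bar R) : measurable_fun setT f ->
  (forall l, 0 <= f l) ->
  \int[upper_variation mu]_l f l + \int[lower_variation mu]_l f l =
  \int[Defs.total_variation mu]_l f l.
Proof.
move=> mf f0.
rewrite -ge0_integral_measure_add//.
apply: eq_measure_integral => A mA _; exact: measure_addE.
Qed.

End signed_sigma_finite.

Section layer_cake_estimate.
Context d (T : measurableType d) d' (L : measurableType d') {R : realType}.
Variables (lam : {sigma_finite_measure set T -> \bar R}) (mu : signed_measure L R).
Variables (Theta : set (T * L)) (th : T -> R).
Hypotheses (mTh : measurable Theta)
  (Thfin : ((lam \x Defs.total_variation mu) Theta < +oo)%E)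
  (thE : forall y, (th y)%:E =
     signed_integral mu (fun l => (\1_(ysection Theta l) y)%:E)).

Let pos y := fine (upper_variation mu (xsection Theta y)).
Let neg y := fine (lower_variation mu (xsection Theta y)).

(** The difference of the two variations of the section is the real number [th y], and no infinite
    value on either side gives a real difference. *)
Lemma layer_cake_split y :
  [/\ (upper_variation mu (xsection Theta y) < +oo)%E,
      (lower_variation mu (xsection Theta y) < +oo)%E &
      th y = pos y - neg y].
Proof.
have I (nu : {measure set L -> \bar R}) :
    (\int[nu]_l (\1_(ysection Theta l) y)%:E = nu (xsection Theta y))%E.
  transitivity (\int[nu]_l (\1_(xsection Theta y) l)%:E)%E; last first.
    by rewrite integral_indic ?setIT//; exact: measurable_xsection.
  by apply: eq_integral => l _; rewrite !indicE mem_xsection mem_ysection.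
have E : (th y)%:E = (upper_variation mu (xsection Theta y) -
    lower_variation mu (xsection Theta y))%E.
  by rewrite thE /signed_integral !I.
have p0 : (0 <= upper_variation mu (xsection Theta y))%E by exact: measure_ge0.
have n0 : (0 <= lower_variation mu (xsection Theta y))%E by exact: measure_ge0.
rewrite /pos /neg; move: E p0 n0.
case: (upper_variation mu _) => [a| |]; case: (lower_variation mu _) => [b| |] //= E _ _.
by split; rewrite ?ltry//; apply: EFin_inj; rewrite E.
Qed.

Let prod_fin (nu : {sigma_finite_measure set L -> \bar R}) :
  (forall A, (nu A <= Defs.total_variation mu A)%E) -> ((lam \x nu) Theta < +oo)%E.
Proof.
move=> nut; apply: le_lt_trans Thfin; rewrite /product_measure1.
apply: ge0_le_integral => //.
- exact: measurable_fun_xsection.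
- exact: measurable_fun_xsection.
- by move=> y _; exact: nut.
Qed.

Variables (k : T -> R) (B : R).
Hypotheses (mk : measurable_fun setT k) (kB : forall y, `|k y| <= B).

(** Fubini is applied to the upper and to the lower variation separately; the two bounds add up
    because the integral is additive in the measure. *)
Lemma layer_cake_fubini :
  (`|\int[lam]_y (k y * th y)|%:E <=
   \int[Defs.total_variation mu]_l `|slice_integral lam Theta k l|)%E.
Proof.
have [i1 h1] := slice_fubini mTh (prod_fin (@upper_le_total _ _ _ mu)) mk kB
  (fun y => let: And3 h _ _ := layer_cake_split y in h).
have [i2 h2] := slice_fubini mTh (prod_fin (@lower_le_total _ _ _ mu)) mk kB
  (fun y => let: And3 _ h _ := layer_cake_split y in h).
have ms := measurable_slice_integral mTh (prod_fin (@upper_le_total _ _ _ mu)) mk kB.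
rewrite -integral_total_variation; last 2 first.
- by apply: measurableT_comp ms.
- by move=> l; exact: abse_ge0.
apply: le_trans (leeD h1 h2).
have -> : \int[lam]_y (k y * th y) = \int[lam]_y (k y * pos y) - \int[lam]_y (k y * neg y).
  rewrite -RintegralB//; apply: eq_Rintegral => y _.
  by have [_ _ ->] := layer_cake_split y; rewrite mulrBr.
by rewrite -EFinD lee_fin ler_normB.
Qed.

End layer_cake_estimate.

Section velocity_estimate.
Context {R : realType}.
Variable alpha : R.
Hypothesis alpha_itv : 0 < alpha < 1 / 2.

Let a0 : 0 < alpha. Proof. by case/andP: alpha_itv. Qed.

(** Turns bounds for every radius below [D] into one for [D]. A finite positive [D] is itself
    admissible, [D = 0] makes the right side infinite, and [D = +oo] forces [G] to be nonpositive by
    letting r grow. *)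
Lemma le_inv_poweR (G c : R) (D : \bar R) : 0 < c -> (0 <= D)%E ->
  (forall r, 0 < r -> (r%:E <= D)%E -> G <= c * r `^ (- (2 * alpha))) ->
  (G%:E <= c%:E * (D `^ (2 * alpha))^-1)%E.
Proof.
move=> c0 D0 H; have a20 : 0 < 2 * alpha by rewrite mulr_gt0.
case: D D0 H => [s| |]//.
- rewrite lee_fin => s0 H; rewrite poweR_EFin inver powR_eq0.
  have [s_eq0|s_neq0] := eqVneq s 0.
    by rewrite (gt_eqF a20)/= mulry gtr0_sg// mul1e leey.
  by rewrite /= -EFinM lee_fin -powRN H// lt_def s_neq0.
- move=> _ H; rewrite poweRyr ?gt_eqF// invey mule0 lee_fin leNgt; apply/negP => G0.
  (* Chosen so that c * r^(-2 alpha) = G / 2, which contradicts the bound on [G]. *)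
  pose r := (2 * c / G) `^ (2 * alpha)^-1.
  have q0 : 0 < 2 * c / G by rewrite divr_gt0// mulr_gt0.
  have r0 : 0 < r by rewrite powR_gt0.
  have := H r r0 (leey _).
  rewrite powRN /r -powRrM mulVf ?gt_eqF// powRr1 ?(ltW q0)//.
  rewrite invf_div mulrA ler_pdivlMr ?mulr_gt0//.
  by nra.
Qed.

Lemma ker_bounded (eps : R) (e w : plane R) : 0 < eps -> enorm e <= 1 ->
  `|ker alpha eps e w| <= profile alpha eps 0 + 1.
Proof.
move=> eps0 e1; have [w1|w1] := ltP (enorm w) 1; last first.
  apply: (le_trans (ker_le alpha_itv eps w e1)).
  by rewrite /near_part ltNge w1 /= lerD2r profile_ge0.
rewrite /ker normrM (ger0_norm (profile_ge0 _ _ _)).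
have h : profile alpha eps (enorm w) <= profile alpha eps 0.
  apply: le_profile => //; last by rewrite lexx enorm_ge0.
  by rewrite expr0n add0r exprn_gt0.
apply: (@le_trans _ _ (1 * profile alpha eps 0)); last by rewrite mul1r lerDl.
apply: ler_pM; rewrite ?profile_ge0//.
by rewrite (le_trans (ler_dotp w e1))// ltW.
Qed.

Lemma reg_rate_small (M : R) : 0 <= M -> forall eta, 0 < eta ->
  exists2 eps, 0 < eps & reg_rate alpha M eps <= eta.
Proof.
move=> M0 eta eta0.
have nb := near_bound_gt0 alpha_itv; have fb := far_bound_gt0 alpha_itv.
set K := M * (near_bound alpha + 2 * far_bound alpha).
have K0 : 0 <= K by rewrite mulr_ge0//; lra.
have K1 : 0 < K + 1 by lra.
have q0 : 0 < 1 - 2 * alpha by have /andP[_ a1] := alpha_itv; lra.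
have e0 : 0 < eta / (K + 1) by rewrite divr_gt0.
(* Solves (K + 1) * eps^(1 - 2 alpha) = eta; the added 1 covers K = 0. *)
exists ((eta / (K + 1)) `^ (1 - 2 * alpha)^-1); first by rewrite powR_gt0.
rewrite /reg_rate mulrA -/K -powRrM mulVf ?gt_eqF// powRr1 ?(ltW e0)//.
by rewrite mulrA ler_pdivrMr// mulrC ler_wpM2l ?(ltW eta0)//; lra.
Qed.

Context d (T : measurableType d) d' (L : measurableType d').
Variables (lam : {sigma_finite_measure set T -> \bar R}) (mu : signed_measure L R).
Variables (Theta : set (T * L)) (th : T -> R) (M : R).
Hypotheses (mTh : measurable Theta)
  (Thfin : ((lam \x Defs.total_variation mu) Theta < +oo)%E)
  (thE : forall y, (th y)%:E =
     signed_integral mu (fun l => (\1_(ysection Theta l) y)%:E))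
  (mth : measurable_fun setT th)
  (ith : lam.-integrable setT (EFin \o th))
  (M0 : 0 <= M) (thM : {ae lam, forall y, `|th y| <= M}).

Variables (psi1 psi2 : T -> plane R) (delta : R) (D : L -> \bar R).
Hypotheses (t1 : transports lam psi1) (t2 : transports lam psi2) (delta0 : 0 < delta)
  (psi12 : forall y, enorm (psi1 y - psi2 y) <= delta)
  (D0 : forall l, (0 <= D l)%E)
  (dichotomy : forall l r, 0 < r -> (r%:E <= D l)%E ->
    (forall y, enorm (psi1 y) < r -> ysection Theta l y) \/
    (forall y, enorm (psi1 y) < r -> ~ ysection Theta l y)).

Let rhs : \bar R := ((key_constant alpha * delta)%:E *
  \int[Defs.total_variation mu]_l (D l `^ (2 * alpha))^-1)%E.

(** Fubini reduces the difference to slice integrals; [key_estimate] bounds the slice l for each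
    radius r <= D l, and [le_inv_poweR] collects these bounds into one in terms of [D l]. *)
Let kint_diff_pos (eps : R) (e : plane R) : 0 < eps -> enorm e <= 1 ->
  (`|kint alpha lam th eps e psi1 - kint alpha lam th eps e psi2|%:E <= rhs)%E.
Proof.
move=> eps0 e1.
pose k y := ker alpha eps e (psi1 y) - ker alpha eps e (psi2 y).
have mker psi : transports lam psi -> measurable_fun setT (fun y => ker alpha eps e (psi y)).
  by move=> tpsi; exact: (measurable_transports tpsi (@measurable_ker R alpha eps e)).
have mk : measurable_fun setT k by apply: measurable_funB; exact: mker.
have kB y : `|k y| <= 2 * (profile alpha eps 0 + 1).
  apply: (le_trans (ler_normB _ _)).
  rewrite mulr_natl mulr2n; exact: lerD (ker_bounded _ eps0 e1) (ker_bounded _ eps0 e1).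
have -> : kint alpha lam th eps e psi1 - kint alpha lam th eps e psi2 =
    \int[lam]_y (k y * th y).
  have ik psi : transports lam psi -> lam.-integrable setT
      (EFin \o (fun y => ker alpha eps e (psi y) * th y)).
    exact: (kint_integrable alpha_itv mth ith M0 thM eps e1).
  rewrite /kint -(RintegralB measurableT (ik _ t1) (ik _ t2)).
  by apply: eq_Rintegral => y _; rewrite /k mulrBl.
apply: (le_trans (layer_cake_fubini mTh Thfin thE mk kB)).
apply: lower_integral_le.
- by rewrite mulr_gt0// key_constant_gt0.
- by move=> l; exact: abse_ge0.
- by move=> l; rewrite inve_ge0 poweR_ge0.
move=> l; rewrite /slice_integral.
have mOm : measurable (ysection Theta l) by exact: measurable_ysection.
have ik := key_integrable alpha_itv eps t1 t2 e1 delta0 psi12.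
have ikl : lam.-integrable (ysection Theta l) (EFin \o k) by exact: integrableS ik.
rewrite -(EFin_normr_Rintegral mOm ikl).
apply: le_inv_poweR => //; first by rewrite mulr_gt0// key_constant_gt0.
move=> r r0 rD.
exact: (key_estimate alpha_itv eps t1 t2 e1 delta0 r0 mOm psi12 (dichotomy r0 rD)).
Qed.

(** [layer_cake_fubini] asks for a bounded kernel, hence eps > 0. The resulting bound does not
    depend on eps, so [kint_reg] carries it over to eps = 0. *)
Lemma kint_diff (eps : R) (e : plane R) : 0 <= eps -> enorm e <= 1 ->
  (`|kint alpha lam th eps e psi1 - kint alpha lam th eps e psi2|%:E <= rhs)%E.
Proof.
rewrite le_eqVlt => /orP[/eqP <-|eps0] e1; last exact: kint_diff_pos.
have pos eta : 0 < eta -> (`|kint alpha lam th eta e psi1 - kint alpha lam th eta e psi2|%:E <= rhs)%E.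
  by move=> eta0; exact: kint_diff_pos.
have rhs0 : (0 <= rhs)%E by apply: le_trans (pos 1 ltr01).
move: rhs0 pos; case: rhs => [s| |]// _ pos; last by rewrite leey.
rewrite lee_fin; apply/ler_addgt0Pr => eta eta0.
have eta2 : 0 < eta / 2 by rewrite divr_gt0.
have [r r0 He] := reg_rate_small M0 eta2.
have := pos _ r0; rewrite lee_fin.
have := kint_reg alpha_itv mth ith M0 thM r0 e1 t1.
have := kint_reg alpha_itv mth ith M0 thM r0 e1 t2.
move: (kint _ _ _ _ _ _) (kint _ _ _ _ _ _) (kint _ _ _ _ _ _) (kint _ _ _ _ _ _).
move=> a b c f h1 h2 h3.
have {}h1 := le_trans h1 He; have {}h2 := le_trans h2 He.
move: h1 h2 h3; rewrite !ler_norml => /andP[? ?] /andP[? ?] /andP[? ?].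
by apply/andP; split; lra.
Qed.

End velocity_estimate.

(** * The symplectic Euler step *)

Section near_identity.
Context {R : realType}.

Lemma lipschitz_continuous (V W : normedModType R) (f : V -> W) (K : R) :
  (forall x y, `|f x - f y| <= K * `|x - y|) -> continuous f.
Proof.
move=> fK x; apply/cvgrPdist_lt => e e0.
have K0 : 0 < `|K| + 1 by rewrite ltr_wpDl.
near=> y; rewrite (le_lt_trans (fK _ _))//.
apply: (@le_lt_trans _ _ ((`|K| + 1) * `|x - y|)).
  by rewrite ler_wpM2r// (le_trans (ler_norm K))// lerDl.
rewrite mulrC -ltr_pdivlMr//; near: y.
by apply: (@cvgr_dist_lt _ _ _ _ _ (fun y => y)); [exact: cvg_id|rewrite divr_gt0].
Unshelve. all: by end_near. Qed.

Definition near_id (kappa : R) (f : R -> R) : Prop :=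
  forall s t, `|(f s - s) - (f t - t)| <= kappa * `|s - t|.

Lemma near_id_increasing kappa (f : R -> R) : kappa <= 1 / 4 -> near_id kappa f ->
  forall s t, s < t -> f s < f t.
Proof.
move=> k4 fk s t st; have := fk t s.
rewrite (ger0_norm (_ : 0 <= t - s)); last by rewrite subr_ge0 ltW.
rewrite ler_norml => /andP[h _].
have : kappa * (t - s) <= 1 / 4 * (t - s) by rewrite ler_wpM2r// subr_ge0 ltW.
lra.
Qed.

Lemma near_id_continuous kappa f : near_id kappa f -> continuous f.
Proof.
move=> fk; apply: (@lipschitz_continuous _ _ _ (kappa + 1)) => s t.
have -> : f s - f t = ((f s - s) - (f t - t)) + (s - t) by ring.
by apply: (le_trans (ler_normD _ _)); rewrite mulrDl mul1r lerD2r; exact: fk.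
Qed.

Lemma near_id_surjective kappa f : kappa <= 1 / 4 -> near_id kappa f ->
  forall v, exists t, f t = v.
Proof.
move=> k4 fk v.
(* Since f moves increments by at most a quarter, f N >= f 0 + 3 N / 4 >= v, and symmetrically at -
   N, so the intermediate value theorem applies. *)
pose N := 2 * (`|v| + `|f 0|).
have N0 : 0 <= N by rewrite mulr_ge0// addr_ge0.
have kN : kappa * N <= 1 / 4 * N by rewrite ler_wpM2r.
have v1 := ler_norm v; have v2 := ler_norm (- v); rewrite normrN in v2.
have f1 := ler_norm (f 0); have f2 := ler_norm (- f 0); rewrite normrN in f2.
have hN : v <= f N.
  have := fk N 0; rewrite !subr0 (ger0_norm N0) ler_norml => /andP[h _].
  rewrite /N in h kN *; lra.
have hN' : f (- N) <= v.
  have := fk (- N) 0; rewrite !subr0 normrN (ger0_norm N0) ler_norml => /andP[_ h].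
  rewrite /N in h kN *; lra.
have [|||c _ fc] := @IVT _ f (- N) N v.
- by rewrite (@le_trans _ _ 0)// oppr_le0.
- by apply: continuous_subspaceT; exact: near_id_continuous fk.
- by rewrite ge_min hN' le_max hN orbT.
by exists c.
Qed.

Lemma near_id_inverse kappa f : kappa <= 1 / 4 -> near_id kappa f ->
  exists g, cancel f g /\ cancel g f.
Proof.
move=> k4 fk; have surj := near_id_surjective k4 fk.
pose g v := sval (cid (surj v)).
have gK : cancel g f by move=> v; exact: (svalP (cid (surj v))).
have inj : injective f.
  move=> s t fst; have := near_id_increasing k4 fk.
  by case: (ltgtP s t) => // st /(_ _ _ st); rewrite fst ltxx.
by exists g; split => // t; apply: inj; rewrite gK.
Qed.

End near_identity.

Section between.
Context {R : realType}.
Let leb := @lebesgue_measure R.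

Definition strip (a b : R) (f g : R -> R) : set (plane R) :=
  [set p | (a < p.1 <= b) /\ (f p.1 < p.2 <= g p.1)].

Lemma measurable_strip a b f g : continuous f -> continuous g ->
  measurable (strip a b f g : set bplane).
Proof.
move=> cf cg.
have m (h : R -> R) : continuous h ->
    measurable_fun setT ((fun p => p.2 - h p.1) : @bplane R -> measurableTypeR R).
  move=> ch; apply: measurable_funB => //.
  apply: (measurableT_comp (f := h)) => //; exact: continuous_measurable_fun.
have -> : strip a b f g = (fst @^-1` `]a, b]%classic) `&`
    ((fun p => p.2 - f p.1) @^-1` `]0, +oo[%classic) `&`
    ((fun p => p.2 - g p.1) @^-1` `]-oo, 0]%classic).
  apply/seteqP; split => -[x y] /=; rewrite /strip /= !in_itv /= !andbT subr_gt0 subr_le0.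
    by move=> [-> /andP[-> ->]].
  by move=> [[-> ->] ->].
apply: measurableI; first apply: measurableI.
- by rewrite -[X in measurable X]setTI; apply: measurable_fst => //; exact: measurable_itv.
- by rewrite -[X in measurable X]setTI; apply: (m f cf) => //; exact: measurable_itv.
- by rewrite -[X in measurable X]setTI; apply: (m g cg) => //; exact: measurable_itv.
Qed.

Lemma bleb_strip a b f g : continuous f -> continuous g -> (forall x, f x <= g x) ->
  bleb (strip a b f g) = (\int[leb]_(x in `[a, b]) (g x - f x))%:E.
Proof.
move=> cf cg fg.
have E : bleb (strip a b f g) = (\int[leb]_x (leb (xsection (strip a b f g) x)))%E by [].
have cgf : continuous (g \- f) by move=> x; apply: cvgB; [exact: cg|exact: cf].
have igf : leb.-integrable `[a, b] (EFin \o (g \- f)).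
  apply: continuous_compact_integrable; first exact: segment_compact.
  exact: continuous_subspaceT.
rewrite E (_ : (\int[leb]_x _ = \int[leb]_(x in `]a, b]) (g x - f x)%:E)%E); last first.
  rewrite [RHS]integral_mkcond; apply: eq_integral => x _; rewrite patchE.
  case: ifPn => [|xab].
    rewrite inE /= in_itv/= => xab.
    have -> : xsection (strip a b f g) x = `]f x, g x]%classic.
      apply/seteqP; split => y; rewrite /xsection /= inE /strip /= in_itv/=; first by case.
      by move=> ?; split.
    rewrite /leb lebesgue_measure_itv/= lte_fin; case: ltP => // gf.
    by congr _%:E; apply/esym/eqP; rewrite subr_eq0 eq_le gf fg.
  have -> : xsection (strip a b f g) x = set0.
    apply/seteqP; split => y // /mem_set; rewrite mem_xsection inE => -[/= xab' _].
    by move: xab; rewrite notin_setE /= in_itv /= xab'.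
  exact: (measure0 (@lebesgue_measure R)).
rewrite integral_itv_obnd_cbnd; last first.
  apply/measurable_EFinP; apply: measurable_funTS.
  exact: (continuous_measurable_fun cgf).
by rewrite /Rintegral fineK//; exact: integrable_fin_num igf.
Qed.

Lemma bleb_swap (B : set bplane) : measurable B ->
  bleb ((fun p : plane R => (p.2, p.1)) @^-1` B) = bleb B.
Proof.
have c : continuous (fun p : plane R => (p.2, p.1)).
  apply: (@lipschitz_continuous _ _ _ _ 1) => -[x y] [x' y']; rewrite mul1r.
  by rewrite !prod_normE /= maxC.
have mr := continuous_borel2 c.
pose m : {measure set bplane -> \bar R} :=
  measure_function_pushforward__canonical__measure_function_Measure bleb mr.
move=> mB; symmetry; rewrite -[RHS]/(m B).
apply: product_measure_unique => // A1 A2 mA1 mA2.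
rewrite /m /= /pushforward.
transitivity (bleb (A2 `*` A1)).
  by congr (bleb _); apply/seteqP; split => -[x y] /= [].
transitivity (leb A2 * leb A1)%E; first by apply: product_measure1E.
by rewrite muleC.
Qed.

End between.

Section symplectic_step.
Context {R : realType}.
Let leb := @lebesgue_measure R.

Lemma borel_ocbox : (measurable : set (set (@bplane R))) = <<s range (@ocbox R) >>.
Proof.
apply/seteqP; split; first exact: borel_generated_ocbox.
apply: smallest_sub; first exact: sigma_algebra_measurable.
by move=> _ [[[a b] [c d]] _ <-]; apply: measurableX; exact: measurable_itv.
Qed.

Lemma bleb_unique (m1 m2 : {measure set (@bplane R) -> \bar R}) :
  (forall p, m1 (ocbox p) = m2 (ocbox p)) -> (forall p, (m1 (ocbox p) < +oo)%E) ->
  forall B : set bplane, measurable B -> m1 B = m2 B.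
Proof.
move=> m12 fin B mB.
apply: (@measure_unique _ R (@bplane R) (range (@ocbox R))
  (fun n => ocbox ((- n%:R, n%:R), (- n%:R, n%:R)))) => //.
- exact: borel_ocbox.
- exact: ocbox_setI.
- rewrite -subTset => -[x y] _; have [n xn] := ocbox_exhaust x; have [k yk] := ocbox_exhaust y.
  exists (maxn n k) => //; split; rewrite /= in_itv/=.
  + case/andP: xn => xn1 xn2; apply/andP; split.
      by apply: le_lt_trans xn1; rewrite lerN2 ler_nat leq_maxl.
    by apply: (le_trans xn2); rewrite ler_nat leq_maxl.
  + case/andP: yk => yk1 yk2; apply/andP; split.
      by apply: le_lt_trans yk1; rewrite lerN2 ler_nat leq_maxr.
    by apply: (le_trans yk2); rewrite ler_nat leq_maxr.
- by move=> _ [p _ <-].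
Qed.

Lemma lipschitz_near_id (kappa : R) (F : plane R -> plane R) :
  (forall x y, `|(F x - x) - (F y - y)| <= kappa * `|x - y|) ->
  forall x y, `|F x - F y| <= (1 + kappa) * `|x - y| /\
    (1 - kappa) * `|x - y| <= `|F x - F y|.
Proof.
move=> H x y; have h := H x y; split.
  have -> : F x - F y = ((F x - x) - (F y - y)) + (x - y).
    by apply: injective_projections => /=; ring.
  by apply: (le_trans (ler_normD _ _)); lra.
have := ler_normB (F x - F y) ((F x - x) - (F y - y)).
have -> : F x - F y - (F x - x - (F y - y)) = x - y.
  by apply: injective_projections => /=; ring.
lra.
Qed.

(** One shear contracts at worst by 1 - k, the other expands at most by 1 + k, and 1 + k <= (1 + 4
    k)(1 - k) for k <= 1/4. *)
Lemma step_distortion (k A B C : R) : 0 <= k -> k <= 1 / 4 -> 0 <= B ->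
  (1 - k) * B <= C -> A <= (1 + k) * B -> A <= (1 + 4 * k) * C.
Proof.
move=> k0 k4 B0 BC AB; apply: (le_trans AB).
apply: (@le_trans _ _ ((1 + 4 * k) * ((1 - k) * B))); last by rewrite ler_wpM2l//; lra.
rewrite mulrA ler_wpM2r//.
have : k * k <= k * (1 / 4) by rewrite ler_wpM2l.
lra.
Qed.

Variables (w1 w2 : plane R -> R) (kappa : R).
Hypotheses (k4 : kappa <= 1 / 4)
  (lip1 : forall x y, `|w1 x - w1 y| <= kappa * `|x - y|)
  (lip2 : forall x y, `|w2 x - w2 y| <= kappa * `|x - y|).
Hypothesis flux : forall a b c d, a <= b -> c <= d ->
  \int[leb]_(x in `[a, b]) (w2 (x, d) - w2 (x, c)) +
  \int[leb]_(y in `[c, d]) (w1 (b, y) - w1 (a, y)) = 0.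

Let norm_vert (x s t : R) : `|((x, s) : plane R) - (x, t)| = `|s - t|.
Proof. by rewrite prod_normE /= subrr normr0 max_r. Qed.

Let norm_horiz (y s t : R) : `|((s, y) : plane R) - (t, y)| = `|s - t|.
Proof. by rewrite prod_normE /= subrr normr0 max_l. Qed.

(** In the mixed coordinates (x, Y) of the step, [p_] recovers the old ordinate from Y and [q_]
    computes the new abscissa from x. Both differ from the identity by a kappa-Lipschitz map and are
    therefore bijections of the line. *)
Let p_ x t := t - w2 (x, t).
Let q_ y s := s + w1 (s, y).

Let p_near x : near_id kappa (p_ x).
Proof.
move=> s t; rewrite -(norm_vert x s t).
have -> : p_ x s - s - (p_ x t - t) = w2 (x, t) - w2 (x, s) by rewrite /p_; ring.
by rewrite distrC; exact: lip2.
Qed.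

Let q_near y : near_id kappa (q_ y).
Proof.
move=> s t; rewrite -(norm_horiz y s t).
have -> : q_ y s - s - (q_ y t - t) = w1 (s, y) - w1 (t, y) by rewrite /q_; ring.
exact: lip1.
Qed.

Let pinv x := sval (cid (near_id_inverse k4 (p_near x))).
Let qinv y := sval (cid (near_id_inverse k4 (q_near y))).
Let pK x : cancel (p_ x) (pinv x). Proof. exact: (svalP (cid (near_id_inverse k4 (p_near x)))).1. Qed.
Let pVK x : cancel (pinv x) (p_ x). Proof. exact: (svalP (cid (near_id_inverse k4 (p_near x)))).2. Qed.
Let qK x : cancel (q_ x) (qinv x). Proof. exact: (svalP (cid (near_id_inverse k4 (q_near x)))).1. Qed.
Let qVK x : cancel (qinv x) (q_ x). Proof. exact: (svalP (cid (near_id_inverse k4 (q_near x)))).2. Qed.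

Let P (z : plane R) : plane R := (z.1, p_ z.1 z.2).
Let Q (z : plane R) : plane R := (q_ z.2 z.1, z.2).
Let Pinv (z : plane R) : plane R := (z.1, pinv z.1 z.2).
Let Qinv (z : plane R) : plane R := (qinv z.2 z.1, z.2).

Let PK : cancel P Pinv. Proof. by move=> [x y]; rewrite /Pinv /= pK. Qed.
Let PVK : cancel Pinv P. Proof. by move=> [x y]; rewrite /P /= pVK. Qed.
Let QK : cancel Q Qinv. Proof. by move=> [x y]; rewrite /Qinv /= qK. Qed.
Let QVK : cancel Qinv Q. Proof. by move=> [x y]; rewrite /Q /= qVK. Qed.

Let Plip x y : `|P x - P y| <= (1 + kappa) * `|x - y| /\
    (1 - kappa) * `|x - y| <= `|P x - P y|.
Proof.
apply: lipschitz_near_id => {}x {}y; apply: ler_prod_norm => /=.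
  by rewrite !subrr normr0; apply: le_trans (lip2 x y).
rewrite /p_ (_ : _ - _ = w2 y - w2 x); first by rewrite distrC.
by case: x y => [a b] [c d] /=; ring.
Qed.

Let Qlip x y : `|Q x - Q y| <= (1 + kappa) * `|x - y| /\
    (1 - kappa) * `|x - y| <= `|Q x - Q y|.
Proof.
apply: lipschitz_near_id => {}x {}y; apply: ler_prod_norm => /=.
  rewrite /q_ (_ : _ - _ = w1 x - w1 y)//.
  by case: x y => [a b] [c d] /=; ring.
by rewrite !subrr normr0; apply: le_trans (lip2 x y).
Qed.

Let inv_continuous F G : cancel G F ->
  (forall x y, (1 - kappa) * `|x - y| <= `|F x - F y|) -> continuous (G : plane R -> plane R).
Proof.
move=> GF H; apply: (@lipschitz_continuous _ _ _ _ (1 - kappa)^-1) => x y.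
have k1 : 0 < 1 - kappa by rewrite subr_gt0 (le_lt_trans k4)// ltr_pdivrMr// mul1r ltr1n.
by rewrite mulrC ler_pdivlMr// mulrC (le_trans (H _ _))// !GF.
Qed.

Let cP : continuous P. Proof. by apply: (@lipschitz_continuous _ _ _ _ (1 + kappa)) => x y; have [] := Plip x y. Qed.
Let cQ : continuous Q. Proof. by apply: (@lipschitz_continuous _ _ _ _ (1 + kappa)) => x y; have [] := Qlip x y. Qed.
Let cPinv : continuous Pinv. Proof. by apply: (inv_continuous PVK) => x y; have [] := Plip x y. Qed.
Let cQinv : continuous Qinv. Proof. by apply: (inv_continuous QVK) => x y; have [] := Qlip x y. Qed.

Let mPinv := continuous_borel2 cPinv.
Let mQinv := continuous_borel2 cQinv.
(** [m1 B] is the area of the image of [B] under [P], and [m2 B] that under [Q], written as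
    push-forwards by the inverses. Their equality says that the step [Q \o Pinv] preserves area. *)
Let m1 : {measure set bplane -> \bar R} :=
  measure_function_pushforward__canonical__measure_function_Measure bleb mPinv.
Let m2 : {measure set bplane -> \bar R} :=
  measure_function_pushforward__canonical__measure_function_Measure bleb mQinv.

Let cslice (h : plane R -> R) : (forall x y, `|h x - h y| <= kappa * `|x - y|) ->
  (forall y, continuous (fun x => h (x, y))) /\ (forall x, continuous (fun y => h (x, y))).
Proof.
move=> hl; split=> z; apply: (@lipschitz_continuous _ _ _ _ kappa) => s t.
  by rewrite -(norm_horiz z s t).
by rewrite -(norm_vert z s t).
Qed.

Let islice a b (h : R -> R) : continuous h -> leb.-integrable `[a, b] (EFin \o h).
Proof.
move=> ch; apply: continuous_compact_integrable; first exact: segment_compact.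
exact: continuous_subspaceT.
Qed.

Let Rint_cst a b (c : R) : a <= b -> \int[leb]_(x in `[a, b]) c = c * (b - a).
Proof.
move=> ab; rewrite Rintegral_cst//.
have := @lebesgue_measure_itv R `[a, b]; rewrite /= lte_fin => E.
transitivity (c * fine (@lebesgue_measure R `[a, b]%classic)); first by [].
rewrite E; case: ltP => [_|ba]; first by rewrite -EFinB.
have -> : a = b by apply/le_anti/andP.
by rewrite /= subrr.
Qed.

(** As [p_ x] is increasing, [P] maps the box onto the region between the graphs of x |-> p_ x c and
    x |-> p_ x d. Its area differs from that of the box by the net flux of [w2] through the
    horizontal sides. *)
Let m1_box a b c d : a <= b -> c <= d -> m1 (ocbox ((a, b), (c, d))) =
  ((d - c) * (b - a) - \int[leb]_(x in `[a, b]) (w2 (x, d) - w2 (x, c)))%:E.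
Proof.
move=> ab cd; rewrite /m1 /= /pushforward.
have cw y : continuous (fun x => p_ x y).
  by move=> x; apply: cvgB; [exact: cvg_cst|exact: (cslice lip2).1].
have -> : Pinv @^-1` ocbox ((a, b), (c, d)) = strip a b (fun x => p_ x c) (fun x => p_ x d).
  have inc x := near_id_increasing k4 (p_near x).
  apply/seteqP; split => -[x y]; rewrite /ocbox /strip /Pinv /= !in_itv/=.
    move=> [-> /andP[h1 h2]]; split => //; rewrite -(pVK x y) inc//=.
    by move: h2; rewrite le_eqVlt => /orP[/eqP ->//|/(inc x)/ltW].
  move=> [-> /andP[h1 h2]]; split => //; apply/andP; split.
    rewrite ltNge; apply/negP; rewrite le_eqVlt => /orP[/eqP E|/(inc x)].
      by move: h1; rewrite -E pVK ltxx.
    by rewrite pVK => /(lt_trans h1); rewrite ltxx.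
  rewrite leNgt; apply/negP => /(inc x); rewrite pVK => /lt_le_trans/(_ h2).
  by rewrite ltxx.
rewrite -[LHS]/(bleb _) bleb_strip//; last first.
  move=> x; move: cd; rewrite le_eqVlt => /orP[/eqP ->//|/(near_id_increasing k4 (p_near x))/ltW//].
congr _%:E; rewrite -Rint_cst// -RintegralB//.
- by apply: eq_Rintegral => x _; rewrite /p_; ring.
- by apply: islice => x; exact: cvg_cst.
- by apply: islice => x; apply: cvgB; exact: (cslice lip2).1.
Qed.

Let m2_box a b c d : a <= b -> c <= d -> m2 (ocbox ((a, b), (c, d))) =
  ((b - a) * (d - c) + \int[leb]_(y in `[c, d]) (w1 (b, y) - w1 (a, y)))%:E.
Proof.
move=> ab cd; rewrite /m2 /= /pushforward.
have cw x : continuous (fun y => q_ y x).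
  by move=> y; apply: cvgD; [exact: cvg_cst|exact: (cslice lip1).2].
have -> : Qinv @^-1` ocbox ((a, b), (c, d)) =
    (fun p : plane R => (p.2, p.1)) @^-1` strip c d (fun y => q_ y a) (fun y => q_ y b).
  have inc y := near_id_increasing k4 (q_near y).
  apply/seteqP; split => -[x y]; rewrite /ocbox /strip /Qinv /= !in_itv/=.
    move=> [/andP[h1 h2] ->]; split => //; rewrite -(qVK y x) inc//=.
    by move: h2; rewrite le_eqVlt => /orP[/eqP ->//|/(inc y)/ltW].
  move=> [-> /andP[h1 h2]]; split => //; apply/andP; split.
    rewrite ltNge; apply/negP; rewrite le_eqVlt => /orP[/eqP E|/(inc y)].
      by move: h1; rewrite -E qVK ltxx.
    by rewrite qVK => /(lt_trans h1); rewrite ltxx.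
  rewrite leNgt; apply/negP => /(inc y); rewrite qVK => /lt_le_trans/(_ h2).
  by rewrite ltxx.
rewrite -[LHS]/(bleb _) bleb_swap; last exact: measurable_strip.
rewrite bleb_strip//; last first.
  move=> y; move: ab; rewrite le_eqVlt => /orP[/eqP ->//|/(near_id_increasing k4 (q_near y))/ltW//].
congr _%:E; rewrite -Rint_cst// -RintegralD//.
- by apply: eq_Rintegral => x _; rewrite /q_; ring.
- by apply: islice => x; exact: cvg_cst.
- by apply: islice => x; apply: cvgB; exact: (cslice lip1).2.
Qed.

(** On a box the two areas differ by the total flux, which is zero; boxes with reversed endpoints
    are empty. *)
Let m12 B : measurable B -> m1 B = m2 B.
Proof.
apply: bleb_unique => -[[a b] [c d]].
  have [ab|ba] := leP a b; last first.
    have -> : ocbox ((a, b), (c, d)) = set0; last by rewrite !measure0.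
    apply/seteqP; split => -[x y] //= []; rewrite /= in_itv /= => /andP[ax xb].
    by have := lt_le_trans ax xb; rewrite ltNge (ltW ba).
  have [cd|dc] := leP c d; last first.
    have -> : ocbox ((a, b), (c, d)) = set0; last by rewrite !measure0.
    apply/seteqP; split => -[x y] //= [_]; rewrite /= in_itv /= => /andP[ax xb].
    by have := lt_le_trans ax xb; rewrite ltNge (ltW dc).
  rewrite m1_box// m2_box//; congr _%:E.
  have := flux ab cd; move: (\int[leb]_(x in _) _) (\int[leb]_(x in _) _) => I J; lra.
have [ab|ba] := leP a b; last first.
  have -> : ocbox ((a, b), (c, d)) = set0; last by rewrite measure0.
  apply/seteqP; split => -[x y] //= []; rewrite /= in_itv /= => /andP[ax xb].
  by have := lt_le_trans ax xb; rewrite ltNge (ltW ba).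
have [cd|dc] := leP c d; last first.
  have -> : ocbox ((a, b), (c, d)) = set0; last by rewrite measure0.
  apply/seteqP; split => -[x y] //= [_]; rewrite /= in_itv /= => /andP[ax xb].
  by have := lt_le_trans ax xb; rewrite ltNge (ltW dc).
by rewrite m1_box// ltry.
Qed.

(* One step of the symplectic Euler scheme: with (x, Y) the mixed coordinates,  *)
(* (x, y) <- (x, Y) and (x, Y) -> (X, Y) distort areas by the same factor,      *)
(* since the field has zero flux through every rectangle.                       *)
Lemma symplectic_step : exists S : plane R -> plane R,
  [/\ measure_preserving_homeo S,
      (forall x y, `|S x - S y| <= (1 + 4 * kappa) * `|x - y|),
      (forall x y, `|x - y| <= (1 + 4 * kappa) * `|S x - S y|) &
      (forall x, exists z, S x = x + (w1 z, w2 z) /\ `|z - x| <= `|w2 z|)].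
Proof.
have k0 : 0 <= kappa.
  have := lip1 (1, 0) 0; rewrite subr0 prod_normE /= normr1 normr0 max_l// mulr1.
  exact: le_trans.
exists (Q \o Pinv); split.
- apply: (@homeo_of_borel _ _ (P \o Qinv)).
  + by move=> x /=; rewrite QK PVK.
  + by move=> x /=; rewrite PK QVK.
  + by move=> x; apply: continuous_comp; [exact: cPinv|exact: cQ].
  + by move=> x; apply: continuous_comp; [exact: cQinv|exact: cP].
  + move=> B mB; rewrite comp_preimage.
    have mQB : measurable (Q @^-1` B : set bplane).
      by rewrite -[X in measurable X]setTI; exact: (continuous_borel2 cQ).
    rewrite -[LHS]/(m1 (Q @^-1` B)) (m12 mQB) /m2 /= /pushforward -comp_preimage.
    by congr (bleb _); apply/seteqP; split => x /=; rewrite QVK.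
- move=> x y /=.
  have [_ h1] := Plip (Pinv x) (Pinv y); rewrite !PVK in h1.
  have [h2 _] := Qlip (Pinv x) (Pinv y).
  exact: step_distortion h1 h2.
- move=> x y /=.
  have [h1 _] := Plip (Pinv x) (Pinv y); rewrite !PVK in h1.
  have [_ h2] := Qlip (Pinv x) (Pinv y).
  exact: step_distortion h2 h1.
- move=> x; exists (Pinv x).
  rewrite [(Q \o Pinv) x]/(Q (Pinv x)); move: (Pinv x) (PVK x) => -[a b] <-.
  rewrite /Q /P /p_ /q_ /=; split.
    by apply: injective_projections => /=; rewrite ?subrK.
  by rewrite norm_vert opprB addrC subrK.
Qed.

End symplectic_step.

(** * Flux and velocity *)

Section fubini_interval.
Context d (T : measurableType d) {R : realType} (lam : {sigma_finite_measure set T -> \bar R}).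
Let leb := @lebesgue_measure R.
Variables (k : R -> T -> R) (th : T -> R) (B a b : R).
Hypotheses (mk : measurable_fun setT (fun p : (measurableTypeR R * T)%type => k p.1 p.2))
  (kB : forall x y, `|k x y| <= B) (mth : measurable_fun setT th)
  (ith : lam.-integrable setT (EFin \o th)) (ab : a <= b).

Let I x := \int[lam]_y (k x y * th y).
Let J y := \int[leb]_(x in `[a, b]) k x y.
Let f (p : measurableTypeR R * T) : R := \1_(`[a, b]%classic) p.1 * (k p.1 p.2 * th p.2).

Let mab : measurable (`[a, b]%classic : set (measurableTypeR R)).
Proof. exact: measurable_itv. Qed.

Let leb_ab : (leb `[a, b]%classic <= (b - a)%:E)%E.
Proof.
have := @lebesgue_measure_itv R `[a, b]; rewrite /= lte_fin /leb => ->.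
by case: ltP => [_|_]; rewrite ?lee_fin ?subr_ge0.
Qed.

Let mind : measurable_fun setT
  (fun p : (measurableTypeR R * T)%type => \1_(`[a, b]%classic) p.1 : R).
Proof.
have m1 := @measurable_indic _ (measurableTypeR R) R setT _ mab.
have m2 := @measurable_fst _ _ (measurableTypeR R) T.
exact: (measurableT_comp m1 m2).
Qed.

Let mf : measurable_fun setT f.
Proof.
apply: measurable_funM; first exact: mind.
apply: measurable_funM => //.
by apply: (measurableT_comp mth); exact: measurable_snd.
Qed.

Let B0 : 0 <= B. Proof. exact: le_trans (kB 0 point). Qed.

Let itf : (leb \x lam)%E.-integrable setT (EFin \o f).
Proof.
pose g (p : measurableTypeR R * T) : R := \1_(`[a, b]%classic) p.1 * (B * `|th p.2|).
have mg : measurable_fun setT g.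
  apply: measurable_funM; first exact: mind.
  apply: measurable_funM => //; apply: measurableT_comp => //.
  by apply: (measurableT_comp mth); exact: measurable_snd.
have g0 p : 0 <= g p by rewrite mulr_ge0// mulr_ge0.
have mnth : measurable_fun setT (fun y => `|th y|) by exact: measurableT_comp.
apply: (@dominated_integrable _ _ _ _ f g ((b - a) * (B * mass lam th))) => //.
  move=> p; rewrite /f /g normrM (@ger0_norm _ (\1__ _))// ler_wpM2l// normrM.
  by rewrite ler_wpM2r.
rewrite fubini_tonelli1; [|exact/measurable_EFinP|by move=> p; rewrite lee_fin].
rewrite /fubini_F /=.
have -> : (\int[leb]_x \int[lam]_y (g (x, y))%:E =
    \int[leb]_x ((B * mass lam th) * \1_(`[a, b]%classic) x)%:E)%E.
  apply: eq_integral => x _; rewrite /g /=.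
  rewrite integral_EFinZ; [|by []|by apply: measurable_funM|by move=> y; rewrite mulr_ge0].
  rewrite integral_EFinZ// (massE ith) -!EFinM; congr _%:E.
  by rewrite mulrC.
rewrite integral_EFinZ//; last by rewrite mulr_ge0// mass_ge0.
rewrite integral_indic// setIT.
apply: (@le_trans _ _ ((B * mass lam th)%:E * (b - a)%:E)%E).
  by apply: lee_wpmul2l; [rewrite lee_fin mulr_ge0// mass_ge0|exact: leb_ab].
by rewrite -EFinM lee_fin mulrC.
Qed.

Let ith_k x : lam.-integrable setT (EFin \o (fun y => k x y * th y)).
Proof.
apply: (@le_integrable _ _ _ _ _ _ _ (EFin \o (fun y => B * th y))) => //.
- apply/measurable_EFinP; apply: measurable_funM => //.
  exact: (measurableT_comp mk (@measurable_pair1 _ _ _ _ x)).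
- by move=> y _ /=; rewrite lee_fin !normrM (ger0_norm B0) ler_wpM2r.
- have := integrableZl measurableT B ith; apply: eq_integrable => // y _.
Qed.

Let FE x : fubini_F lam (EFin \o f) x = (\1_(`[a, b]%classic) x * I x)%:E.
Proof.
rewrite /fubini_F /f /=; under eq_integral do rewrite EFinM.
rewrite integralZl//; last exact: ith_k.
by rewrite EFinM /I /Rintegral fineK//; exact: integrable_fin_num (ith_k x).
Qed.

Let ikx y : leb.-integrable `[a, b] (EFin \o (k ^~ y)).
Proof.
apply: measurable_bounded_integrable => //.
- by apply: (le_lt_trans leb_ab); rewrite ltry.
- apply: measurable_funTS.
  exact: (measurableT_comp mk (@measurable_pair2 _ _ _ _ y)).
- exists B; split; first exact: num_real.
  by move=> M BM x _; rewrite /= (le_trans (kB x y))// ltW.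
Qed.

Let GE y : fubini_G leb (EFin \o f) y = (J y * th y)%:E.
Proof.
rewrite /fubini_G /f /=.
have -> : (\int[leb]_x (\1_(`[a, b]%classic) x * (k x y * th y))%:E =
    \int[leb]_(x in `[a, b]) ((th y)%:E * (k x y)%:E))%E.
  rewrite [RHS]integral_mkcond; apply: eq_integral => x _.
  rewrite patchE indicE; case: ifP => _; last by rewrite mul0r.
  by rewrite mul1r mulrC EFinM.
rewrite integralZl//; last exact: ikx.
by rewrite EFinM muleC /J /Rintegral fineK//; exact: integrable_fin_num (ikx y).
Qed.

(** A bounded [k], an integrable [th] and a bounded interval make the integrand integrable on the
    product. With this the flux through one side of a rectangle is computed label by label. *)
Lemma fubini_interval :
  [/\ leb.-integrable `[a, b] (EFin \o I),
      lam.-integrable setT (EFin \o (fun y => J y * th y)) &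
      \int[leb]_(x in `[a, b]) I x = \int[lam]_y (J y * th y)].
Proof.
have patchI : (EFin \o I) \_ `[a, b]%classic =1 fubini_F lam (EFin \o f).
  move=> x; rewrite FE patchE indicE /=.
  by case: ifP => _; rewrite ?mul1r// mul0r.
split.
- apply/integrable_mkcond => //.
  have := integrable_fubini_F itf; apply: eq_integrable => // x _.
- have mJ : measurable_fun setT (fun y => J y * th y).
    apply/measurable_EFinP; have := measurable_fubini_G itf.
    by apply: eq_measurable_fun => y _; exact: GE.
  have mnth : measurable_fun setT (fun y => `|th y|) by exact: measurableT_comp.
  have K0 : 0 <= B * (b - a) by rewrite mulr_ge0 ?subr_ge0.
  apply: (@dominated_integrable _ _ _ _ _ (fun y => B * (b - a) * `|th y|)
    (B * (b - a) * mass lam th)) => //.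
  + exact: measurable_funM.
  + move=> y; rewrite normrM ler_wpM2r//.
    have -> : J y = \int[leb]_(x in `[a, b]) (k x y * \1_(`[a, b]%classic) x).
      by apply: eq_Rintegral => x xab; rewrite indicE xab mulr1.
    have m1 := @measurable_indic _ (measurableTypeR R) R setT _ mab.
    apply: (@dominated_Rintegral_le _ _ _ leb `[a, b]%classic _
      (fun x => B * \1_(`[a, b]%classic) x)) => //.
    * apply: measurable_funM => //.
      exact: (measurableT_comp mk (@measurable_pair2 _ _ _ _ y)).
    * exact: measurable_funM.
    * by move=> x; rewrite normrM (@ger0_norm _ (\1__ _))// ler_wpM2r.
    rewrite integral_EFinZ// integral_indic// setIT EFinM.
    by apply: lee_wpmul2l; [rewrite lee_fin|exact: leb_ab].
  + by rewrite integral_EFinZ// (massE ith) EFinM.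
- have := Fubini itf => fub; rewrite /Rintegral; congr fine.
  rewrite integral_mkcond.
  transitivity (\int[leb]_x fubini_F lam (EFin \o f) x)%E.
    by apply: eq_integral => x _; exact: patchI.
  rewrite [LHS]fub; apply: eq_integral => y _; exact: GE.
Qed.

End fubini_interval.

Section kernel_primitive.
Context {R : realType}.
Variable alpha : R.
Hypothesis alpha_itv : 0 < alpha < 1 / 2.
Let leb := @lebesgue_measure R.

Let a0 : 0 < alpha. Proof. by case/andP: alpha_itv. Qed.

(** Stream function of the kernel, as a function of the squared distance: its derivative is s^-(1 +
    alpha) / 2, and the chain rule for (t - q)^2 + s supplies the factor 2 (t - q). *)
Definition potential (s : R) : R := - (2 * alpha)^-1 * s `^ (- alpha).

Lemma derive_potential (q s x : R) : 0 < s ->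
  is_derive x 1 (fun t : R => potential ((t - q) ^+ 2 + s))
    ((x - q) * (((x - q) ^+ 2 + s) `^ (1 + alpha))^-1).
Proof.
move=> s0; have y0 : 0 < (x - q) ^+ 2 + s by rewrite ltr_wpDl ?sqr_ge0.
rewrite /potential.
have d1 : is_derive x 1 (fun t : R => (t - q) ^+ 2 + s) (2 * (x - q)).
  apply: is_derive_eq; rewrite /GRing.scale /= ; ring.
have d2 := @is_derive1_powR _ (- alpha) _ y0.
have d3 := @is_derive1_comp _ (fun u : R => u `^ (- alpha))
  (fun t : R => (t - q) ^+ 2 + s) x _ _ d2 d1.
have d4 := @is_deriveZ _ _ _ _ (- (2 * alpha)^-1) _ _ _ d3.
apply: (@is_derive_eq _ _ _ _ _ _ _ _ d4).
rewrite /GRing.scale /= -powRN (_ : - alpha - 1 = - (1 + alpha)); last by ring.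
by field; rewrite gt_eqF.
Qed.

Lemma integral_potential (c q s a b : R) : 0 < s -> a <= b ->
  \int[leb]_(x in `[a, b]) (c * ((x - q) * (((x - q) ^+ 2 + s) `^ (1 + alpha))^-1)) =
  c * (potential ((b - q) ^+ 2 + s) - potential ((a - q) ^+ 2 + s)).
Proof.
move=> s0; rewrite le_eqVlt => /orP[/eqP ->|ab].
  by rewrite set_itv1 Rintegral_set1 subrr mulr0.
pose F : R -> R := c \*: (fun t : R => potential ((t - q) ^+ 2 + s)).
have dF (x : R) : is_derive x (1 : R) F (c * ((x - q) * (((x - q) ^+ 2 + s) `^ (1 + alpha))^-1)).
  exact: (@is_deriveZ _ _ _ _ c _ _ _ (derive_potential q x s0)).
have cF : continuous F.
  by move=> x; apply: differentiable_continuous; apply/derivable1_diffP; apply: ex_derive.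
rewrite mulrBr -/(F b) -/(F a) /Rintegral (@continuous_FTC2 _ _ F)//.
- apply: continuous_subspaceT => x.
  apply: cvgM; first exact: cvg_cst.
  apply: cvgM; first by apply: cvgB; [exact: cvg_id|exact: cvg_cst].
  under eq_fun do rewrite -powRN.
  rewrite -powRN.
  have y0 : 0 < (x - q) ^+ 2 + s by rewrite ltr_wpDl ?sqr_ge0.
  apply: (@continuous_comp _ _ _ (fun t : R => (t - q) ^+ 2 + s) (fun u : R => u `^ (- (1 + alpha)))).
    apply: cvgD; last exact: cvg_cst.
    by apply: cvgM; (apply: cvgB; [exact: cvg_id|exact: cvg_cst]).
  apply: differentiable_continuous; apply/derivable1_diffP.
  by apply: derivable_powR; rewrite in_itv /= y0.
- split; last 2 first.
  + exact: cvg_at_right_filter (cF a).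
  + exact: cvg_at_left_filter (cF b).
  + by move=> x _; apply: ex_derive.
- by move=> x _; rewrite derive1E; apply: derive_val.
Qed.

End kernel_primitive.

Lemma Rintegral4_eq0 d (T : measurableType d) (R : realType)
    (mu : {measure set T -> \bar R}) (f1 f2 g1 g2 : T -> R) :
  mu.-integrable setT (EFin \o f1) -> mu.-integrable setT (EFin \o f2) ->
  mu.-integrable setT (EFin \o g1) -> mu.-integrable setT (EFin \o g2) ->
  (forall y, f1 y - f2 y + (g1 y - g2 y) = 0) ->
  \int[mu]_y f1 y - \int[mu]_y f2 y + (\int[mu]_y g1 y - \int[mu]_y g2 y) = 0.
Proof.
move=> i1 i2 j1 j2 fg0; rewrite -(RintegralB _ i1 i2)// -(RintegralB _ j1 j2)//.
rewrite -RintegralD//; [|exact: (integrableB measurableT i1 i2)|exact: (integrableB measurableT j1 j2)].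
transitivity (\int[mu]_(y in setT) (cst 0 y : R)); last by rewrite Rintegral_cst// mul0r.
by apply: eq_Rintegral => y _; exact: fg0.
Qed.

Section flux.
Context {R : realType}.
Variable alpha : R.
Hypothesis alpha_itv : 0 < alpha < 1 / 2.
Context d (T : measurableType d) (lam : {sigma_finite_measure set T -> \bar R}).
Variables (th : T -> R) (phi : T -> plane R) (eps : R).
Hypotheses (mth : measurable_fun setT th)
  (ith : lam.-integrable setT (EFin \o th)) (eps0 : 0 < eps)
  (mphi : measurable_fun setT (phi : T -> bplane)).
Let leb := @lebesgue_measure R.

Definition field (e z : plane R) : R := kint alpha lam th eps e (fun y => z - phi y).

Let H (z : plane R) (y : T) : R :=
  potential alpha ((z.1 - (phi y).1) ^+ 2 + ((z.2 - (phi y).2) ^+ 2 + eps ^+ 2)).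

Let e1 : plane R := (1, 0).
Let e2 : plane R := (0, -1).

Let ne1 : enorm e1 <= 1. Proof. by rewrite /enorm /= expr1n expr0n addr0 sqrtr1. Qed.
Let ne2 : enorm e2 <= 1. Proof. by rewrite /enorm /= sqrrN expr1n expr0n add0r sqrtr1. Qed.

Let s0 (t : R) : 0 < t ^+ 2 + eps ^+ 2.
Proof. by rewrite ltr_wpDl ?sqr_ge0// exprn_gt0. Qed.

Let J1 a b t y : a <= b ->
  \int[leb]_(x in `[a, b]) ker alpha eps e1 ((x, t) - phi y) = H (b, t) y - H (a, t) y.
Proof.
move=> ab; rewrite /H /= -[RHS]mul1r -(integral_potential alpha_itv _ _ (s0 _) ab).
apply: eq_Rintegral => x _; rewrite /ker /dotp /profile enorm_sqr /= !mul1r mul0r addr0.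
by rewrite addrA.
Qed.

Let J2 a b t y : a <= b ->
  \int[leb]_(x in `[a, b]) ker alpha eps e2 ((t, x) - phi y) = - (H (t, b) y - H (t, a) y).
Proof.
move=> ab; rewrite /H /= !(addrCA ((t - _) ^+ 2)) -[RHS]mulN1r.
rewrite -(integral_potential alpha_itv _ _ (s0 _) ab).
apply: eq_Rintegral => x _; rewrite /ker /dotp /profile enorm_sqr /= mul0r add0r -mulrA.
by rewrite addrCA addrA.
Qed.

Let B := profile alpha eps 0 + 1.

Let kB e z y : enorm e <= 1 -> `|ker alpha eps e (z - phi y)| <= B.
Proof. by move=> h; exact: ker_bounded. Qed.

Let mline1 e t : measurable_fun setT
  (fun p : (measurableTypeR R * T)%type => ker alpha eps e ((p.1, t) - phi p.2)).
Proof.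
apply: (measurableT_comp (f := ker alpha eps e : bplane -> measurableTypeR R)).
  exact: measurable_ker.
have m2 := measurableT_comp mphi (@measurable_snd _ _ (measurableTypeR R) T).
apply/measurable_fun_pairP; split.
- apply: measurable_funB; first exact: measurable_fst.
  exact: (measurableT_comp (@measurable_fst _ _ (measurableTypeR R) (measurableTypeR R)) m2).
- apply: measurable_funB => //.
  exact: (measurableT_comp (@measurable_snd _ _ (measurableTypeR R) (measurableTypeR R)) m2).
Qed.

Let mline2 e t : measurable_fun setT
  (fun p : (measurableTypeR R * T)%type => ker alpha eps e ((t, p.1) - phi p.2)).
Proof.
apply: (measurableT_comp (f := ker alpha eps e : bplane -> measurableTypeR R)).
  exact: measurable_ker.
have m2 := measurableT_comp mphi (@measurable_snd _ _ (measurableTypeR R) T).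
apply/measurable_fun_pairP; split.
- apply: measurable_funB => //.
  exact: (measurableT_comp (@measurable_fst _ _ (measurableTypeR R) (measurableTypeR R)) m2).
- apply: measurable_funB; first exact: measurable_fst.
  exact: (measurableT_comp (@measurable_snd _ _ (measurableTypeR R) (measurableTypeR R)) m2).
Qed.

(** Along a side of the rectangle the normal component of the kernel has the primitive [H], up to
    sign. For each label the four sides thus give differences of [H] at the corners, and each corner
    occurs twice with opposite signs. [fubini_interval] moves the flux inside the integral over the
    labels, and eps > 0 keeps the kernel bounded. *)
Lemma field_flux k a b c d' : a <= b -> c <= d' ->
  \int[leb]_(x in `[a, b]) (k * field e1 (x, d') - k * field e1 (x, c)) +
  \int[leb]_(y in `[c, d']) (k * field e2 (b, y) - k * field e2 (a, y)) = 0.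
Proof.
move=> ab cd.
have [i1 j1 E1] := fubini_interval (k := (fun x y => ker alpha eps e1 ((x, d') - phi y)))
  (mline1 e1 d') (fun x y => kB (x, d') y ne1) mth ith ab.
have [i2 j2 E2] := fubini_interval (k := (fun x y => ker alpha eps e1 ((x, c) - phi y)))
  (mline1 e1 c) (fun x y => kB (x, c) y ne1) mth ith ab.
have [i3 j3 E3] := fubini_interval (k := (fun x y => ker alpha eps e2 ((b, x) - phi y)))
  (mline2 e2 b) (fun x y => kB (b, x) y ne2) mth ith cd.
have [i4 j4 E4] := fubini_interval (k := (fun x y => ker alpha eps e2 ((a, x) - phi y)))
  (mline2 e2 a) (fun x y => kB (a, x) y ne2) mth ith cd.
have mitv (u v : R) : measurable (`[u, v]%classic : set (measurableTypeR R)).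
  exact: measurable_itv.
under eq_Rintegral do rewrite -mulrBr.
under [X in _ + X]eq_Rintegral do rewrite -mulrBr.
rewrite (RintegralZl k (mitv a b) (integrableB (mitv a b) i1 i2)).
rewrite (RintegralZl k (mitv c d') (integrableB (mitv c d') i3 i4)).
rewrite -mulrDr; apply/eqP; rewrite mulf_eq0; apply/orP; right; apply/eqP.
rewrite [X in X + _](RintegralB (mitv a b) i1 i2).
rewrite [X in _ + X](RintegralB (mitv c d') i3 i4).
rewrite [X in X - _ + _]E1 [X in _ - X + _]E2 [X in _ + (X - _)]E3 [X in _ + (_ - X)]E4.
apply: (Rintegral4_eq0 j1 j2 j3 j4) => y.
rewrite !J1// !J2//.
move: (H _ _) (H _ _) (H _ _) (H _ _) (th y) => h1 h2 h3 h4 t; ring.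
Qed.

End flux.

(** * Lebesgue spaces under measure-preserving maps *)

Section Lfun_facts.
Context d (T : measurableType d) {R : realType} (mu : {measure set T -> \bar R}).

Lemma Lfun_oo_bounded (f : T -> R) : f \in Lfun mu +oo%E ->
  exists2 M, 0 <= M & {ae mu, forall y, `|f y| <= M}.
Proof.
move=> fL; have mf : measurable_fun setT f by have /sub_Lfun_mfun := fL; rewrite inE.
have /sub_Lfun_finLfun := fL; rewrite inE /finite_norm /= unlock.
(* The L^oo norm distinguishes a space of measure zero; there every bound holds almost
   everywhere. *)
case: ifPn => [mu0 foo|mu0 _]; last first.
  exists 0 => //; exists setT; split => //.
  by apply/eqP; rewrite eq_le measure_ge0 andbT leNgt.
have h := @ess_sup_ge _ _ _ mu (abse \o (EFin \o f)).
case E : (ess_sup mu (abse \o (EFin \o f))) foo => [s| |]// _.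
- exists (Num.max s 0); first by rewrite le_max lexx orbT.
  by apply: filterS h => y; rewrite E /= lee_fin => /le_trans; apply; rewrite le_max lexx.
- exists 0 => //.
  by apply: filterS h => y; rewrite E.
Qed.

Lemma Lfun1_integrable_fun (f : T -> R) : f \in Lfun mu 1%E ->
  measurable_fun setT f /\ mu.-integrable setT (EFin \o f).
Proof.
move=> fL; have mf : measurable_fun setT f by have /sub_Lfun_mfun := fL; rewrite inE.
split => //; apply/integrableP; split; first exact/measurable_EFinP.
by have /sub_Lfun_finLfun := fL; rewrite inE /finite_norm /= Lnorm1.
Qed.

Lemma Lfun_oo_intro (f : T -> R) M : measurable_fun setT f ->
  {ae mu, forall y, `|f y| <= M} -> f \in Lfun mu +oo%E.
Proof.
move=> mf fM; apply/andP; split; first by rewrite inE.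
rewrite inE /= /finite_norm unlock; case: ifPn => // _.
apply: (@le_lt_trans _ _ M%:E); last by rewrite ltry.
by apply/ess_supP; apply: filterS fM => y; rewrite /= lee_fin.
Qed.

Lemma Lfun1_intro (f : T -> R) : measurable_fun setT f ->
  mu.-integrable setT (EFin \o f) -> f \in Lfun mu 1%E.
Proof.
move=> mf fi; apply/andP; split; first by rewrite inE.
rewrite inE /= /finite_norm Lnorm1.
by have /integrableP[] := fi.
Qed.

Variable G : T -> T.
Hypotheses (mG : measurable_fun setT G)
  (GE : forall A, measurable A -> mu (G @^-1` A) = mu A).

Lemma preserving_integral (f : T -> \bar R) : measurable_fun setT f ->
  mu.-integrable setT (f \o G) -> (\int[mu]_y f (G y) = \int[mu]_y f y)%E.
Proof.
move=> mf fi; have := @integral_pushforward _ _ T T R G mG mu setT f mf fi measurableT.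
rewrite preimage_setT /= => <-.
pose m := measure_function_pushforward__canonical__measure_function_Measure mu mG.
by apply: (@eq_measure_integral _ _ _ _ mu m) => A mA _; exact: GE.
Qed.

Lemma preserving_ge0_integral (f : T -> \bar R) : measurable_fun setT f ->
  (forall y, 0 <= f y)%E -> (\int[mu]_y f (G y) = \int[mu]_y f y)%E.
Proof.
move=> mf f0.
have := @ge0_integral_pushforward _ _ T T R G mG mu setT f measurableT mf (fun y _ => f0 y).
rewrite preimage_setT /= => <-.
pose m := measure_function_pushforward__canonical__measure_function_Measure mu mG.
by apply: (@eq_measure_integral _ _ _ _ mu m) => A mA _; exact: GE.
Qed.

Lemma preserving_Lfun (f : T -> R) : f \in Lfun mu 1%E -> f \in Lfun mu +oo%E ->
  (f \o G \in Lfun mu 1%E) && (f \o G \in Lfun mu +oo%E).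
Proof.
move=> f1 foo; have [mf fi] := Lfun1_integrable_fun f1.
have [M M0 fM] := Lfun_oo_bounded foo.
have mfG : measurable_fun setT (f \o G) by exact: measurableT_comp.
apply/andP; split.
  apply: Lfun1_intro => //; apply/integrableP; split; first exact/measurable_EFinP.
  have /integrableP[_] := fi; apply: le_lt_trans.
  rewrite (@preserving_ge0_integral (fun y => `|(f y)%:E|%E))//.
  by apply: measurableT_comp => //; exact/measurable_EFinP.
apply: (@Lfun_oo_intro _ M) => //.
have [N [mN N0 subN]] := fM.
exists (G @^-1` N); split.
- by rewrite -[X in measurable X]setTI; exact: mG.
- by rewrite GE.
- by move=> y /= h; apply: subN => /= h'; apply: h.
Qed.

End Lfun_facts.

(** * Boundaries and distances under homeomorphisms *)

Section geometry.
Context {R : realType}.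
Implicit Types (A B : set (plane R)) (x z : plane R).

Lemma dist_to_le x B (r : R) : (r%:E <= dist_to x B)%E -> forall z, B z -> r <= enorm (x - z).
Proof.
move=> rB z Bz; rewrite -lee_fin (le_trans rB)//.
by apply: ereal_inf_lbound; exists z.
Qed.

Lemma dist_to_ge0 x B : (0 <= dist_to x B)%E.
Proof. by apply: le_ereal_inf_tmp => _ [z _ <-]; rewrite lee_fin enorm_ge0. Qed.

Lemma bdP A z : ~ bd A z -> (A z -> interior A z) /\ (closure A z -> A z).
Proof.
move=> nbd; split => h.
  by apply: contra_notP nbd => nint; split => //; exact: subset_closure.
by apply: contra_notP nbd => nA; split => // /interior_subset.
Qed.

(** The segment from x to z misses the boundary, so on it [A] coincides with its interior and with
    its closure. The trace of [A] is then open and closed in a connected set, hence empty or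
    everything. *)
Lemma segment_same_side A x z :
  (forall w, enorm (x - w) <= enorm (x - z) -> ~ bd A w) -> A x <-> A z.
Proof.
move=> nbd.
pose g (t : R) : plane R := x + t *: (z - x).
have cg : continuous g.
  apply: (@lipschitz_continuous _ _ _ _ `|z - x|) => s t.
  by rewrite /g opprD addrACA subrr add0r -scalerBl normrZ mulrC.
have gin t : t \in `[0, 1] -> ~ bd A (g t).
  rewrite in_itv /= => /andP[t0 t1]; apply: nbd.
  have -> : x - g t = t *: (x - z).
    by rewrite /g opprD addrA subrr add0r -scalerN opprB.
  have -> : enorm (t *: (x - z)) = t * enorm (x - z).
    rewrite /enorm /= /GRing.scale /= !exprMn -mulrDr sqrtrM ?sqr_ge0//.
    by rewrite sqrtr_sqr ger0_norm.
  by rewrite ler_piMl// enorm_ge0.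
pose I := [set` `[0 : R, 1]].
have conI : connected I by apply/connected_intervalP; exact: interval_is_interval.
have conE : connected (g @` I).
  by apply: connected_continuous_connected => //; exact: continuous_subspaceT.
have all_or w : (g @` I) w -> A w -> g @` I `&` A = g @` I.
  move=> gw Aw; apply: conE; first by exists w.
  - exists (interior A); first exact: open_interior.
    apply/seteqP; split => u [[t tI <-] Au]; split.
    + by exists t.
    + by have [h _] := bdP (gin t tI); exact: h.
    + by exists t.
    + exact: interior_subset.
  - exists (closure A); first exact: closed_closure.
    apply/seteqP; split => u [[t tI <-] Au]; split.
    + by exists t.
    + exact: subset_closure.
    + by exists t.
    + by have [_ h] := bdP (gin t tI); exact: h.
have gx : (g @` I) x by exists 0; [rewrite /I /= in_itv/= lexx ler01|rewrite /g scale0r addr0].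
have gz : (g @` I) z by exists 1; [rewrite /I /= in_itv/= lexx ler01|rewrite /g scale1r addrC subrK].
split=> h.
- by have := gz; rewrite -(all_or x gx h) => -[].
- by have := gx; rewrite -(all_or z gz h) => -[].
Qed.

Lemma bd_image (F : plane R -> plane R) A z : bijective F ->
  continuous (inverse F) -> bd (F @` A) z -> exists2 w, bd A w & F w = z.
Proof.
move=> bF cG [cl nint]; exists (inverse F z); last exact: (inverseVK bF _).
have nb U : nbhs (inverse F z) U -> nbhs z (F @` U).
  move=> nU; have h : nbhs z (inverse F @^-1` U) := cG z _ nU.
  apply: filterS h => y /= Uy.
  by exists (inverse F y) => //; exact: (inverseVK bF _).
split.
- move=> U nU; have [y [[w Aw <-] [u Uu]]] := cl _ (nb _ nU).
  move=> /(congr1 (inverse F)); rewrite !(inverseK bF) => uw.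
  by exists w; split => //; rewrite -uw.
- by move=> h; apply: nint; exact: nb.
Qed.

Lemma ysection_push d (L : measurableType d) (Theta : set (lplane R * L))
    (F : plane R -> plane R) l :
  ysection (push_set Theta F) l = F @` (ysection Theta l).
Proof.
apply/seteqP; split => z.
  rewrite /ysection /= inE => -[[w l'] /= h [<- <-]]; exists w => //.
  by rewrite /ysection /= inE.
by move=> [w]; rewrite /ysection /= !inE => h <-; exists (w, l).
Qed.

(* The Lipschitz bound is on the inverse of F \o G^-1. *)
Lemma dist_to_image (F G : plane R -> plane R) (l : R) A y :
  0 < l -> bijective F -> continuous (inverse F) -> bijective G ->
  (forall B w, bd B w -> bd (G @` B) (G w)) ->
  (forall v w, enorm (G v - G w) <= l * enorm (F v - F w)) ->
  (dist_to (G y) (bd (G @` A)) <= l%:E * dist_to (F y) (bd (F @` A)))%E.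
Proof.
move=> l0 bF cF bG bdG lip.
rewrite -lee_pdivrMl//; apply: le_ereal_inf_tmp => _ [z bz <-].
have [w bw <-] := bd_image bF cF bz.
rewrite lee_pdivrMl//; apply: (@le_trans _ _ (enorm (G y - G w))%:E).
  by apply: ereal_inf_lbound; exists (G w) => //; exact: bdG.
by rewrite -EFinM lee_fin.
Qed.

Lemma bd_image_conv (F : plane R -> plane R) A w : bijective F ->
  continuous F -> bd A w -> bd (F @` A) (F w).
Proof.
move=> bF cF [cl nint]; split.
- move=> U nU; have [y [Ay Uy]] := cl _ (cF w _ nU).
  by exists (F y); split => //; exists y.
- move=> h; apply: nint; have h' : nbhs w (F @^-1` (F @` A)) := cF w _ h.
  apply: filterS h' => y /= [u Au].
  by move=> /(congr1 (inverse F)); rewrite !(inverseK bF) => <-.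
Qed.

(** As p <= 1 and l >= 1, l^p <= l: a distortion l of distances costs at most the factor l. In use p
    = 2 alpha, which is below 1. *)
Lemma inv_poweR_le (l p : R) (D D' : \bar R) : 1 <= l -> 0 < p <= 1 ->
  (0 <= D)%E -> (0 <= D')%E -> (D' <= l%:E * D)%E ->
  ((D `^ p)^-1 <= l%:E * (D' `^ p)^-1)%E.
Proof.
move=> l1 /andP[p0 p1] D0 D'0; have l0 : 0 < l by lra.
have rhs0 : (0 <= l%:E * (D' `^ p)^-1)%E.
  by rewrite mule_ge0 ?lee_fin ?(ltW l0)// inve_ge0 poweR_ge0.
case: D D0 => [s| |]//; last first.
  by move=> _ _; rewrite poweRyr ?gt_eqF// invey.
rewrite lee_fin => s0; case: D' D'0 rhs0 => [s'| |]//.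
move=> s'0 rhs0 ss'; rewrite lee_fin in s'0; rewrite -EFinM lee_fin in ss'.
rewrite !poweR_EFin !inver !powR_eq0 (gt_eqF p0) !andbT.
have [s'_eq0|s'_neq0] := eqVneq s' 0.
  by rewrite gt0_muley ?lte_fin// leey.
have s'_gt0 : 0 < s' by rewrite lt_def s'_neq0.
have s_gt0 : 0 < s by rewrite -(pmulr_rgt0 s l0); exact: lt_le_trans ss'.
rewrite (gt_eqF s_gt0) -EFinM lee_fin.
rewrite ler_pdivlMr ?powR_gt0// mulrC ler_pdivrMr ?powR_gt0//.
apply: (@le_trans _ _ ((l * s) `^ p)).
  by apply: ge0_ler_powR; rewrite ?nnegrE// ?mulr_ge0// ltW.
rewrite powRM ?(ltW l0)// ler_wpM2r ?powR_ge0//.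
exact: ler1_powR.
Qed.

End geometry.

Lemma leb2_sigma_finite (R : realType) : sigma_finite setT (@leb2 R).
Proof.
apply: completed_measure_extension_sigma_finite.
exists (fun n : nat => [set w : plane R | enorm w <= n%:R]).
  apply/seteqP; split => // w _; exists (Num.bound (enorm w)) => //=.
  exact: ltW (archi_boundP (enorm_ge0 w)).
move=> n; split; last first.
  by apply: (le_lt_trans (bleb_ball (ler0n R n))); rewrite ltry.
exact: measurable_ball.
Qed.

HB.instance Definition _ (R : realType) := Measure_isSigmaFinite.Build _ _ _
  (@leb2 R) (@leb2_sigma_finite R).

(** * The velocity of a transported datum *)

Section plane_flow.
Context {R : realType}.
Variable alpha : R.
Hypothesis alpha_itv : 0 < alpha < 1 / 2.
Variable th0 : plane R -> R.
Hypothesis th0L : L1Linfty th0.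
Implicit Types (Phi Psi : plane R -> plane R) (eps : R).

Lemma homeo_transports Phi : measure_preserving_homeo Phi ->
  transports (@leb2 R) (Phi : lplane R -> plane R).
Proof.
move=> [_ _ _ mF FE]; split.
  move=> _ B mB; apply: mF; first exact: measurableT.
  exact: borel_lplane.
move=> B mB; rewrite -(leb2_borel mB) -(FE _ (borel_lplane mB)).
by [].
Qed.

Lemma homeo_transportsB x Phi : measure_preserving_homeo Phi ->
  transports (@leb2 R) ((fun y => x - Phi y) : lplane R -> plane R).
Proof.
by move=> h; apply: homeo_transports (homeo_comp (homeo_reflect x) h).
Qed.

Lemma L1Linfty_push Phi : measure_preserving_homeo Phi ->
  L1Linfty (th0 \o inverse Phi).
Proof.
move=> /homeo_inverse[_ _ _ mG GE]; have [h1 h2] := th0L.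
by have /andP[] := preserving_Lfun mG GE h1 h2.
Qed.

Let mth : measurable_fun setT (th0 : lplane R -> R).
Proof. by have [/Lfun1_integrable_fun[]] := th0L. Qed.

Let ith : (@leb2 R).-integrable setT (EFin \o (th0 : lplane R -> R)).
Proof. by have [/Lfun1_integrable_fun[]] := th0L. Qed.

Let bnd : exists2 M, 0 <= M & {ae @leb2 R, forall y : lplane R, `|th0 y| <= M}.
Proof. by have [_ /Lfun_oo_bounded] := th0L. Qed.

Definition sup_th : R := sval (cid2 bnd).

Let M0 : 0 <= sup_th. Proof. exact: (s2valP (cid2 bnd)). Qed.
Let thM : {ae @leb2 R, forall y : lplane R, `|th0 y| <= sup_th}.
Proof. exact: (s2valP' (cid2 bnd)). Qed.

Definition dir1 : plane R := (1, 0).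
Definition dir2 : plane R := (0, -1).

Lemma enorm_dir1 : enorm dir1 <= 1.
Proof. by rewrite /enorm /= expr1n expr0n addr0 sqrtr1. Qed.
Lemma enorm_dir2 : enorm dir2 <= 1.
Proof. by rewrite /enorm /= sqrrN expr1n expr0n add0r sqrtr1. Qed.

(* The velocity at x of the datum transported by Phi, with the kernel           *)
(* x^perp / |x|^(2 + 2 alpha) regularized at scale eps.                         *)
Definition vel (c eps : R) Phi (x : plane R) : plane R :=
  (c * kint alpha (@leb2 R) th0 eps dir2 (fun y => x - Phi y),
   c * kint alpha (@leb2 R) th0 eps dir1 (fun y => x - Phi y)).

Lemma kerE (w : plane R) :
  ker alpha 0 dir2 w = (enorm w `^ (2 + 2 * alpha))^-1 * - w.2 /\
  ker alpha 0 dir1 w = (enorm w `^ (2 + 2 * alpha))^-1 * w.1.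
Proof.
rewrite /ker /dotp /profile expr0n addr0 sqr_powR ?enorm_ge0//=; split; ring.
Qed.

(** The substitution that replaces y by [Phi y] preserves the measure and turns the transported
    datum back into [th0]. *)
Lemma velocityE Phi x : measure_preserving_homeo Phi ->
  velocity alpha (th0 \o inverse Phi) x = vel (c_alpha alpha) 0 Phi x.
Proof.
move=> mPhi; have tPhi := homeo_transportsB x mPhi.
have [bPhi _ _ mF FE] := mPhi.
have [_ _ _ mG _] := homeo_inverse mPhi.
have key e : enorm e <= 1 -> \int[@leb2 R]_y (ker alpha 0 e (x - y) * th0 (inverse Phi y)) =
    kint alpha (@leb2 R) th0 0 e (fun y => x - Phi y).
  move=> e1; rewrite /kint /Rintegral; congr fine.
  have i := kint_integrable alpha_itv mth ith M0 thM 0 e1 tPhi.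
  have mg : measurable_fun setT
      ((fun y => (ker alpha 0 e (x - y) * th0 (inverse Phi y))%:E) : lplane R -> \bar R).
    apply/measurable_EFinP; apply: measurable_funM.
      have t := homeo_transports (homeo_reflect x).
      exact: (measurable_transports t (@measurable_ker R alpha 0 e)).
    exact: (measurableT_comp mth mG).
  rewrite -(preserving_integral mF FE mg).
    by apply: eq_integral => y _; rewrite /= inverseK.
  by apply: eq_integrable i => // y _ /=; rewrite inverseK.
rewrite /velocity /vel -(key _ enorm_dir1) -(key _ enorm_dir2).
congr pair; congr (_ * _); apply: eq_Rintegral => y _; rewrite /comp.
- by rewrite (kerE (x - y)).1.
- by rewrite (kerE (x - y)).2.
Qed.

Definition vel_bound (c : R) : R := `|c| * kint_bound alpha (@leb2 R) th0 sup_th.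

Lemma vel_le c eps Phi x : measure_preserving_homeo Phi -> `|vel c eps Phi x| <= vel_bound c.
Proof.
move=> /(homeo_transportsB x) t; apply: ler_prod_norm; rewrite /vel normrM ler_wpM2l//.
- exact: (kint_le alpha_itv mth ith M0 thM eps enorm_dir2 t).
- exact: (kint_le alpha_itv mth ith M0 thM eps enorm_dir1 t).
Qed.

Definition vel_rate (c eps : R) : R := `|c| * reg_rate alpha sup_th eps.

Lemma vel_reg c eps Phi x : measure_preserving_homeo Phi -> 0 < eps ->
  `|vel c eps Phi x - vel c 0 Phi x| <= vel_rate c eps.
Proof.
move=> /(homeo_transportsB x) t eps0; apply: ler_prod_norm; rewrite /vel /= -mulrBr normrM ler_wpM2l//.
- exact: (kint_reg alpha_itv mth ith M0 thM eps0 enorm_dir2 t).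
- exact: (kint_reg alpha_itv mth ith M0 thM eps0 enorm_dir1 t).
Qed.

Lemma vel_rate_small c eta : 0 < eta -> exists2 eps, 0 < eps & vel_rate c eps <= eta.
Proof.
move=> eta0; have c1 : 0 < `|c| + 1 by rewrite ltr_wpDl.
have [eps eps0 h] := reg_rate_small alpha_itv M0 (divr_gt0 eta0 c1).
exists eps => //; rewrite /vel_rate; apply: (@le_trans _ _ (`|c| * (eta / (`|c| + 1)))).
  by rewrite ler_wpM2l.
by rewrite mulrA ler_pdivrMr// mulrC ler_wpM2l ?(ltW eta0)// lerDl.
Qed.

Context d (L : measurableType d) (mu : signed_measure L R) (Theta : set (lplane R * L)).

(** The point Phi y is compared with Psi y for the same label y: the distance of Psi y to the
    boundary of the image slice under [Psi] is at most l times that of Phi y under [Phi]. The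
    supremum over all points absorbs the change of point. *)
Lemma L_mu_image Phi Psi (l : R) : 1 <= l -> measure_preserving_homeo Phi ->
  measure_preserving_homeo Psi ->
  (forall x y, enorm (Psi x - Psi y) <= l * enorm (Phi x - Phi y)) ->
  (L_mu mu (push_set Theta Phi) alpha <= l%:E * L_mu mu (push_set Theta Psi) alpha)%E.
Proof.
move=> l1 [bF cF cF' _ _] [bG cG cG' _ _] lip.
have /andP[a0 a1] := alpha_itv.
apply: ge_ereal_sup => _ [x _ <-]; rewrite -(inverseVK bF x).
set y := inverse Phi x.
apply: (@le_trans _ _ (l%:E * \int[Defs.total_variation mu]_l0
    (dist_to (Psi y) (bd (ysection (push_set Theta Psi) l0)) `^ (2 * alpha))^-1)%E); last first.
  apply: lee_wpmul2l; first by rewrite lee_fin; lra.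
  by apply: ereal_sup_ubound; exists (Psi y).
apply: lower_integral_le.
- lra.
- by move=> l0; rewrite inve_ge0 poweR_ge0.
- by move=> l0; rewrite inve_ge0 poweR_ge0.
move=> l0; rewrite !ysection_push; apply: inv_poweR_le => //.
- by apply/andP; split; lra.
- exact: dist_to_ge0.
- exact: dist_to_ge0.
apply: dist_to_image => //; first lra.
by move=> B w; exact: bd_image_conv.
Qed.

Hypothesis cake : layer_cake mu Theta th0.

Lemma vel_diff c eps Phi1 Phi2 (Lam delta : R) x1 x2 : 0 <= eps ->
  measure_preserving_homeo Phi1 -> measure_preserving_homeo Phi2 ->
  (L_mu mu (push_set Theta Phi1) alpha <= Lam%:E)%E -> 0 < delta ->
  (forall y, enorm ((x1 - Phi1 y) - (x2 - Phi2 y)) <= delta) ->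
  `|vel c eps Phi1 x1 - vel c eps Phi2 x2| <= `|c| * (key_constant alpha * delta * Lam).
Proof.
move=> eps0 m1 m2 hL delta0 hd.
have t1 := homeo_transportsB x1 m1; have t2 := homeo_transportsB x2 m2.
have [mTh Thfin thE] := cake.
have [b1 _ _ _ _] := m1.
have kc := key_constant_gt0 alpha_itv.
pose D (l : L) := dist_to x1 (bd (ysection (push_set Theta Phi1) l)).
have D0 l : (0 <= D l)%E by exact: dist_to_ge0.
have dich (l : L) (r : R) : 0 < r -> (r%:E <= D l)%E ->
    (forall y, enorm (x1 - Phi1 y) < r -> ysection Theta l y) \/
    (forall y, enorm (x1 - Phi1 y) < r -> ~ ysection Theta l y).
  move=> r0 rD; have far := dist_to_le rD.
  (* The segment from x1 to Phi1 y stays closer than r to x1, hence off the boundary of the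
     slice. *)
  have side y : enorm (x1 - Phi1 y) < r ->
      (ysection (push_set Theta Phi1) l) x1 <-> ysection Theta l y.
    move=> yr; rewrite (@segment_same_side _ _ _ (Phi1 y)); last first.
      by move=> w wy /far; rewrite leNgt (le_lt_trans wy yr).
    rewrite ysection_push; split; last by move=> h; exists y.
    by move=> [w Aw] /(congr1 (inverse Phi1)); rewrite !(inverseK b1) => <-.
  have [hx|hx] := pselect ((ysection (push_set Theta Phi1) l) x1); [left|right] => y /side [h1 h2].
    exact: h1.
  by move=> /h2.
have key e : enorm e <= 1 -> `|kint alpha (@leb2 R) th0 eps e (fun y => x1 - Phi1 y) -
    kint alpha (@leb2 R) th0 eps e (fun y => x2 - Phi2 y)| <= key_constant alpha * delta * Lam.
  move=> e1; rewrite -lee_fin.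
  apply: (le_trans (kint_diff alpha_itv mTh Thfin thE mth ith M0 thM t1 t2 delta0 hd D0 dich eps0 e1)).
  rewrite [leRHS]EFinM; apply: lee_wpmul2l; first by rewrite lee_fin mulr_ge0// ltW.
  by apply: le_trans hL; apply: ereal_sup_ubound; exists x1.
apply: ler_prod_norm; rewrite /vel /= -mulrBr normrM ler_wpM2l//.
- exact: (key _ enorm_dir2).
- exact: (key _ enorm_dir1).
Qed.

End plane_flow.

(** * Limits of measure-preserving homeomorphisms *)

Section limits.
Context {R : realType}.
Implicit Types (F G : plane R -> plane R) (Phi : nat -> plane R -> plane R).

(** A point that [F] sends into the open set [U] is sent there by all late [Phi n]. The preimage
    therefore lies in the increasing union of the sets [A N], each of which is contained in the
    preimage under [Phi N] and so has measure at most that of [U]. *)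
Lemma bleb_preimage_limit Phi F (U : set (plane R)) : continuous F ->
  (forall n, measure_preserving_homeo (Phi n)) ->
  (forall x, Phi n x @[n --> \oo] --> F x) -> open U ->
  (bleb (F @^-1` U) <= bleb U)%E.
Proof.
move=> cF mPhi cvPhi oU.
have mU : measurable (U : set bplane) by exact: open_borel.
have mPU n : measurable (Phi n @^-1` U : set bplane).
  by have [_ cP _ _ _] := mPhi n; apply: open_borel; apply: open_comp => // x _; exact: cP.
have mFU : measurable (F @^-1` U : set bplane).
  by apply: open_borel; apply: open_comp => // x _; exact: cF.
pose A (N : nat) : set bplane := \bigcap_(n in [set n | (N <= n)%N]) (Phi n @^-1` U).
have mA N : measurable (A N) by apply: bigcap_measurable => //; exists N => /=.
have mUA : measurable (\bigcup_N A N) by exact: bigcup_measurable.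
apply: (@le_trans _ _ (bleb (\bigcup_N A N))).
  apply: le_measure; rewrite ?inE// => x Ux.
  have [N _ HN] : \forall n \near \oo, U (Phi n x).
    by apply: (cvPhi x); exact: open_nbhs_nbhs.
  by exists N => // n /HN.
have cv := @nondecreasing_cvg_mu _ _ _ (@bleb R) A mA mUA.
have nd : nondecreasing_seq A.
  by move=> m n mn; apply/subsetPset => x Ax k /= nk; apply: Ax => /=; exact: leq_trans nk.
rewrite -(cvg_lim _ (cv nd))//; apply: lime_le; first by apply/cvg_ex; eexists; exact: (cv nd).
apply: nearW => N /=; rewrite -(homeo_borel (mPhi N) mU).
by apply: le_measure; rewrite ?inE// => x /(_ N (leqnn N)).
Qed.

(** Convergence of the inverses gives the reverse inequality on open sets. These are closed under
    intersection, generate the Borel sets and include an exhaustion by discs of finite measure,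
    which settles all Borel sets. *)
Lemma homeo_limit Phi F G : (forall n, measure_preserving_homeo (Phi n)) ->
  (forall x, Phi n x @[n --> \oo] --> F x) ->
  (forall x, inverse (Phi n) x @[n --> \oo] --> G x) ->
  cancel F G -> cancel G F -> continuous F -> continuous G ->
  measure_preserving_homeo F.
Proof.
move=> mPhi cvF cvG FG GF cF cG; apply: (homeo_of_borel FG GF cF cG).
have FU (U : set (plane R)) : open U -> bleb (F @^-1` U) = bleb U.
  move=> oU; apply/eqP; rewrite eq_le (bleb_preimage_limit cF mPhi cvF oU) /=.
  have oFU : open (F @^-1` U) by apply: open_comp => // x _; exact: cF.
  have E : G @^-1` (F @^-1` U) = U by apply/seteqP; split => x /=; rewrite GF.
  by have := bleb_preimage_limit cG (fun n => homeo_inverse (mPhi n)) cvG oFU; rewrite E.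
have mF := continuous_borel2 cF.
pose m1 := measure_function_pushforward__canonical__measure_function_Measure (@bleb R) mF.
have oball (n : nat) : open [set w : plane R | enorm w < n%:R].
  have -> : [set w : plane R | enorm w < n%:R] = (@enorm R) @^-1` `]-oo, n%:R[.
    by apply/seteqP; split => x /=; rewrite in_itv.
  by apply: open_comp => [x _|]; [exact: continuous_enorm|exact: interval_open].
apply: (@measure_unique _ R (@bplane R) [set U : set (plane R) | open U]
  (fun n => [set w : plane R | enorm w < n%:R]) _ _ _ _ m1 (@bleb R)).
- apply/seteqP; split; first exact: borel_generated_open.
  by apply: smallest_sub; [exact: sigma_algebra_measurable|move=> U; exact: open_borel].
- by move=> U V; exact: openI.
- exact: oball.
- apply/seteqP; split => // w _; exists (Num.bound (enorm w)) => //=.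
  exact: archi_boundP (enorm_ge0 w).
- by move=> U oU; rewrite /m1 /= /pushforward FU.
- move=> n; rewrite /m1 /= /pushforward FU//.
  apply: (@le_lt_trans _ _ (4 * n%:R ^+ 2)%:E); last exact: ltry.
  apply: le_trans (bleb_ball (ler0n R n)); apply: le_measure; rewrite ?inE.
  + exact: open_borel (oball n).
  + exact: measurable_ball.
  + by move=> w /= /ltW.
Qed.

End limits.

(** * The Euler step along a flow *)

Section homeo_step.
Context {R : realType}.
Variable alpha : R.
Hypothesis alpha_itv : 0 < alpha < 1 / 2.
Variable th0 : plane R -> R.
Hypothesis th0L : L1Linfty th0.
Context d (L : measurableType d) (mu : signed_measure L R) (Theta : set (lplane R * L)).
Hypothesis cake : layer_cake mu Theta th0.
Variable c : R.

Let mth : measurable_fun setT (th0 : lplane R -> R).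
Proof. by have [/Lfun1_integrable_fun[]] := th0L. Qed.

Let ith : (@leb2 R).-integrable setT (EFin \o (th0 : lplane R -> R)).
Proof. by have [/Lfun1_integrable_fun[]] := th0L. Qed.

(** The factor 2 converts the max norm to the Euclidean one, and the summand 1 makes the constant
    positive for every [c], in particular for both signs used later. *)
Definition vel_const : R := 1 + 2 * (`|c| * key_constant alpha).

Lemma vel_const_ge1 : 1 <= vel_const.
Proof. by rewrite lerDl mulr_ge0// mulr_ge0// ltW// key_constant_gt0. Qed.

Lemma vel_lip eps Phi1 Phi2 (Lam D : R) x1 x2 : 0 <= eps ->
  measure_preserving_homeo Phi1 -> measure_preserving_homeo Phi2 ->
  (L_mu mu (push_set Theta Phi1) alpha <= Lam%:E)%E -> 0 <= Lam -> 0 <= D ->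
  (forall y, `|(x1 - Phi1 y) - (x2 - Phi2 y)| <= D) ->
  `|vel alpha th0 c eps Phi1 x1 - vel alpha th0 c eps Phi2 x2| <= vel_const * Lam * D.
Proof.
move=> eps0 m1 m2 hL Lam0 D0 hD; have kc := key_constant_gt0 alpha_itv.
have ck : 0 <= `|c| * key_constant alpha by rewrite mulr_ge0// ltW.
have C1 : 0 < vel_const * Lam + 1.
  by rewrite ltr_wpDl// mulr_ge0// (le_trans ler01 vel_const_ge1).
apply/ler_addgt0Pr => e e0.
have e1 : 0 < e / (vel_const * Lam + 1) by rewrite divr_gt0.
(* [vel_diff] asks for a positive displacement bound, whereas D may be 0; the surplus changes the
   estimate by at most e. *)
have dl : 0 < 2 * D + e / (vel_const * Lam + 1) by rewrite ltr_wpDl// mulr_ge0.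
have hd y : enorm ((x1 - Phi1 y) - (x2 - Phi2 y)) <= 2 * D + e / (vel_const * Lam + 1).
  apply: (le_trans (ler_enorm_norm _)); apply: ler_wpDr; first exact: ltW.
  by rewrite ler_wpM2l.
apply: (le_trans (vel_diff alpha_itv th0L cake c eps0 m1 m2 hL dl hd)).
have : `|c| * key_constant alpha * Lam * (e / (vel_const * Lam + 1)) <= e.
  rewrite mulrA ler_pdivrMr// mulrC ler_wpM2l ?(ltW e0)// /vel_const.
  have : 0 <= `|c| * key_constant alpha * Lam by rewrite mulr_ge0.
  lra.
have : 0 <= Lam * D by rewrite mulr_ge0.
rewrite /vel_const [`|c| * (_ * _)]mulrA [`|c| * (_ * _)]mulrA.
by move: (`|c| * key_constant alpha) (e / _) => k q; lra.
Qed.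

Lemma homeo_step eps h Lam Phi : 0 < eps -> 0 <= h -> 0 <= Lam ->
  measure_preserving_homeo Phi ->
  (L_mu mu (push_set Theta Phi) alpha <= Lam%:E)%E ->
  h * (vel_const * Lam) <= 1 / 4 ->
  exists Phi' : plane R -> plane R, [/\ measure_preserving_homeo Phi',
    (forall x y, `|Phi' x - Phi' y| <= (1 + 4 * (h * (vel_const * Lam))) * `|Phi x - Phi y|),
    (forall x y, `|Phi x - Phi y| <= (1 + 4 * (h * (vel_const * Lam))) * `|Phi' x - Phi' y|) &
    (forall x, exists z, Phi' x = Phi x + h *: vel alpha th0 c eps Phi z /\
      `|z - Phi x| <= h * vel_bound alpha th0L c)].
Proof.
move=> eps0 h0 Lam0 mPhi hL hk.
pose w1 z := h * c * field alpha (@leb2 R) th0 Phi eps (0, -1) z.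
pose w2 z := h * c * field alpha (@leb2 R) th0 Phi eps (1, 0) z.
have w1E z : w1 z = h * (vel alpha th0 c eps Phi z).1 by rewrite /w1 -mulrA.
have w2E z : w2 z = h * (vel alpha th0 c eps Phi z).2 by rewrite /w2 -mulrA.
have lip x y : `|vel alpha th0 c eps Phi x - vel alpha th0 c eps Phi y| <= vel_const * Lam * `|x - y|.
  apply: vel_lip => //; first exact: ltW.
  by move=> z; rewrite opprB addrA subrK.
have lip1 x y : `|w1 x - w1 y| <= h * (vel_const * Lam) * `|x - y|.
  rewrite !w1E -mulrBr normrM ger0_norm// -mulrA ler_wpM2l//.
  by apply: le_trans (lip x y); exact: (ler_norm1 (_ - _)).
have lip2 x y : `|w2 x - w2 y| <= h * (vel_const * Lam) * `|x - y|.
  rewrite !w2E -mulrBr normrM ger0_norm// -mulrA ler_wpM2l//.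
  by apply: le_trans (lip x y); exact: (ler_norm2 (_ - _)).
have mP : measurable_fun setT (Phi : lplane R -> @bplane R) by have [] := homeo_transports mPhi.
have [S [mS S1 S2 S3]] := symplectic_step hk lip1 lip2
  (fun a b s t => @field_flux _ _ alpha_itv _ _ _ _ _ _ mth ith eps0 mP (h * c) a b s t).
exists (S \o Phi); split; first exact: homeo_comp.
- by move=> x y; exact: S1.
- by move=> x y; exact: S2.
move=> x; have [z [Sz hz]] := S3 (Phi x); exists z; split; last first.
  apply: (le_trans hz); rewrite w2E normrM ger0_norm// ler_wpM2l//.
  apply: le_trans (vel_le alpha_itv th0L c eps z mPhi).
  exact: (ler_norm2 (vel alpha th0 c eps Phi z)).
by rewrite -[LHS]/(S (Phi x)) Sz w1E w2E.
Qed.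

End homeo_step.

(** * Convergence of the Euler scheme *)

Section geometric.
Context {R : realType}.

Lemma le_geom (x K D : R) : (forall n, x <= K + D / 2 ^+ n) -> x <= K.
Proof.
move=> H; rewrite leNgt; apply/negP => Kx.
have xK : 0 < x - K by rewrite subr_gt0.
pose n := Num.bound (`|D| / (x - K)).
have Dn : `|D| / (x - K) < n%:R by apply: archi_boundP; rewrite divr_ge0// ltW.
have n2 : n%:R <= 2 ^+ n :> R by rewrite -natrX ler_nat ltnW// ltn_expl.
have := H n; apply/negP; rewrite -ltNge -ltrBrDl ltr_pdivrMr ?exprn_gt0//.
apply: le_lt_trans (ler_norm D) _; rewrite mulrC -ltr_pdivrMr//.
exact: lt_le_trans Dn n2.
Qed.

(** Subtracting or adding the tail [g n] = 2 W / 2^n turns [u] into a nondecreasing sequence below a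
    nonincreasing one; the limit is the supremum of the lower one, within [g n] of [u n]. *)
Lemma geom_limit (u : nat -> R) (W : R) :
  (forall n, `|u n.+1 - u n| <= W / 2 ^+ n) ->
  exists l, forall n, `|u n - l| <= 2 * W / 2 ^+ n.
Proof.
move=> H; pose g n : R := 2 * W / 2 ^+ n.
have gS n : g n.+1 = g n - W / 2 ^+ n.
  by rewrite /g exprS; field; rewrite expf_neq0.
have H' n : - (W / 2 ^+ n) <= u n.+1 - u n <= W / 2 ^+ n by rewrite -ler_norml.
pose v n := u n - g n; pose z n := u n + g n.
have vnd : {homo v : n m / (n <= m)%N >-> n <= m}.
  apply: homo_leq => [//|y x w /le_trans|n]; first exact.
  by rewrite /v gS; have := H' n; lra.
have zni : {homo z : n m / (n <= m)%N >-> n >= m}.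
  apply: homo_leq => [//|y x w h1 h2|n]; first exact: le_trans h2 h1.
  by rewrite /z gS; have := H' n; lra.
have g0 n : 0 <= g n.
  have := le_trans (normr_ge0 _) (H n); rewrite /g -mulrA => h; exact: mulr_ge0.
have vz n m : v n <= z m.
  apply: le_trans (vnd _ _ (leq_maxl n m)) _; apply: le_trans (zni _ _ (leq_maxr n m)).
  by rewrite /v /z; have := g0 (maxn n m); lra.
have ub : has_ubound (range v) by exists (z 0%N) => _ [n _ <-].
exists (sup (range v)) => n; rewrite -/(g n) ler_norml.
have h1 : v n <= sup (range v) by apply: ub_le_sup => //; exists n.
have h2 : sup (range v) <= z n by apply: ge_sup; [exists (v 0%N), 0%N|move=> _ [m _ <-]].
by move: h1 h2; rewrite /v /z; lra.
Qed.

Lemma geom_limit2 (u : nat -> plane R) (W : R) :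
  (forall n, `|u n.+1 - u n| <= W / 2 ^+ n) ->
  exists l, forall n, `|u n - l| <= 2 * W / 2 ^+ n.
Proof.
move=> H.
have [l1 h1] : exists l, forall n, `|(u n).1 - l| <= 2 * W / 2 ^+ n.
  by apply: geom_limit => n; exact: le_trans (ler_norm1 (u n.+1 - u n)) (H n).
have [l2 h2] : exists l, forall n, `|(u n).2 - l| <= 2 * W / 2 ^+ n.
  by apply: geom_limit => n; exact: le_trans (ler_norm2 (u n.+1 - u n)) (H n).
by exists (l1, l2) => n; apply: ler_prod_norm; [exact: h1|exact: h2].
Qed.

Lemma cvg_geom (V : normedModType R) (u : nat -> V) (l : V) (D : R) :
  (forall n, `|u n - l| <= D / 2 ^+ n) -> u n @[n --> \oo] --> l.
Proof.
move=> H; apply/cvgrPdist_le => e e0.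
pose N := Num.bound (`|D| / e).
exists N => // n /= Nn; rewrite distrC; apply: le_trans (H n) _.
rewrite ler_pdivrMr ?exprn_gt0// mulrC; apply: le_trans (ler_norm D) _.
rewrite -ler_pdivrMr//; apply: ltW; apply: (@lt_le_trans _ _ N%:R).
  by apply: archi_boundP; rewrite divr_ge0// ltW.
by rewrite -natrX ler_nat (leq_trans Nn)// ltnW// ltn_expl.
Qed.

End geometric.

Section scheme.
Context {R : realType}.
Variables (V : R -> (plane R -> plane R) -> plane R -> plane R)
  (Lf : (plane R -> plane R) -> \bar R) (C M : R).
Implicit Types (F G : plane R -> plane R) (x y z : plane R).
Hypotheses (C0 : 0 < C) (M0 : 0 <= M).
Hypothesis V_reg : forall eta : R, 0 < eta -> exists2 eps, 0 < eps &
  forall F x, measure_preserving_homeo F -> `|V eps F x - V 0 F x| <= eta.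
Hypothesis V_le : forall eps F x, measure_preserving_homeo F -> `|V eps F x| <= M.
Hypothesis V_lip : forall (eps : R) F G (Lam D : R) x y, 0 <= eps ->
  measure_preserving_homeo F -> measure_preserving_homeo G ->
  (Lf F <= Lam%:E)%E -> 0 <= Lam -> 0 <= D ->
  (forall z, `|(x - F z) - (y - G z)| <= D) ->
  `|V eps F x - V eps G y| <= C * Lam * D.
Hypothesis Lf_growth : forall F G (l : R), 1 <= l ->
  measure_preserving_homeo F -> measure_preserving_homeo G ->
  (forall x y, `|G x - G y| <= l * `|F x - F y|) ->
  (Lf F <= (2 * l)%:E * Lf G)%E.
Hypothesis step : forall (eps h Lam : R) F, 0 < eps -> 0 <= h -> 0 <= Lam ->
  measure_preserving_homeo F -> (Lf F <= Lam%:E)%E -> h * (C * Lam) <= 1 / 4 ->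
  exists F', [/\ measure_preserving_homeo F',
    (forall x y, `|F' x - F' y| <= (1 + 4 * (h * (C * Lam))) * `|F x - F y|),
    (forall x y, `|F x - F y| <= (1 + 4 * (h * (C * Lam))) * `|F' x - F' y|) &
    (forall x, exists z, F' x = F x + h *: V eps F z /\ `|z - F x| <= h * M)].
Variables (Psi : plane R -> plane R) (Lam0 : R).
Hypotheses (mPsi : measure_preserving_homeo Psi) (Lam0_gt0 : 0 < Lam0)
  (LPsi : (Lf Psi <= Lam0%:E)%E).

(** Along the scheme [Lf] stays below 4 Lam0: 2 for the distortion and 2 from [Lf_growth], which
    pays for the change of norm. So [a] is the Lipschitz constant of the velocity, and [tau] is
    chosen with 4 tau a = 1/2. *)
Let a := C * (4 * Lam0).
Let tau := (8 * a)^-1.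

Let a_gt0 : 0 < a. Proof. by rewrite mulr_gt0// mulr_gt0. Qed.
Let tau_gt0 : 0 < tau. Proof. by rewrite invr_gt0 mulr_gt0. Qed.
Let tau_a : tau * a = 1 / 8.
Proof. by rewrite /tau; move: a_gt0 => h; field; rewrite gt_eqF. Qed.

Let h_ (n : nat) : R := tau / 2 ^+ n.
(** Consistency error of a step in units of h_n / 2^n: 1 for the regularization, and a M tau for
    evaluating the field at the mixed point, which is within h_n M of the current one. *)
Let rho := 1 + a * M * tau.

(** With x = 1 / (2 N) the step factor is 1 + x, and (1 + x)(1 - (k + 1) x) <= 1 - k x. So 1 / (1 -
    k x) dominates k steps and is at most 2 up to k = N. *)
Let growth_step (k N : R) : 0 <= k -> 0 < N -> k + 1 <= N ->
  (1 + 4 * (tau / N * a)) * (1 - k / (2 * N))^-1 <= (1 - (k + 1) / (2 * N))^-1.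
Proof.
move=> k0 N0 kN.
have -> : tau / N * a = 1 / 8 / N by rewrite -tau_a; field; rewrite gt_eqF.
have h1 : 0 < 2 * N - k by lra.
have h2 : 0 < 2 * N - (k + 1) by lra.
rewrite -subr_ge0.
have -> : (1 - (k + 1) / (2 * N))^-1 - (1 + 4 * (1 / 8 / N)) * (1 - k / (2 * N))^-1 =
   (k + 1) / ((2 * N - k) * (2 * N - (k + 1))).
  by field; rewrite !gt_eqF//; lra.
by rewrite divr_ge0 ?mulr_ge0//; lra.
Qed.

Let growth_le2 (k N : R) : 0 <= k -> 0 < N -> k <= N ->
  1 <= (1 - k / (2 * N))^-1 <= 2.
Proof.
move=> k0 N0 kN.
have q : k / (2 * N) <= 1 / 2 by rewrite ler_pdivrMr; lra.
have q0 : 0 <= k / (2 * N) by rewrite divr_ge0; lra.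
have q1 : 0 < 1 - k / (2 * N) by lra.
apply/andP; split; first by rewrite invf_ge1//; lra.
by rewrite -[leRHS]invrK lef_pV2 ?posrE ?invr_gt0//; lra.
Qed.

Let h_gt0 n : 0 < h_ n. Proof. by rewrite divr_gt0// exprn_gt0. Qed.

(** The induction runs on the distortion [l k] relative to [Psi]: being at most 2 it keeps [Lf]
    below 4 Lam0, which permits the next step and bounds its distortion in turn. *)
Lemma discrete n : exists P : nat -> plane R -> plane R,
  [/\ P 0%N = Psi,
    (forall k, (k <= 2 ^ n)%N -> [/\ measure_preserving_homeo (P k),
       (Lf (P k) <= (4 * Lam0)%:E)%E,
       (forall x y, `|P k x - P k y| <= 2 * `|Psi x - Psi y|) &
       (forall x y, `|Psi x - Psi y| <= 2 * `|P k x - P k y|)]) &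
    (forall k, (k < 2 ^ n)%N -> forall x, `|P k.+1 x - P k x| <= h_ n * M /\
       `|P k.+1 x - P k x - h_ n *: V 0 (P k) (P k x)| <= h_ n * (rho / 2 ^+ n))].
Proof.
have N0 : 0 < 2 ^+ n :> R by rewrite exprn_gt0.
have r0 : 0 < (2 ^+ n)^-1 :> R by rewrite invr_gt0.
(* The scale depends on n alone, with a regularization error of at most 2^-n. *)
have [eps eps0 rate] := V_reg r0.
have h0 := h_gt0 n; have a0 := a_gt0.
have aE : C * (4 * Lam0) = a by [].
have hE : h_ n = tau / 2 ^+ n by [].
have tau0 := tau_gt0.
have hta : h_ n * a <= 1 / 8.
  have n1 : 1 <= 2 ^+ n :> R by rewrite exprn_ege1// ler1n.
  by rewrite hE mulrAC tau_a ler_pdivrMr//; lra.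
have L4 : 0 <= 4 * Lam0 by rewrite mulr_ge0// ltW.
have /choice[nxt Hnxt] : forall F, exists F', measure_preserving_homeo F ->
    (Lf F <= (4 * Lam0)%:E)%E -> [/\ measure_preserving_homeo F',
    (forall x y, `|F' x - F' y| <= (1 + 4 * (h_ n * a)) * `|F x - F y|),
    (forall x y, `|F x - F y| <= (1 + 4 * (h_ n * a)) * `|F' x - F' y|) &
    (forall x, exists z, F' x = F x + h_ n *: V eps F z /\ `|z - F x| <= h_ n * M)].
  move=> F; have [mF|nF] := pselect (measure_preserving_homeo F); last by exists F.
  have [LF|nF] := pselect (Lf F <= (4 * Lam0)%:E)%E; last by exists F.
  have h4 : h_ n * (C * (4 * Lam0)) <= 1 / 4 by rewrite aE; lra.
  by have [F' HF'] := step eps0 (ltW h0) L4 mF LF h4; exists F'.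
pose P k := iter k nxt Psi.
pose l (k : nat) : R := (1 - k%:R / (2 * 2 ^+ n))^-1.
have kN k : (k <= 2 ^ n)%N -> k%:R <= 2 ^+ n :> R by rewrite -natrX ler_nat.
have l12 k : (k <= 2 ^ n)%N -> 1 <= l k <= 2.
  by move=> /kN h; apply: growth_le2.
have Lf_le F k : (k <= 2 ^ n)%N -> measure_preserving_homeo F ->
    (forall x y, `|Psi x - Psi y| <= l k * `|F x - F y|) -> (Lf F <= (4 * Lam0)%:E)%E.
  move=> /l12/andP[l1 l2] mF lF; apply: (le_trans (Lf_growth l1 mF mPsi lF)).
  apply: (@le_trans _ _ ((2 * l k)%:E * Lam0%:E)%E).
    by apply: lee_wpmul2l => //; rewrite lee_fin; lra.
  by rewrite -EFinM lee_fin ler_wpM2r ?(ltW Lam0_gt0)//; lra.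
have inv k : (k <= 2 ^ n)%N -> [/\ measure_preserving_homeo (P k),
    (forall x y, `|P k x - P k y| <= l k * `|Psi x - Psi y|) &
    (forall x y, `|Psi x - Psi y| <= l k * `|P k x - P k y|)].
  elim: k => [_|k IH kn].
    by split => //= x y; rewrite /l mul0r subr0 invr1 mul1r.
  have [mP P1 P2] := IH (ltnW kn).
  have LP := Lf_le _ _ (ltnW kn) mP P2.
  have [mP' Q1 Q2 _] := Hnxt _ mP LP.
  have gs : (1 + 4 * (h_ n * a)) * l k <= l k.+1.
    have kn' : k%:R + 1 <= 2 ^+ n :> R by rewrite natr1; exact: kN.
    by have := growth_step (ler0n R k) N0 kn'; rewrite natr1.
  have h4 : 0 <= 1 + 4 * (h_ n * a) by rewrite addr_ge0// mulr_ge0// mulr_ge0// ltW.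
  have /andP[l1 _] := l12 _ (ltnW kn).
  split => // x y.
  - apply: (le_trans (Q1 x y)); apply: (@le_trans _ _ ((1 + 4 * (h_ n * a)) * (l k * `|Psi x - Psi y|))).
      by rewrite ler_wpM2l.
    by rewrite mulrA ler_wpM2r.
  - apply: (le_trans (P2 x y)); apply: (@le_trans _ _ (l k * ((1 + 4 * (h_ n * a)) * `|P k.+1 x - P k.+1 y|))).
      by rewrite ler_wpM2l//; lra.
    by rewrite mulrCA mulrA ler_wpM2r.
exists P; split; [exact: erefl|move=> k kn|move=> k kn].
  have [mP P1 P2] := inv _ kn; have /andP[l1 l2] := l12 _ kn; split => //.
  - exact: Lf_le kn mP P2.
  - by move=> x y; apply: (le_trans (P1 x y)); rewrite ler_wpM2r.
  - by move=> x y; apply: (le_trans (P2 x y)); rewrite ler_wpM2r.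
move=> x; have [mP P1 P2] := inv _ (ltnW kn).
have LP := Lf_le _ _ (ltnW kn) mP P2.
have [_ _ _ /(_ x) [z [Pz hz]]] := Hnxt _ mP LP.
rewrite [P k.+1 x]Pz addrAC subrr add0r normrZ gtr0_norm//; split.
  by rewrite ler_wpM2l ?(ltW h0)//; exact: V_le.
rewrite -scalerBr normrZ gtr0_norm// ler_wpM2l ?(ltW h0)//.
have hM : 0 <= h_ n * M by rewrite mulr_ge0// ltW.
have e1 : `|V eps (P k) z - V eps (P k) (P k x)| <= a * (h_ n * M).
  apply: (V_lip (ltW eps0) mP mP LP L4 hM) => y.
  by rewrite opprB addrA subrK.
have e2 := rate _ (P k x) mP.
have -> : rho / 2 ^+ n = a * (h_ n * M) + (2 ^+ n)^-1.
  by rewrite /rho /h_; field; rewrite gt_eqF.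
rewrite -(subrKA (V eps (P k) (P k x))); apply: (le_trans (ler_normD _ _)).
exact: lerD.
Qed.

End scheme.

Section passage.
Context {R : realType}.
Implicit Types (F G Psi : plane R -> plane R) (x y z : plane R) (t s : R).
Variables (ok : (plane R -> plane R) -> Prop)
  (V0 : (plane R -> plane R) -> plane R -> plane R) (a M tau rho : R)
  (Psi : plane R -> plane R) (P : nat -> nat -> plane R -> plane R).
Hypotheses (a0 : 0 < a) (M0 : 0 <= M) (tau0 : 0 < tau) (tau_a : tau * a <= 1 / 8)
  (rho0 : 0 <= rho) (mPsi : measure_preserving_homeo Psi).
Hypothesis ok_mp : forall F, ok F -> measure_preserving_homeo F.
Hypothesis ok_lip : forall F, measure_preserving_homeo F ->
  (forall x y, `|Psi x - Psi y| <= 2 * `|F x - F y|) -> ok F.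
Hypothesis V0_lip : forall F G (D : R) x y, ok F -> ok G -> 0 <= D ->
  (forall z, `|(x - F z) - (y - G z)| <= D) -> `|V0 F x - V0 G y| <= a * D.
Let h_ (n : nat) : R := tau / 2 ^+ n.
Hypothesis P_start : forall n, P n 0%N = Psi.
Hypothesis P_ok : forall n k, (k <= 2 ^ n)%N -> [/\ ok (P n k),
  (forall x y, `|P n k x - P n k y| <= 2 * `|Psi x - Psi y|) &
  (forall x y, `|Psi x - Psi y| <= 2 * `|P n k x - P n k y|)].
Hypothesis P_step : forall n k, (k < 2 ^ n)%N -> forall x,
  `|P n k.+1 x - P n k x| <= h_ n * M /\
  `|P n k.+1 x - P n k x - h_ n *: V0 (P n k) (P n k x)| <= h_ n * (rho / 2 ^+ n).

Let h_gt0 n : 0 < h_ n. Proof. by rewrite divr_gt0// exprn_gt0. Qed.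

(** The kernel only sees differences between a particle and the others; each of the two positions
    moves by at most B, whence 2 B. *)
Let V0_near F G (B : R) x : ok F -> ok G -> (forall z, `|F z - G z| <= B) ->
  `|V0 F (F x) - V0 G (G x)| <= a * (2 * B).
Proof.
move=> oF oG FG; apply: V0_lip => //.
  by rewrite mulr_ge0//; exact: le_trans (FG x).
move=> z; have -> : F x - F z - (G x - G z) = (F x - G x) - (F z - G z).
  by apply: injective_projections => /=; ring.
by apply: (le_trans (ler_normB _ _)); have := FG x; have := FG z; lra.
Qed.

Let P_time n j i x : (j + i <= 2 ^ n)%N ->
  `|P n (j + i) x - P n j x| <= i%:R * (h_ n * M).
Proof.
elim: i => [|i IH] ij; first by rewrite addn0 subrr normr0 mul0r.
rewrite addnS in ij *; rewrite -natr1 -(subrKA (P n (j + i) x)).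
apply: (le_trans (ler_normD _ _)); have [h1 _] := P_step ij x.
by have := IH (ltnW ij); lra.
Qed.

(** Discrete Taylor estimate: over i steps the velocity of a particle drifts by at most 2 a M i h_n,
    and each step adds its consistency error. *)
Let P_time_quad n j i x : (j + i <= 2 ^ n)%N ->
  `|P n (j + i) x - P n j x - (i%:R * h_ n) *: V0 (P n j) (P n j x)| <=
  (i%:R * h_ n) * (2 * a * M * (i%:R * h_ n) + rho / 2 ^+ n).
Proof.
elim: i => [|i IH] ij; first by rewrite addn0 subrr !mul0r scale0r subrr normr0.
rewrite addnS in ij *; have ij' := ltnW ij.
have [wj _ _] := P_ok (leq_trans (leq_addr i j) ij').
have [wi _ _] := P_ok ij'.
have h0 := h_gt0 n.
have hi := IH ij'.
have [_ hs] := P_step ij x.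
have hv := V0_near x wi wj (fun z => P_time z ij').
have -> : P n (j + i).+1 x - P n j x - (i.+1%:R * h_ n) *: V0 (P n j) (P n j x) =
  (P n (j + i).+1 x - P n (j + i)%N x - h_ n *: V0 (P n (j + i)%N) (P n (j + i)%N x)) +
  (P n (j + i)%N x - P n j x - (i%:R * h_ n) *: V0 (P n j) (P n j x)) +
  h_ n *: (V0 (P n (j + i)%N) (P n (j + i)%N x) - V0 (P n j) (P n j x)).
  by rewrite -natr1; apply: injective_projections => /=; rewrite /GRing.scale /=; ring.
apply: (le_trans (ler_normD _ _)).
apply: (le_trans (lerD (ler_normD _ _) (lexx _))).
apply: (le_trans (lerD (lerD hs hi) (lexx _))).
rewrite normrZ gtr0_norm//.
apply: (@le_trans _ _ (h_ n * (rho / 2 ^+ n) + i%:R * h_ n * (2 * a * M * (i%:R * h_ n) + rho / 2 ^+ n) +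
   h_ n * (a * (2 * (i%:R * (h_ n * M)))))).
  by rewrite lerD2l ler_wpM2l// ltW.
have i0 : 0 <= i%:R :> R by [].
rewrite -natr1 -subr_ge0.
rewrite (_ : _ - _ = h_ n ^+ 2 * (2 * a * M) * (i%:R + 1)); last by ring.
by rewrite !mulr_ge0 ?exprn_ge0 ?addr_ge0// ltW.
Qed.

Let Q := 2 * rho + a * M * tau.
Let Q0 : 0 <= Q.
Proof. by rewrite addr_ge0 ?mulr_ge0// ltW. Qed.

(** One coarse step is compared with two fine ones. The local errors are of order h_n Q / 2^n. The
    earlier discrepancy feeds back through the velocity, but by at most half of h_n Q / 2^n, because
    a k h_n <= a tau <= 1/8. Hence the bound grows only linearly in k. *)
Let P_refine n k x : (k <= 2 ^ n)%N ->
  `|P n.+1 k.*2 x - P n k x| <= 2 * (k%:R * h_ n) * (Q / 2 ^+ n).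
Proof.
elim: k x => [|k IH] x kn; first by rewrite double0 !P_start subrr normr0 mul0r mulr0 mul0r.
have k2 : (k.*2.+1 < 2 ^ n.+1)%N by rewrite expnS mul2n -doubleS leq_double.
have kn' := ltnW kn; have k2' := ltnW k2.
have [w1 _ _] := P_ok kn'; have [w2 _ _] := P_ok (ltnW k2'); have [w3 _ _] := P_ok k2'.
have h0 := h_gt0 n; have hE : h_ n.+1 = h_ n / 2.
  by rewrite /h_ exprS; field; rewrite expf_neq0.
have [_ e1] := P_step kn x; have [_ e2] := P_step k2' x; have [_ e3] := P_step k2 x.
have t1 z : `|P n.+1 k.*2.+1 z - P n.+1 k.*2 z| <= h_ n.+1 * M by have [] := P_step k2' z.
have v1 := V0_near x w3 w2 t1.
have v2 := V0_near x w2 w1 (fun z => IH z kn').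
have e4 := IH x kn'.
rewrite doubleS.
move: e1 e2 e3 v1 v2 e4; rewrite hE.
have kh : (0 <= k%:R * h_ n <= tau).
  rewrite mulr_ge0 ?(ltW h0)//= /h_ mulrCA ger_pMr//.
  by rewrite ler_pdivrMr ?exprn_gt0// mul1r -natrX ler_nat.
have hle : h_ n <= tau / 2 ^+ n by [].
have -> : rho / 2 ^+ n.+1 = rho / 2 ^+ n / 2 by rewrite exprS; field; rewrite expf_neq0.
have hM : h_ n / 2 * M <= 1 / 2 * (M * (tau / 2 ^+ n)) by rewrite /h_; lra.
have qE : Q / 2 ^+ n = 2 * (rho / 2 ^+ n) + a * M * h_ n by rewrite /Q /h_; field; rewrite expf_neq0.
have q0 : 0 <= Q / 2 ^+ n by rewrite divr_ge0// exprn_ge0.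
have r0 : 0 <= rho / 2 ^+ n by rewrite divr_ge0// exprn_ge0.
set vb := V0 (P n.+1 k.*2.+1) _; set va := V0 (P n.+1 k.*2) _; set v := V0 (P n k) _.
move: (P n.+1 k.*2.+2 x) (P n.+1 k.*2.+1 x) (P n.+1 k.*2 x) (P n k.+1 x) (P n k x) => p2 p1 p q1 q.
move=> e1 e2 e3 v1 v2 e4.
rewrite (_ : p2 - q1 = (p - q) + (p2 - p1 - (h_ n / 2) *: vb) + (p1 - p - (h_ n / 2) *: va) -
   (q1 - q - h_ n *: v) + (h_ n / 2) *: (vb - va) + h_ n *: (va - v)); last first.
  by apply: injective_projections => /=; rewrite /GRing.scale /=; field.
apply: (le_trans (ler_normD _ _)); rewrite normrZ gtr0_norm//.
apply: (le_trans (lerD (ler_normD _ _) (lexx _))); rewrite normrZ gtr0_norm ?divr_gt0//.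
apply: (le_trans (lerD (lerD (ler_normB _ _) (lexx _)) (lexx _))).
apply: (le_trans (lerD (lerD (lerD (ler_normD _ _) (lexx _)) (lexx _)) (lexx _))).
apply: (le_trans (lerD (lerD (lerD (lerD (ler_normD _ _) (lexx _)) (lexx _)) (lexx _)) (lexx _))).
have f1 : h_ n / 2 * `|vb - va| <= h_ n / 2 * (a * (2 * (h_ n / 2 * M))).
  by rewrite ler_wpM2l// divr_ge0// ltW.
have f2 : h_ n * `|va - v| <= h_ n * (a * (2 * (2 * (k%:R * h_ n) * (Q / 2 ^+ n)))).
  by rewrite ler_wpM2l// ltW.
have f3 : h_ n * (a * (2 * (2 * (k%:R * h_ n) * (Q / 2 ^+ n)))) <= h_ n * (Q / 2 ^+ n) / 2.
  have kha : a * (k%:R * h_ n) <= 1 / 8.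
    apply: le_trans tau_a; rewrite [leRHS]mulrC ler_wpM2l ?(ltW a0)//; lra.
  have : h_ n * (Q / 2 ^+ n) * (a * (k%:R * h_ n)) <= h_ n * (Q / 2 ^+ n) * (1 / 8).
    by rewrite ler_wpM2l// mulr_ge0// ltW.
  lra.
have f4 : 0 <= h_ n * (a * M * h_ n) by rewrite !mulr_ge0// ltW.
have f5 : 0 <= h_ n * (rho / 2 ^+ n) by rewrite mulr_ge0// ltW.
rewrite -[k.+1%:R]natr1.
move: e1 e2 e3 e4 f1 f2 f3 f4 f5; rewrite qE.
move: (rho / 2 ^+ n) (h_ n) (k%:R) => r h k'.
move: (`|_|) (`|_|) (`|_|) (`|_|) (`|_|) (`|_|) => A1 A2 A3 A4 A5 A6; lra.
Qed.

Let idx n t := Num.truncn (t / h_ n).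

Let idx_itv n t : 0 <= t -> (idx n t)%:R * h_ n <= t < ((idx n t)%:R + 1) * h_ n.
Proof.
move=> t0; have := truncn_itv (divr_ge0 t0 (ltW (h_gt0 n))).
by rewrite ler_pdivlMr// ltr_pdivrMr// natr1.
Qed.

Let idx_le n t : 0 <= t <= tau -> (idx n t <= 2 ^ n)%N.
Proof.
move=> /andP[t0 tt]; have /andP[h1 _] := idx_itv n t0.
have := le_trans h1 tt; rewrite /h_ mulrCA ger_pMr//.
by rewrite ler_pdivrMr ?exprn_gt0// mul1r -natrX ler_nat.
Qed.

Let idxS n t : 0 <= t -> idx n.+1 t = (idx n t).*2 \/ idx n.+1 t = (idx n t).*2.+1.
Proof.
move=> t0; have /andP[h1 h2] := idx_itv n t0; have /andP[h3 h4] := idx_itv n.+1 t0.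
have h0 := h_gt0 n.+1.
have hE : h_ n = 2 * h_ n.+1 by rewrite /h_ exprS; field; rewrite expf_neq0.
have d (k : nat) : k.*2%:R = 2 * k%:R :> R by rewrite -mul2n natrM.
have l1 : ((idx n t).*2 < (idx n.+1 t).+1)%N.
  rewrite -(ltr_nat R) d -[X in _ < X]natr1 -(ltr_pM2r h0); apply: le_lt_trans h4.
  by rewrite mulrAC -hE mulrC.
have l2 : (idx n.+1 t < (idx n t).*2.+2)%N.
  rewrite -(ltr_nat R) -doubleS d -[X in _ < _ * X]natr1 -(ltr_pM2r h0).
  by apply: (le_lt_trans h3); rewrite mulrAC -hE mulrC.
rewrite ltnS in l1; move: l2; rewrite ltnS leq_eqVlt ltnS => /orP[/eqP ->|l2]; first by right.
by left; apply/eqP; rewrite eqn_leq l1 l2.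
Qed.

Let X n t x := P n (idx n t) x.
(** First term from [P_refine] up to time tau; the second pays for the additional fine step when the
    finer index of t is odd. *)
Let W := 2 * tau * Q + tau * M.

Let X_refine n t x : 0 <= t <= tau -> `|X n.+1 t x - X n t x| <= W / 2 ^+ n.
Proof.
move=> tt; have kn := idx_le n tt; have kn' := idx_le n.+1 tt.
have e0 := P_refine x kn.
have kh : 2 * ((idx n t)%:R * h_ n) * (Q / 2 ^+ n) <= 2 * tau * (Q / 2 ^+ n).
  rewrite ler_wpM2r ?divr_ge0 ?exprn_ge0// ler_wpM2l//.
  case/andP: tt => t0 t1; have /andP[h1 _] := idx_itv n t0; exact: le_trans h1 t1.
have g0 : 0 <= tau * M / 2 ^+ n by rewrite divr_ge0 ?exprn_ge0// mulr_ge0// ltW.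
have -> : W / 2 ^+ n = 2 * tau * (Q / 2 ^+ n) + tau * M / 2 ^+ n.
  by rewrite /W; field; rewrite expf_neq0.
rewrite /X; case/andP: (tt) => t0 _; case: (idxS n t0) => E; rewrite E; first by lra.
have kS : ((idx n t).*2 < 2 ^ n.+1)%N by rewrite -E.
have [e1 _] := P_step kS x.
rewrite -(subrKA (P n.+1 (idx n t).*2 x)); apply: (le_trans (ler_normD _ _)).
have : h_ n.+1 * M <= tau * M / 2 ^+ n.
  rewrite /h_ mulrAC ler_wpM2l ?mulr_ge0 ?(ltW tau0)// lef_pV2 ?posrE ?exprn_gt0//.
  by rewrite exprS ler_peMl ?exprn_ge0// ler1n.
lra.
Qed.

Let flow_limit : exists Phi : R -> plane R -> plane R,
  forall t x n, 0 <= t <= tau -> `|X n t x - Phi t x| <= 2 * W / 2 ^+ n.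
Proof.
have /choice[f Hf] : forall p : R * plane R, exists l, 0 <= p.1 <= tau ->
    forall n, `|X n p.1 p.2 - l| <= 2 * W / 2 ^+ n.
  move=> [t x]; have [tt|nt] := pselect (0 <= t <= tau); last by exists 0 => /= /nt.
  by have [l Hl] := geom_limit2 (fun n => X_refine n x tt); exists l.
by exists (fun t x => f (t, x)) => t x n tt; exact: (Hf (t, x)).
Qed.

(** Each property holds for the approximants up to an error D / 2^n, which [le_geom] removes. The
    two distortion bounds come first, as the limit owes its injectivity and continuity to them. *)
Lemma scheme_limit : exists Phi : R -> plane R -> plane R,
  [/\ Phi 0 = Psi,
    (forall t, 0 <= t <= tau -> ok (Phi t)),
    (forall s t x, 0 <= s -> s <= t -> t <= tau -> `|Phi t x - Phi s x| <= M * (t - s)) &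
    (forall s t x, 0 <= s -> s <= t -> t <= tau ->
      `|Phi t x - Phi s x - (t - s) *: V0 (Phi s) (Phi s x)| <= 2 * a * M * (t - s) ^+ 2)].
Proof.
have [Phi HP] := flow_limit.
have [bPsi cPsi cPsi' _ _] := mPsi.
have lipX t n : 0 <= t <= tau -> [/\ ok (X n t),
    (forall x y, `|X n t x - X n t y| <= 2 * `|Psi x - Psi y|) &
    (forall x y, `|Psi x - Psi y| <= 2 * `|X n t x - X n t y|)].
  by move=> tt; exact: P_ok (idx_le n tt).
have lip1 t x y : 0 <= t <= tau -> `|Phi t x - Phi t y| <= 2 * `|Psi x - Psi y|.
  move=> tt; apply: (@le_geom _ _ _ (4 * W)) => n; have [_ h _] := lipX _ n tt.
  have -> : Phi t x - Phi t y = (X n t x - X n t y) - (X n t x - Phi t x) + (X n t y - Phi t y).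
    by apply: injective_projections => /=; ring.
  apply: (le_trans (ler_normD _ _)); apply: (le_trans (lerD (ler_normB _ _) (lexx _))).
  by have := h x y; have := HP t x n tt; have := HP t y n tt; lra.
have lip2 t x y : 0 <= t <= tau -> `|Psi x - Psi y| <= 2 * `|Phi t x - Phi t y|.
  move=> tt; apply: (@le_geom _ _ _ (8 * W)) => n; have [_ _ h] := lipX _ n tt.
  have : `|X n t x - X n t y| <= `|Phi t x - Phi t y| + 4 * W / 2 ^+ n.
    have -> : X n t x - X n t y = (Phi t x - Phi t y) + (X n t x - Phi t x) - (X n t y - Phi t y).
      by apply: injective_projections => /=; ring.
    apply: (le_trans (ler_normB _ _)); apply: (le_trans (lerD (ler_normD _ _) (lexx _))).
    by have := HP t x n tt; have := HP t y n tt; lra.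
  by have := h x y; lra.
have okPhi t : 0 <= t <= tau -> ok (Phi t).
  move=> tt; apply: ok_lip; last by move=> x y; exact: lip2.
  have hX n : measure_preserving_homeo (X n t) by have [/ok_mp] := lipX _ n tt.
  have bX n : bijective (X n t) by have [] := hX n.
  (* The inverses converge after composition with [Psi]: the approximants control distances between
     values of [Psi], whereas [inverse Psi] is merely continuous. [X_refine] at the point
     [inverse (X n t) y] provides the Cauchy bound. *)
  have /choice[p Hp] : forall y, exists p, forall n,
      `|Psi (inverse (X n t) y) - p| <= 2 * (2 * W) / 2 ^+ n.
    move=> y; apply: geom_limit2 => n; have [_ _ h] := lipX _ n.+1 tt.
    apply: (le_trans (h _ _)); rewrite inverseVK//.
    have := X_refine n (inverse (X n t) y) tt; rewrite inverseVK// distrC; lra.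
  pose G y := inverse Psi (p y).
  have PG y : Phi t (G y) = y.
    apply/eqP; rewrite -subr_eq0 -normr_le0; apply: (@le_geom _ _ _ (10 * W)) => n.
    have h1 := HP t (inverse (X n t) y) n tt; rewrite inverseVK// in h1.
    have h2 := lip1 t (G y) (inverse (X n t) y) tt; rewrite /G inverseVK// in h2.
    have := Hp y n; rewrite distrC => h3.
    rewrite -(subrKA (Phi t (inverse (X n t) y))); apply: (le_trans (ler_normD _ _)).
    by rewrite (distrC (Phi t _) y); lra.
  have GP : cancel (Phi t) G.
    move=> x; apply: (can_inj (inverseK bPsi)).
    apply/eqP; rewrite -subr_eq0 -normr_le0; apply: (le_trans (lip2 t _ _ tt)).
    by rewrite PG subrr normr0 mulr0.
  have cPhi : continuous (Phi t).
    have c1 : continuous (fun x => Phi t (inverse Psi x)).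
      apply: (@lipschitz_continuous _ _ _ _ 2) => x y.
      by apply: (le_trans (lip1 t _ _ tt)); rewrite !inverseVK.
    have -> : Phi t = (fun x => Phi t (inverse Psi x)) \o Psi by apply/funext => x /=; rewrite inverseK.
    by move=> x; apply: continuous_comp; [exact: cPsi|exact: c1].
  have cG : continuous G.
    have c1 : continuous p.
      apply: (@lipschitz_continuous _ _ _ _ 2) => x y.
      by have := lip2 t (G x) (G y) tt; rewrite !PG /G !inverseVK.
    by move=> x; apply: (@continuous_comp _ _ _ p (inverse Psi)); [exact: c1|exact: cPsi'].
  apply: (@homeo_limit _ (X ^~ t) _ G) => // x.
    by apply: (@cvg_geom _ _ _ _ (2 * W)) => n; exact: HP.
  have -> : (fun n => inverse (X n t) x) = (fun n => inverse Psi (Psi (inverse (X n t) x))).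
    by apply/funext => n; rewrite inverseK.
  apply: (@cvg_comp _ _ _ (fun n => Psi (inverse (X n t) x)) (inverse Psi) _ (nbhs (p x))); last exact: cPsi'.
  by apply: (@cvg_geom _ _ _ _ (2 * (2 * W))) => n; exact: Hp.
(* Indices are rounded-down quotients, so the steps between s and t cover t - s up to one step. *)
have idx_split s t n : 0 <= s -> s <= t -> t <= tau -> exists i,
    [/\ idx n t = (idx n s + i)%N, i%:R * h_ n <= tau, i%:R * h_ n <= t - s + h_ n &
        `|i%:R * h_ n - (t - s)| <= h_ n].
  move=> s0 st tt; exists (idx n t - idx n s)%N.
  have st' : (idx n s <= idx n t)%N.
    by apply: le_truncn; rewrite ler_wpM2r// invr_ge0 ltW.
  have /andP[s1 s2] := idx_itv n s0; have /andP[t1 t2] := idx_itv n (le_trans s0 st).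
  have h0 := h_gt0 n; have sh : 0 <= (idx n s)%:R * h_ n by rewrite mulr_ge0// ltW.
  rewrite subnKC// natrB// mulrBl ler_norml.
  rewrite mulrDl mul1r in s2; rewrite mulrDl mul1r in t2.
  move: ((idx n s)%:R * h_ n) ((idx n t)%:R * h_ n) s1 s2 t1 t2 sh.
  move=> A B s1 s2 t1 t2 sh; split => //; lra.
exists Phi; split => //.
- apply/funext => x; apply/eqP; rewrite -subr_eq0 -normr_le0; apply: (@le_geom _ _ _ (2 * W)) => n.
  have t0 : (0 : R) <= 0 <= tau by rewrite lexx ltW.
  have := HP 0 x n t0; rewrite /X /idx mul0r truncn0 P_start distrC add0r; exact.
- move=> s t x s0 st tt; apply: (@le_geom _ _ _ (M * tau + 4 * W)) => n.
  have s1 : 0 <= s <= tau by rewrite s0 (le_trans st).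
  have t1 : 0 <= t <= tau by rewrite tt (le_trans s0).
  have [i [iE i1 i2 i3]] := idx_split s t n s0 st tt.
  have it : (idx n s + i <= 2 ^ n)%N by rewrite -iE; exact: idx_le.
  have := P_time x it; rewrite -iE => h.
  have -> : Phi t x - Phi s x = (X n t x - X n s x) - (X n t x - Phi t x) + (X n s x - Phi s x).
    by apply: injective_projections => /=; ring.
  apply: (le_trans (ler_normD _ _)); apply: (le_trans (lerD (ler_normB _ _) (lexx _))).
  have : M * (i%:R * h_ n) <= M * (t - s + h_ n) by rewrite ler_wpM2l.
  have := HP t x n t1; have := HP s x n s1; move: h; rewrite -/(X n t x) -/(X n s x).
  have -> : (M * tau + 4 * W) / 2 ^+ n = M * h_ n + 2 * (2 * W / 2 ^+ n).
    by rewrite /h_; field; rewrite expf_neq0.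
  move: (h_ n) (`|_|) (`|_|) (`|_|) (i%:R) (2 * W / 2 ^+ n) => h A1 A2 A3 i' w; lra.
- move=> s t x s0 st tt; pose v := V0 (Phi s) (Phi s x).
  apply: (@le_geom _ _ _ (4 * W + tau * rho + tau * (a * (4 * W)) + tau * `|v| + 6 * a * M * tau ^+ 2)) => n.
  have s1 : 0 <= s <= tau by rewrite s0 (le_trans st).
  have t1 : 0 <= t <= tau by rewrite tt (le_trans s0).
  have [i [iE i1 i2 i3]] := idx_split s t n s0 st tt.
  have it : (idx n s + i <= 2 ^ n)%N by rewrite -iE; exact: idx_le.
  have := P_time_quad x it; rewrite -iE -/(X n t x) -/(X n s x).
  have i0 : 0 <= i%:R * h_ n by rewrite mulr_ge0// ltW.
  have [wX _ _] := lipX s n s1.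
  have := V0_near x wX (okPhi s s1) (fun z => HP s z n s1).
  rewrite -/v -/(X n s x) -[V0 (P n (idx n s)) (X n s x)]/(V0 (X n s) (X n s x)).
  move: (V0 (X n s) (X n s x)) => vn.
  have := HP t x n t1; have := HP s x n s1.
  have h0 := h_gt0 n; have ht : h_ n <= tau.
    by rewrite /h_ ler_pdivrMr ?exprn_gt0// ler_peMr ?(ltW tau0)// exprn_ege1// ler1n.
  have -> : (4 * W + tau * rho + tau * (a * (4 * W)) + tau * `|v| + 6 * a * M * tau ^+ 2) / 2 ^+ n =
    4 * W / 2 ^+ n + tau * (rho / 2 ^+ n) + tau * (a * (4 * W / 2 ^+ n)) + h_ n * `|v| + 6 * a * M * (tau * h_ n).
    by rewrite /h_; field; rewrite expf_neq0.
  have w0 : 0 <= 2 * W / 2 ^+ n by apply: le_trans (HP s x n s1); exact: normr_ge0.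
  have r0 : 0 <= rho / 2 ^+ n by rewrite divr_ge0// exprn_ge0.
  have dt : 0 <= t - s <= tau by apply/andP; split; lra.
  have -> : 4 * W / 2 ^+ n = 2 * (2 * W / 2 ^+ n) by field; rewrite expf_neq0.
  move: (i%:R * h_ n) i0 i1 i2 i3 => D D0 D1 D2 D3 e1 e2 e3 e4.
  (* In order: convergence at t and at s, the discrete Taylor estimate over the i steps, the
     velocity of the approximant against that of the limit, and the mismatch between D = i h_n and t
     - s. *)
  rewrite (_ : Phi t x - Phi s x - (t - s) *: v = - (X n t x - Phi t x) + (X n s x - Phi s x) +
    (X n t x - X n s x - D *: vn) + D *: (vn - v) + (D - (t - s)) *: v); last first.
    by apply: injective_projections => /=; rewrite /GRing.scale /=; ring.
  apply: (le_trans (ler_normD _ _)); rewrite normrZ.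
  apply: (le_trans (lerD (ler_normD _ _) (lexx _))); rewrite normrZ ger0_norm//.
  apply: (le_trans (lerD (lerD (ler_normD _ _) (lexx _)) (lexx _))).
  apply: (le_trans (lerD (lerD (lerD (ler_normD _ _) (lexx _)) (lexx _)) (lexx _))); rewrite normrN.
  have f1 : `|D - (t - s)| * `|v| <= h_ n * `|v| by rewrite ler_wpM2r.
  have f2 : D * `|vn - v| <= tau * (a * (2 * (2 * W / 2 ^+ n))).
    by apply: ler_pM.
  have f3 : D * (rho / 2 ^+ n) <= tau * (rho / 2 ^+ n) by rewrite ler_wpM2r.
  have am : 0 <= a * M by rewrite mulr_ge0// ltW.
  have f4 : a * M * (D * D) <= a * M * ((t - s) ^+ 2 + 3 * (tau * h_ n)).
    rewrite ler_wpM2l//; case/andP: dt => dt0 dt1.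
    apply: (@le_trans _ _ ((t - s + h_ n) * (t - s + h_ n))); first by apply: ler_pM => //; lra.
    have : (t - s) * h_ n <= tau * h_ n by rewrite ler_wpM2r// ltW.
    have : h_ n * h_ n <= tau * h_ n by rewrite ler_wpM2r// ltW.
    by rewrite expr2; move: (t - s) (h_ n) => p q; lra.
  move: e1 e2 e3 e4 f1 f2 f3 f4.
  move: (h_ n) (2 * W / 2 ^+ n) (rho / 2 ^+ n) (t - s) => h w r q.
  move: (`|_|) (`|_|) (`|_|) (`|_| * `|_|) (`|_|) (`|_|) => A1 A2 A3 A4 A5 A6; lra.
Qed.

End passage.

(** * Flows *)

Section real_ode.
Context {R : realType}.

Lemma is_derive1P (W : normedModType R) (f : R -> W) (x : R) (v : W) :
  is_derive x 1 f v <-> h^-1 *: (f (h + x) - f x) @[h --> 0^'] --> v.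
Proof.
have E : (fun h : R => h^-1 *: ((f \o shift x) (h *: 1) - f x)) =
    (fun h : R => h^-1 *: (f (h + x) - f x)).
  by apply/funext => h; rewrite /= /GRing.scale /= mulr1.
split=> [[d]|H].
  by rewrite /derive E => <-; move: d; rewrite /derivable E.
split; first by rewrite /derivable E; apply/cvg_ex; exists v.
by rewrite /derive E; apply: cvg_lim.
Qed.

Lemma is_derive_fst (f : R -> plane R) (x : R) (v : plane R) :
  is_derive x 1 f v -> is_derive x 1 (fun t => (f t).1) v.1.
Proof.
move=> /is_derive1P H; apply/is_derive1P.
exact: (cvg_comp (fun h => h^-1 *: (f (h + x) - f x)) fst H cvg_fst).
Qed.

Lemma is_derive_snd (f : R -> plane R) (x : R) (v : plane R) :
  is_derive x 1 f v -> is_derive x 1 (fun t => (f t).2) v.2.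
Proof.
move=> /is_derive1P H; apply/is_derive1P.
exact: (cvg_comp (fun h => h^-1 *: (f (h + x) - f x)) snd H cvg_snd).
Qed.

Lemma is_derive_fstB (f g : R -> plane R) (x : R) (v w : plane R) :
  is_derive x 1 f v -> is_derive x 1 g w ->
  is_derive x 1 (fun t => (f t).1 - (g t).1) (v.1 - w.1).
Proof. by move=> /is_derive_fst df /is_derive_fst dg; exact: is_deriveB. Qed.

Lemma is_derive_sndB (f g : R -> plane R) (x : R) (v w : plane R) :
  is_derive x 1 f v -> is_derive x 1 g w ->
  is_derive x 1 (fun t => (f t).2 - (g t).2) (v.2 - w.2).
Proof. by move=> /is_derive_snd df /is_derive_snd dg; exact: is_deriveB. Qed.

Lemma is_derive_sqr_add (f g : R -> R) (x v w : R) :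
  is_derive x 1 f v -> is_derive x 1 g w ->
  is_derive x 1 (fun t => f t * f t + g t * g t) (2 * (f x * v) + 2 * (g x * w)).
Proof.
move=> df dg; apply: is_derive_eq; rewrite /GRing.scale /=; ring.
Qed.

Lemma quad_derive (W : normedModType R) (f : R -> W) (x K r : R) (v : W) : 0 < r ->
  (forall t, `|t - x| < r -> `|f t - f x - (t - x) *: v| <= K * (t - x) ^+ 2) ->
  is_derive x 1 f v.
Proof.
move=> r0 H; apply/is_derive1P/cvgrPdist_le => e e0.
have K1 : 0 < `|K| + 1 by rewrite ltr_wpDl.
near=> h.
have h0 : h != 0 by near: h; exact: nbhs_dnbhs_neq.
have hr : `|h| < r by near: h; apply: dnbhs0_lt.
have he : `|h| <= e / (`|K| + 1) by near: h; apply: dnbhs0_le; rewrite divr_gt0.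
have -> : v - h^-1 *: (f (h + x) - f x) = - (h^-1 *: (f (h + x) - f x - h *: v)).
  by rewrite [in RHS]scalerBr scalerA mulVf// scale1r opprB.
rewrite normrN normrZ normfV ler_pdivrMl ?normr_gt0//.
have := H (h + x); rewrite addrK => /(_ hr) /le_trans; apply.
rewrite -real_normK ?num_real// expr2 mulrA mulrC ler_wpM2l//.
apply: (@le_trans _ _ (`|K| * `|h|)); first by rewrite ler_wpM2r// ler_norm.
move: he; rewrite ler_pdivlMr// => he; apply: le_trans he.
by rewrite mulrC ler_wpM2l// lerDl.
Unshelve. all: by end_near. Qed.

Lemma derive_le0_le (f df : R -> R) (a b : R) : a <= b ->
  (forall t, a <= t <= b -> is_derive t 1 f (df t)) ->
  (forall t, a <= t <= b -> df t <= 0) -> f b <= f a.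
Proof.
move=> ab fd df0.
have cf : {within `[a, b], continuous f}.
  apply: derivable_within_continuous => t; rewrite in_itv /= => /fd d; exact: ex_derive.
have d' (t : R) : t \in `]a, b[ -> is_derive t 1 f (df t).
  by rewrite in_itv /= => /andP[/ltW h1 /ltW h2]; apply: fd; rewrite h1.
have [c] := MVT_segment ab d' cf; rewrite in_itv /= => /df0 h E.
by rewrite -subr_le0 E mulr_le0_ge0// subr_ge0.
Qed.

Lemma derive_bound (f df : R -> R) (M a b : R) : a <= b ->
  (forall t, a <= t <= b -> is_derive t 1 f (df t)) ->
  (forall t, a <= t <= b -> `|df t| <= M) -> `|f b - f a| <= M * (b - a).
Proof.
move=> ab fd dfM.
have dM (t : R) : is_derive t 1 (fun t : R => M * t) M.
  by apply: is_derive_eq; rewrite /GRing.scale /=; ring.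
rewrite ler_norml; apply/andP; split.
  have : - f b - M * b <= - f a - M * a.
    apply: (@derive_le0_le (fun t => - f t - M * t) (fun t => - df t - M) _ _ ab) => t tab.
      by have := fd t tab => fdt; apply: is_deriveB.
    by have := dfM t tab; rewrite ler_norml; lra.
  by rewrite mulrBr; lra.
have : f b - M * b <= f a - M * a.
  apply: (@derive_le0_le (fun t => f t - M * t) (fun t => df t - M) _ _ ab) => t tab.
    by have := fd t tab => fdt; apply: is_deriveB.
  by have := dfM t tab; rewrite ler_norml; lra.
by rewrite mulrBr; lra.
Qed.

Lemma is_derive_exp_linear (k a t : R) :
  is_derive t 1 (fun t : R => expR (k * (t - a))) (k * expR (k * (t - a))).
Proof.
have d : is_derive t 1 (fun t : R => k * (t - a)) k.
  by apply: is_derive_eq; rewrite /GRing.scale /=; ring.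
have := @is_derive1_comp _ expR (fun t : R => k * (t - a)) t _ _ (is_derive_expR (k * (t - a))) d.
by rewrite mulrC.
Qed.

(** The right-hand side has derivative B exp(k (t - a)), so f and - f minus it are nonincreasing. In
    the uniqueness proof k is twice the Lipschitz rate, and each application halves the constant. *)
Lemma gronwall_exp (f df : R -> R) (B k a b : R) : 0 < k -> 0 <= B -> a <= b ->
  (forall t, a <= t <= b -> is_derive t 1 f (df t)) -> f a = 0 ->
  (forall t, a <= t <= b -> `|df t| <= B * expR (k * (t - a))) ->
  `|f b| <= B / k * expR (k * (b - a)).
Proof.
move=> k0 B0 ab fd fa dfB.
have dE (t : R) : is_derive t 1 (fun t : R => B / k * expR (k * (t - a))) (B * expR (k * (t - a))).
  have d := is_derive_exp_linear k a t.
  by apply: is_derive_eq; rewrite /GRing.scale /=; field; rewrite gt_eqF.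
have Bk : 0 <= B / k by rewrite divr_ge0// ltW.
rewrite ler_norml; apply/andP; split.
  have : - f b - B / k * expR (k * (b - a)) <= - f a - B / k * expR (k * (a - a)).
    apply: (@derive_le0_le (fun t => - f t - B / k * expR (k * (t - a)))
      (fun t => - df t - B * expR (k * (t - a))) _ _ ab) => t tab.
      by have := fd t tab => fdt; apply: is_deriveB.
    by have := dfB t tab; rewrite ler_norml; lra.
  by rewrite fa subrr mulr0 expR0; lra.
have : f b - B / k * expR (k * (b - a)) <= f a - B / k * expR (k * (a - a)).
  apply: (@derive_le0_le (fun t => f t - B / k * expR (k * (t - a)))
    (fun t => df t - B * expR (k * (t - a))) _ _ ab) => t tab.
    by have := fd t tab => fdt; apply: is_deriveB.
  by have := dfB t tab; rewrite ler_norml; lra.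
by rewrite fa subrr mulr0 expR0; lra.
Qed.

(** exp(- k t) f is nonincreasing and exp(k t) f nondecreasing; the second fact bounds the past by
    the future, as the inverse flow requires. *)
Lemma gronwall_linear (f df : R -> R) (k a b : R) : a <= b ->
  (forall t, a <= t <= b -> is_derive t 1 f (df t)) ->
  (forall t, a <= t <= b -> `|df t| <= k * f t) ->
  f b <= expR (k * (b - a)) * f a /\ f a <= expR (k * (b - a)) * f b.
Proof.
move=> ab fd dfk; split.
  have : expR (- k * (b - a)) * f b <= expR (- k * (a - a)) * f a.
    apply: (@derive_le0_le (fun t => expR (- k * (t - a)) * f t)
      (fun t => expR (- k * (t - a)) *: df t + f t *: (- k * expR (- k * (t - a)))) _ _ ab) => t tab.
      by have := fd t tab => fdt; apply: is_deriveM; exact: is_derive_exp_linear.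
    rewrite /GRing.scale /= (_ : _ + _ = expR (- k * (t - a)) * (df t - k * f t)); last by ring.
    rewrite pmulr_rle0 ?expR_gt0//.
    by have := dfk t tab; rewrite ler_norml; lra.
  rewrite subrr mulr0 expR0 mul1r mulNr expRN => h.
  by rewrite -ler_pdivrMl ?expR_gt0.
have : - (expR (k * (b - a)) * f b) <= - (expR (k * (a - a)) * f a).
  apply: (@derive_le0_le (fun t => - (expR (k * (t - a)) * f t))
    (fun t => - (expR (k * (t - a)) *: df t + f t *: (k * expR (k * (t - a))))) _ _ ab) => t tab.
    have := fd t tab => fdt; apply: is_deriveN; apply: is_deriveM; exact: is_derive_exp_linear.
  rewrite /GRing.scale /= oppr_le0 (_ : _ + _ = expR (k * (t - a)) * (df t + k * f t)); last by ring.
  rewrite pmulr_rge0 ?expR_gt0//.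
  by have := dfk t tab; rewrite ler_norml; lra.
by rewrite subrr mulr0 expR0 mul1r; lra.
Qed.

Lemma is_derive_reflect (W : normedModType R) (f : R -> W) (x : R) (v : W) :
  is_derive x 1 f v -> is_derive (- x) 1 (fun t => f (- t)) (- v).
Proof.
move=> /is_derive1P H; apply/is_derive1P.
have E : (fun h : R => h^-1 *: (f (- (h + - x)) - f (- - x))) =
    (fun h : R => - (h^-1 *: (f (h + x) - f x))) \o -%R.
  by apply/funext => h /=; rewrite opprD opprK invrN scaleNr opprK.
rewrite E; apply: (cvg_comp (-%R) (fun h : R => - (h^-1 *: (f (h + x) - f x))) (G := 0^')).
  move=> A [d /= d0 HA]; exists d => //= h hd h0; apply: HA; last by rewrite oppr_eq0.
  by move: hd; rewrite /= !sub0r (normrN (- h)).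
exact: (cvgN H).
Qed.

End real_ode.

Section two_sided.
Context {R : realType}.

(* Two quadratic Taylor estimates, on [-tau, 0] and on [0, tau], yield one on   *)
(* [-tau, tau].                                                                *)
Lemma quad_glue (f v : R -> plane R) (K K' tau : R) :
  0 <= tau -> 0 <= K -> 0 <= K' ->
  (forall s t, 0 <= s <= tau -> 0 <= t <= tau ->
     `|f t - f s - (t - s) *: v s| <= K * (t - s) ^+ 2 /\ `|v t - v s| <= K' * `|t - s|) ->
  (forall s t, - tau <= s <= 0 -> - tau <= t <= 0 ->
     `|f t - f s - (t - s) *: v s| <= K * (t - s) ^+ 2 /\ `|v t - v s| <= K' * `|t - s|) ->
  forall s t, - tau <= s <= tau -> - tau <= t <= tau ->
    `|f t - f s - (t - s) *: v s| <= (K + K') * (t - s) ^+ 2.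
Proof.
move=> tau0 K0 K'0 Hp Hn s t st tt.
have weaken (A : R) : A <= K * (t - s) ^+ 2 -> A <= (K + K') * (t - s) ^+ 2.
  by move=> h; rewrite mulrDl (le_trans h)// lerDl mulr_ge0// sqr_ge0.
(* Through 0 the velocity at s is replaced by that at 0, at the cost K' |t| |s|. As s and t lie on
   opposite sides of 0, |t| |s| = - t s, and (t - s)^2 = t^2 + s^2 - 2 t s absorbs it. *)
have cross : (0 <= t) != (0 <= s) ->
    `|f t - f 0 - (t - 0) *: v 0| <= K * (t - 0) ^+ 2 ->
    `|f 0 - f s - (0 - s) *: v s| <= K * (0 - s) ^+ 2 -> `|v 0 - v s| <= K' * `|0 - s| ->
    `|f t - f s - (t - s) *: v s| <= (K + K') * (t - s) ^+ 2.
  move=> ts h1 h2 h3.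
  have -> : f t - f s - (t - s) *: v s = (f t - f 0 - (t - 0) *: v 0) +
      (f 0 - f s - (0 - s) *: v s) + t *: (v 0 - v s).
    by apply: injective_projections => /=; rewrite /GRing.scale /=; ring.
  apply: (le_trans (ler_normD _ _)); rewrite normrZ.
  apply: (le_trans (lerD (ler_normD _ _) (lexx _))).
  have h4 : `|t| * `|v 0 - v s| <= `|t| * (K' * `|0 - s|) by rewrite ler_wpM2l.
  have ts0 : t * s <= 0.
    move: ts; case: (leP 0 t) => t0; case: (leP 0 s) => s0 //= _.
      by rewrite mulr_ge0_le0// ltW.
    by rewrite mulr_le0_ge0// ltW.
  have E2 : `|t| * (K' * `|0 - s|) = - (K' * (t * s)).
    by rewrite sub0r normrN mulrCA -normrM ler0_norm// mulrN.
  move: h4; rewrite E2 => h4.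
  have k1 : 0 <= K * - (t * s) by rewrite mulr_ge0// oppr_ge0.
  have k2 : 0 <= K' * - (t * s) by rewrite mulr_ge0// oppr_ge0.
  have k3 : 0 <= K' * t ^+ 2 by rewrite mulr_ge0// sqr_ge0.
  have k4 : 0 <= K' * s ^+ 2 by rewrite mulr_ge0// sqr_ge0.
  move: h1 h2 h4; move: (`|_|) (`|_|) (`|_| * `|_|) => A B D; rewrite subr0 sub0r sqrrN; lra.
have z1 : (0 : R) <= 0 <= tau by rewrite lexx.
have z2 : - tau <= (0 : R) <= 0 by rewrite lexx oppr_le0 tau0.
case/andP: st => s1 s2; case/andP: tt => t1 t2.
case: (leP 0 s) => s0; case: (leP 0 t) => t0.
- by apply: weaken; apply: (Hp _ _ _ _).1; apply/andP.
- have t' : - tau <= t <= 0 by rewrite t1 ltW.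
  have s' : 0 <= s <= tau by rewrite s0.
  apply: cross; first by rewrite s0 leNgt t0.
  + exact: (Hn _ _ z2 t').1.
  + exact: (Hp _ _ s' z1).1.
  + exact: (Hp _ _ s' z1).2.
- have t' : 0 <= t <= tau by rewrite t0.
  have s' : - tau <= s <= 0 by rewrite s1 ltW.
  apply: cross; first by rewrite t0 leNgt s0.
  + exact: (Hp _ _ z1 t').1.
  + exact: (Hn _ _ s' z2).1.
  + exact: (Hn _ _ s' z2).2.
- by apply: weaken; apply: (Hn _ _ _ _).1; apply/andP; split => //; exact: ltW.
Qed.

End two_sided.

(** * Local existence *)

Section local_flow.
Context {R : realType}.
Variable alpha : R.
Hypothesis alpha_itv : 0 < alpha < 1 / 2.
Variable th0 : plane R -> R.
Hypothesis th0L : L1Linfty th0.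
Context d (L : measurableType d) (mu : signed_measure L R) (Theta : set (lplane R * L)).
Hypothesis cake : layer_cake mu Theta th0.
Implicit Types (Phi : R -> plane R -> plane R) (Psi : plane R -> plane R).

Let velN c eps Psi x : vel alpha th0 (- c) eps Psi x = - vel alpha th0 c eps Psi x.
Proof. by rewrite /vel !mulNr. Qed.

(** Forward in time only; since [c] may have either sign, the same statement for - c gives the
    backward half through [velN]. *)
Let half_flow (c : R) Psi (Lam : R) : measure_preserving_homeo Psi -> 0 < Lam ->
  (L_mu mu (push_set Theta Psi) alpha <= Lam%:E)%E ->
  let a := vel_const alpha c * (4 * Lam) in
  let tau := (8 * a)^-1 in
  exists Phi, [/\ Phi 0 = Psi,
    (forall t : R, 0 <= t <= tau -> measure_preserving_homeo (Phi t) /\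
       (L_mu mu (push_set Theta (Phi t)) alpha <= (4 * Lam)%:E)%E) &
    (forall (s t : R) x, 0 <= s <= tau -> 0 <= t <= tau ->
      `|Phi t x - Phi s x - (t - s) *: vel alpha th0 c 0 (Phi s) (Phi s x)| <=
         4 * a * vel_bound alpha th0L c * (t - s) ^+ 2 /\
      `|vel alpha th0 c 0 (Phi t) (Phi t x) - vel alpha th0 c 0 (Phi s) (Phi s x)| <=
         2 * a * vel_bound alpha th0L c * `|t - s|)].
Proof.
move=> mPsi Lam0 LPsi a tau.
have C0 : 0 < vel_const alpha c by apply: lt_le_trans (vel_const_ge1 alpha_itv c).
have M0 : 0 <= vel_bound alpha th0L c.
  by apply: le_trans (vel_le alpha_itv th0L c 0 0 mPsi); exact: normr_ge0.
have a0 : 0 < a by rewrite mulr_gt0// mulr_gt0.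
have tau0 : 0 < tau by rewrite invr_gt0 mulr_gt0.
pose V eps F x := vel alpha th0 c eps F x.
pose Lf F := L_mu mu (push_set Theta F) alpha.
have V_reg (eta : R) : 0 < eta -> exists2 eps : R, 0 < eps &
    forall F x, measure_preserving_homeo F -> `|V eps F x - V 0 F x| <= eta.
  move=> /(vel_rate_small alpha_itv th0L c) [eps eps0 h]; exists eps => // F x mF.
  exact: le_trans (vel_reg alpha_itv th0L c x mF eps0) h.
have V_le eps F x : measure_preserving_homeo F -> `|V eps F x| <= vel_bound alpha th0L c.
  exact: vel_le.
have V_lip := @vel_lip _ _ alpha_itv _ th0L _ _ _ _ cake c.
have Lf_growth F G (l : R) : 1 <= l -> measure_preserving_homeo F -> measure_preserving_homeo G ->
    (forall x y, `|G x - G y| <= l * `|F x - F y|) -> (Lf F <= (2 * l)%:E * Lf G)%E.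
  move=> l1 mF mG h; apply: L_mu_image => //; first by lra.
  move=> x y; apply: (le_trans (ler_enorm_norm _)); rewrite -mulrA ler_wpM2l//.
  by apply: (le_trans (h x y)); rewrite ler_wpM2l ?ler_norm_enorm//; lra.
have step := @homeo_step _ _ alpha_itv _ th0L _ _ _ _ cake c.
have /choice[P HP] := discrete C0 M0 V_reg V_le V_lip Lf_growth step mPsi Lam0 LPsi.
pose ok F := measure_preserving_homeo F /\ (Lf F <= (4 * Lam)%:E)%E.
have tau_a : tau * a <= 1 / 8 by rewrite (_ : tau * a = 1 / 8)// /tau; field; rewrite gt_eqF.
have rho0 : 0 <= 1 + a * vel_bound alpha th0L c * tau.
  apply: addr_ge0 => //; apply: mulr_ge0; last exact: ltW.
  by apply: mulr_ge0 => //; exact: ltW.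
have ok_lip F : measure_preserving_homeo F ->
    (forall x y, `|Psi x - Psi y| <= 2 * `|F x - F y|) -> ok F.
  move=> mF h; split => //; have l1 : (1 : R) <= 2 by rewrite ler1n.
  apply: (le_trans (Lf_growth _ _ _ l1 mF mPsi h)).
  apply: (@le_trans _ _ ((2 * 2)%:E * Lam%:E)%E); first by apply: lee_wpmul2l.
  by rewrite -EFinM -natrM.
have V0_lip F G (D : R) x y : ok F -> ok G -> 0 <= D ->
    (forall z, `|(x - F z) - (y - G z)| <= D) -> `|V 0 F x - V 0 G y| <= a * D.
  move=> [mF LF] [mG _] D0 h; apply: V_lip => //; last by rewrite mulr_ge0// ltW.
have P0 n : P n 0%N = Psi by have [] := HP n.
have P_ok n k : (k <= 2 ^ n)%N -> [/\ ok (P n k),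
    (forall x y, `|P n k x - P n k y| <= 2 * `|Psi x - Psi y|) &
    (forall x y, `|Psi x - Psi y| <= 2 * `|P n k x - P n k y|)].
  by move=> kn; have [_ /(_ k kn)[]] := HP n.
have P_step n k : (k < 2 ^ n)%N -> forall x,
    `|P n k.+1 x - P n k x| <= tau / 2 ^+ n * vel_bound alpha th0L c /\
    `|P n k.+1 x - P n k x - (tau / 2 ^+ n) *: V 0 (P n k) (P n k x)| <=
      tau / 2 ^+ n * ((1 + a * vel_bound alpha th0L c * tau) / 2 ^+ n).
  by move=> kn x; have [_ _ /(_ k kn x)] := HP n.
have ok_mp F : ok F -> measure_preserving_homeo F by case.
have [Phi [Phi0 okPhi Phi_time Phi_quad]] :=
  scheme_limit a0 M0 tau0 tau_a rho0 mPsi ok_mp ok_lip V0_lip P0 P_ok P_step.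
exists Phi; split => //.
have near0 s t x : 0 <= s <= tau -> 0 <= t <= tau -> `|Phi t x - Phi s x| <= vel_bound alpha th0L c * `|t - s|.
  move=> /andP[s0 s1] /andP[t0 t1]; case: (leP s t) => [st|/ltW ts].
    by rewrite [`|t - s|]ger0_norm ?subr_ge0//; exact: Phi_time.
  by rewrite distrC [`|t - s|]distrC [`|s - t|]ger0_norm ?subr_ge0//; exact: Phi_time.
have vdiff s t x : 0 <= s <= tau -> 0 <= t <= tau ->
    `|V 0 (Phi t) (Phi t x) - V 0 (Phi s) (Phi s x)| <= 2 * a * vel_bound alpha th0L c * `|t - s|.
  move=> s1 t1; rewrite (_ : 2 * a * _ * _ = a * (2 * (vel_bound alpha th0L c * `|t - s|))); last by ring.
  apply: V0_lip; [exact: okPhi|exact: okPhi|by rewrite mulr_ge0// mulr_ge0|] => z.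
  rewrite (_ : _ - _ = (Phi t x - Phi s x) - (Phi t z - Phi s z)); last first.
    by apply: injective_projections => /=; ring.
  apply: (le_trans (ler_normB _ _)); have := near0 s t x s1 t1; have := near0 s t z s1 t1; lra.
move=> s t x s1 t1; split; last exact: vdiff.
have aM0 : 0 <= a * vel_bound alpha th0L c * (t - s) ^+ 2.
  by rewrite mulr_ge0 ?sqr_ge0// mulr_ge0// ltW.
case/andP: (s1) => s0 s2; case/andP: (t1) => t0 t2; case: (leP s t) => [st|/ltW ts].
  by apply: (le_trans (Phi_quad s t x s0 st t2)); lra.
(* For t < s the Taylor estimate is based at t; moving the base point to s costs the variation 2 a M
   |t - s| of the velocity, which doubles the constant. *)
have -> : Phi t x - Phi s x - (t - s) *: vel alpha th0 c 0 (Phi s) (Phi s x) =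
   - (Phi s x - Phi t x - (s - t) *: V 0 (Phi t) (Phi t x)) +
   (t - s) *: (V 0 (Phi t) (Phi t x) - V 0 (Phi s) (Phi s x)).
  rewrite -/(V 0 (Phi s) (Phi s x)).
  move: (V 0 (Phi t) (Phi t x)) (V 0 (Phi s) (Phi s x)) => v w.
  by apply: injective_projections => /=; rewrite /GRing.scale /=; ring.
apply: (le_trans (ler_normD _ _)); rewrite normrN normrZ.
have h1 := Phi_quad t s x t0 ts s2.
have h2 : `|t - s| * `|V 0 (Phi t) (Phi t x) - V 0 (Phi s) (Phi s x)| <=
    `|t - s| * (2 * a * vel_bound alpha th0L c * `|t - s|) by rewrite ler_wpM2l// vdiff.
move: h1 h2; rewrite (_ : `|t - s| * (_ * `|t - s|) = 2 * a * vel_bound alpha th0L c * (t - s) ^+ 2); last first.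
  by rewrite mulrCA -expr2 real_normK ?num_real.
rewrite -sqrrN opprB.
move: (`|_|) (`|_| * `|_|) (vel_bound alpha th0L c) ((t - s) ^+ 2) => A B M q; lra.
Qed.

(** [tau] comes before [Psi]: it depends on [c] and [Lam] only, on which continuation and blow-up
    rest. The halves are joined through their Taylor estimates, so that the two-sided derivative at
    time 0 is covered too. *)
Lemma local_flow (c Lam : R) : 0 < Lam -> exists2 tau : R, 0 < tau &
  forall Psi, measure_preserving_homeo Psi ->
  (L_mu mu (push_set Theta Psi) alpha <= Lam%:E)%E ->
  exists Phi, [/\ Phi 0 = Psi,
    (forall t : R, `|t| < tau -> measure_preserving_homeo (Phi t) /\
       (L_mu mu (push_set Theta (Phi t)) alpha <= (4 * Lam)%:E)%E) &
    (forall (t : R) x, `|t| < tau ->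
      is_derive t 1 (Phi ^~ x) (vel alpha th0 c 0 (Phi t) (Phi t x)))].
Proof.
move=> Lam0; pose a := vel_const alpha c * (4 * Lam); pose tau := (8 * a)^-1.
have C0 : 0 < vel_const alpha c by apply: lt_le_trans (vel_const_ge1 alpha_itv c).
have a0 : 0 < a by rewrite mulr_gt0// mulr_gt0.
have tau0 : 0 < tau by rewrite invr_gt0 mulr_gt0.
exists tau => // Psi mPsi LPsi.
have [F [F0 okF HF]] := half_flow c mPsi Lam0 LPsi.
have [G []] := half_flow (- c) mPsi Lam0 LPsi.
rewrite (_ : vel_const alpha (- c) = vel_const alpha c); last by rewrite /vel_const normrN.
rewrite (_ : vel_bound alpha th0L (- c) = vel_bound alpha th0L c); last by rewrite /vel_bound normrN.
rewrite -/a -/tau in okF HF * => G0 okG HG.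
have M0 : 0 <= vel_bound alpha th0L c.
  by apply: le_trans (vel_le alpha_itv th0L c 0 0 mPsi); exact: normr_ge0.
pose Phi t := if 0 <= t then F t else G (- t).
have Pp t : 0 <= t -> Phi t = F t by rewrite /Phi => ->.
have Pn t : t <= 0 -> Phi t = G (- t).
  rewrite le_eqVlt => /orP[/eqP ->|t0]; last by rewrite /Phi leNgt t0.
  by rewrite Pp// oppr0 F0 G0.
exists Phi; split; first by rewrite Pp.
  move=> t; rewrite ltr_norml => /andP[t1 t2]; case: (leP 0 t) => t0.
    by rewrite (Pp _ t0); apply: okF; rewrite t0 (ltW t2).
  by rewrite (Pn _ (ltW t0)); apply: okG; rewrite oppr_ge0 (ltW t0) lerNl (ltW t1).
move=> s x; rewrite ltr_norml => /andP[s1 s2].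
pose v t := vel alpha th0 c 0 (Phi t) (Phi t x).
have K0 : 0 <= 4 * a * vel_bound alpha th0L c by rewrite mulr_ge0// mulr_ge0// ltW.
have K'0 : 0 <= 2 * a * vel_bound alpha th0L c by rewrite mulr_ge0// mulr_ge0// ltW.
have quad : forall s t, - tau <= s <= tau -> - tau <= t <= tau ->
    `|Phi t x - Phi s x - (t - s) *: v s| <=
      (4 * a * vel_bound alpha th0L c + 2 * a * vel_bound alpha th0L c) * (t - s) ^+ 2.
  apply: (quad_glue (f := Phi ^~ x) (v := v) (ltW tau0) K0 K'0) => {s s1 s2} s t.
    move=> ss tt; have /andP[ss0 _] := ss; have /andP[tt0 _] := tt.
    by rewrite /v !Pp//; exact: HF.
  move=> /andP[s1 s2] /andP[t1 t2]; rewrite /v !Pn//.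
  have ss : 0 <= - s <= tau by rewrite oppr_ge0 s2 lerNl.
  have tt : 0 <= - t <= tau by rewrite oppr_ge0 t2 lerNl.
  have [] := HG (- s) (- t) x ss tt; rewrite !velN.
  have E (A : zmodType) (p q : A) : - p - - q = - (p - q) by rewrite opprD.
  by rewrite !E scalerN scaleNr opprK sqrrN !normrN.
pose r := Num.min (tau - s) (tau + s).
have r0 : 0 < r by rewrite lt_min !subr_gt0 s2 -ltrBlDl sub0r s1.
apply: (quad_derive r0) => t; rewrite lt_min !ltr_norml => /andP[/andP[h1 h2] /andP[h3 h4]].
by apply: quad; apply/andP; split; lra.
Qed.

End local_flow.

(** * Integral curves: uniqueness and Lipschitz bounds *)

Section curves.
Context {R : realType}.
Variable alpha : R.
Hypothesis alpha_itv : 0 < alpha < 1 / 2.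
Variable th0 : plane R -> R.
Hypothesis th0L : L1Linfty th0.
Implicit Types (F G : R -> plane R -> plane R) (c T : R).

Definition integral_curve c (F : R -> plane R -> plane R) (t : R) : Prop :=
  measure_preserving_homeo (F t) /\
  forall x, is_derive t 1 (F ^~ x) (vel alpha th0 c 0 (F t) (F t x)).

Lemma curve_shift c F (s t : R) : integral_curve c F (t + s) ->
  integral_curve c (fun r => F (r + s)) t.
Proof.
move=> [mF dF]; split => // x; have /is_derive1P H := dF x; apply/is_derive1P.
by under eq_fun do rewrite -addrA.
Qed.

Lemma curve_reflect c F (t : R) : integral_curve c F (- t) ->
  integral_curve (- c) (fun r => F (- r)) t.
Proof.
move=> [mF dF]; split => // x; have := is_derive_reflect (dF x).
by rewrite opprK /vel !mulNr.
Qed.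

Lemma curve_near c F G (t : R) : (\forall r \near t, F r = G r) ->
  integral_curve c F t -> integral_curve c G t.
Proof.
move=> FG [mF dF]; have E := nbhs_singleton FG; rewrite /integral_curve -E; split => // x.
by apply: near_eq_is_derive (dF x); near=> r; congr (_ x); near: r.
Unshelve. all: by end_near. Qed.

Lemma curve_time c F (s t : R) x : s <= t ->
  (forall r, s <= r <= t -> integral_curve c F r) ->
  `|F t x - F s x| <= vel_bound alpha th0L c * (t - s).
Proof.
move=> st cF.
apply: ler_prod_norm.
- apply: (derive_bound (f := fun r => (F r x).1) (df := fun r => (vel alpha th0 c 0 (F r) (F r x)).1) st) => r rst.
    by have [_ /(_ x)] := cF r rst; exact: is_derive_fst.
  have [mF _] := cF r rst; apply: le_trans (vel_le alpha_itv th0L c 0 (F r x) mF).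
  exact: (ler_norm1 (vel alpha th0 c 0 (F r) (F r x))).
- apply: (derive_bound (f := fun r => (F r x).2) (df := fun r => (vel alpha th0 c 0 (F r) (F r x)).2) st) => r rst.
    by have [_ /(_ x)] := cF r rst; exact: is_derive_snd.
  have [mF _] := cF r rst; apply: le_trans (vel_le alpha_itv th0L c 0 (F r x) mF).
  exact: (ler_norm2 (vel alpha th0 c 0 (F r) (F r x))).
Qed.

Context d (L : measurableType d) (mu : signed_measure L R) (Theta : set (lplane R * L)).
Hypothesis cake : layer_cake mu Theta th0.

Let C_gt0 c : 0 < vel_const alpha c.
Proof. by apply: lt_le_trans (vel_const_ge1 alpha_itv c). Qed.

(** The supremum over particles of |F - G| need not be differentiable in time, so the bound is
    bootstrapped instead. If |F - G| <= B exp(4 a t) for all particles, the velocities differ by at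
    most 2 a B exp(4 a t), and integrating each particle gives the same bound with B / 2. The start
    is the bound on speed. *)
Lemma curve_unique c F G T (Lam : R) : 0 <= T -> 0 < Lam ->
  (forall t, 0 <= t <= T -> integral_curve c F t) ->
  (forall t, 0 <= t <= T -> integral_curve c G t) ->
  (forall t, 0 <= t <= T -> (L_mu mu (push_set Theta (F t)) alpha <= Lam%:E)%E) ->
  F 0 = G 0 -> F T = G T.
Proof.
move=> T0 Lam0 cF cG LF FG0.
pose a := vel_const alpha c * Lam; have a0 : 0 < a by rewrite mulr_gt0.
pose A := 2 * vel_bound alpha th0L c * T.
have [mF0 _] := cF 0 (introT andP (conj (lexx 0) T0)).
have M0 : 0 <= vel_bound alpha th0L c.
  by apply: le_trans (vel_le alpha_itv th0L c 0 0 mF0); exact: normr_ge0.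
have A0 : 0 <= A by rewrite mulr_ge0// mulr_ge0.
have claim (n : nat) : forall t, 0 <= t <= T -> forall x,
    `|F t x - G t x| <= A / 2 ^+ n * expR (4 * a * (t - 0)).
  elim: n => [t /andP[t0 tT] x|n IH t /andP[t0 tT] x].
    have sub r : 0 <= r <= t -> 0 <= r <= T by move=> /andP[-> /le_trans]; exact.
    have h1 := curve_time x t0 (fun r h => cF r (sub r h)).
    have h2 := curve_time x t0 (fun r h => cG r (sub r h)).
    have h3 : vel_bound alpha th0L c * (t - 0) <= vel_bound alpha th0L c * T.
      by rewrite ler_wpM2l// subr0.
    have e1 : 1 <= expR (4 * a * (t - 0)).
      by rewrite -expR0 ler_expR subr0 !mulr_ge0// ltW.
    apply: (@le_trans _ _ A); last by rewrite expr0 divr1 ler_peMr.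
    have -> : F t x - G t x = (F t x - F 0 x) - (G t x - G 0 x).
      by rewrite FG0; apply: injective_projections => /=; ring.
    by apply: (le_trans (ler_normB _ _)); rewrite /A; lra.
  pose B := A / 2 ^+ n; have B0 : 0 <= B by rewrite divr_ge0// exprn_ge0.
  have dv r : 0 <= r <= t ->
      `|vel alpha th0 c 0 (F r) (F r x) - vel alpha th0 c 0 (G r) (G r x)| <=
      2 * a * B * expR (4 * a * (r - 0)).
    move=> /andP[r0 rt]; have rT : 0 <= r <= T by rewrite r0 (le_trans rt).
    have [mF _] := cF r rT; have [mG _] := cG r rT.
    have E0 : 0 <= B * expR (4 * a * (r - 0)) by rewrite mulr_ge0// expR_ge0.
    rewrite (_ : 2 * a * B * _ = a * (2 * (B * expR (4 * a * (r - 0))))); last by ring.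
    apply: (vel_lip alpha_itv th0L cake c (lexx 0) mF mG (LF r rT) (ltW Lam0)).
      by rewrite mulr_ge0.
    move=> z; have -> : F r x - F r z - (G r x - G r z) = (F r x - G r x) - (F r z - G r z).
      by apply: injective_projections => /=; ring.
    apply: (le_trans (ler_normB _ _)); have := IH r rT x; have := IH r rT z.
    by rewrite -/B; lra.
  have tE : A / 2 ^+ n.+1 * expR (4 * a * (t - 0)) = 2 * a * B / (4 * a) * expR (4 * a * (t - 0)).
    by congr (_ * _); rewrite /B exprS; field; rewrite expf_neq0//= gt_eqF.
  have k0 : 0 < 4 * a by rewrite mulr_gt0.
  have B'0 : 0 <= 2 * a * B by rewrite mulr_ge0// mulr_ge0// ltW.
  rewrite tE; apply: ler_prod_norm.
  - apply: (gronwall_exp (f := fun r => (F r x).1 - (G r x).1)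
      (df := fun r => (vel alpha th0 c 0 (F r) (F r x)).1 - (vel alpha th0 c 0 (G r) (G r x)).1) k0 B'0 t0).
    + move=> r /andP[r0 rt]; have rT : 0 <= r <= T by rewrite r0 (le_trans rt).
      have [_ dF] := cF r rT; have [_ dG] := cG r rT.
      exact: (is_derive_fstB (dF x) (dG x)).
    + by rewrite FG0 subrr.
    + move=> r rt; apply: le_trans (dv r rt).
      exact: (ler_norm1 (vel alpha th0 c 0 (F r) (F r x) - vel alpha th0 c 0 (G r) (G r x))).
  - apply: (gronwall_exp (f := fun r => (F r x).2 - (G r x).2)
      (df := fun r => (vel alpha th0 c 0 (F r) (F r x)).2 - (vel alpha th0 c 0 (G r) (G r x)).2) k0 B'0 t0).
    + move=> r /andP[r0 rt]; have rT : 0 <= r <= T by rewrite r0 (le_trans rt).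
      have [_ dF] := cF r rT; have [_ dG] := cG r rT.
      exact: (is_derive_sndB (dF x) (dG x)).
    + by rewrite FG0 subrr.
    + move=> r rt; apply: le_trans (dv r rt).
      exact: (ler_norm2 (vel alpha th0 c 0 (F r) (F r x) - vel alpha th0 c 0 (G r) (G r x))).
apply/funext => x; apply/eqP; rewrite -subr_eq0 -normr_le0.
apply: (@le_geom _ _ _ (A * expR (4 * a * (T - 0)))) => n.
by rewrite add0r mulrAC; apply: claim; rewrite T0 lexx.
Qed.

(** Linear Gronwall for the squared Euclidean distance, which is differentiable even where the
    distance vanishes. Its rate 4 a becomes 2 a after taking roots. *)
Lemma curve_lipschitz c F T (Lam : R) x y : 0 <= T -> 0 < Lam ->
  (forall t, 0 <= t <= T -> integral_curve c F t) ->
  (forall t, 0 <= t <= T -> (L_mu mu (push_set Theta (F t)) alpha <= Lam%:E)%E) ->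
  enorm (F T x - F T y) <= expR (2 * (vel_const alpha c * Lam) * T) * enorm (F 0 x - F 0 y) /\
  enorm (F 0 x - F 0 y) <= expR (2 * (vel_const alpha c * Lam) * T) * enorm (F T x - F T y).
Proof.
move=> T0 Lam0 cF LF; set a := vel_const alpha c * Lam.
have a0 : 0 < a by rewrite mulr_gt0.
pose v r := vel alpha th0 c 0 (F r) (F r x) - vel alpha th0 c 0 (F r) (F r y).
pose w r := F r x - F r y.
pose f r := (w r).1 * (w r).1 + (w r).2 * (w r).2.
pose df r := 2 * ((w r).1 * (v r).1) + 2 * ((w r).2 * (v r).2).
have fE r : f r = enorm (w r) ^+ 2 by rewrite enorm_sqr /f !expr2.
have dd r : 0 <= r <= T -> is_derive r 1 f (df r).
  move=> rT; have [_ dF] := cF r rT.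
  have d1 : is_derive r 1 (fun r => (w r).1) (v r).1.
    exact: (is_derive_fstB (dF x) (dF y)).
  have d2 : is_derive r 1 (fun r => (w r).2) (v r).2.
    exact: (is_derive_sndB (dF x) (dF y)).
  exact: (is_derive_sqr_add d1 d2).
have dk r : 0 <= r <= T -> `|df r| <= 4 * a * f r.
  move=> rT; have [mF _] := cF r rT.
  have hv : `|v r| <= a * `|w r|.
    apply: (vel_lip alpha_itv th0L cake c (lexx 0) mF mF (LF r rT) (ltW Lam0)) => // z.
    by rewrite opprB addrA subrK.
  have v1 := le_trans (ler_norm1 (v r)) hv; have v2 := le_trans (ler_norm2 (v r)) hv.
  have w1 := ler_norm1 (w r); have w2 := ler_norm2 (w r).
  have h1 : `|(w r).1 * (v r).1| <= `|w r| * (a * `|w r|) by rewrite normrM ler_pM.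
  have h2 : `|(w r).2 * (v r).2| <= `|w r| * (a * `|w r|) by rewrite normrM ler_pM.
  have h3 : a * (`|w r| * `|w r|) <= a * f r.
    by rewrite fE expr2 ler_wpM2l ?(ltW a0)// ler_pM// ler_norm_enorm.
  apply: (le_trans (ler_normD _ _)); rewrite normrM (normrM 2) normr_nat.
  move: h1 h2 h3; move: (f r) (`|w r|) => q p; lra.
have [h1 h2] := gronwall_linear T0 dd dk.
have E : expR (4 * a * (T - 0)) = expR (2 * a * T) ^+ 2.
  by rewrite -expRM_natl subr0; congr expR; ring.
rewrite !fE E in h1 h2.
have e0 : 0 <= expR (2 * a * T) by exact: expR_ge0.
split; rewrite -(@ler_pXn2r _ 2) ?nnegrE ?mulr_ge0 ?enorm_ge0// exprMn.
- exact: h1.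
- exact: h2.
Qed.

End curves.

Lemma open_itv_between (R : realType) (a b : \bar R) (s r t : R) :
  open_itv a b s -> open_itv a b t -> s <= r <= t -> open_itv a b r.
Proof.
move=> /andP[s1 _] /andP[_ t2] /andP[sr rt]; apply/andP; split.
- by apply: lt_le_trans s1 _; rewrite lee_fin.
- by apply: le_lt_trans t2; rewrite lee_fin.
Qed.

Lemma open_itv_nbhs (R : realType) (a b : \bar R) (t : R) :
  open_itv a b t -> \forall r \near t, open_itv a b r.
Proof.
move=> /andP[t1 t2].
have n1 : \forall r \near t, (a < r%:E)%E.
  case: a t1 => [a| |] //=.
  - by rewrite lte_fin => t1; near=> r; rewrite lte_fin; near: r; exact: lt_nbhsr.
  - by move=> _; near=> r; rewrite ltNyr.
have n2 : \forall r \near t, (r%:E < b)%E.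
  case: b t2 => [b| |] //=.
  - by rewrite lte_fin => t2; near=> r; rewrite lte_fin; near: r; exact: lt_nbhsl.
  - by move=> _; near=> r; rewrite ltry.
by near=> r; apply/andP; split; near: r.
Unshelve. all: by end_near. Qed.

(** * Flows on open intervals *)

Section flows.
Context {R : realType}.
Variable alpha : R.
Hypothesis alpha_itv : 0 < alpha < 1 / 2.
Variable th0 : plane R -> R.
Hypothesis th0L : L1Linfty th0.
Implicit Types (F G : R -> plane R -> plane R) (c : R) (a b : \bar R).

Definition flow c a b (F : R -> plane R -> plane R) : Prop :=
  forall t, open_itv a b t -> integral_curve alpha th0 c F t.

Lemma sub_flow c a b a' b' F : open_itv a' b' `<=` open_itv a b ->
  flow c a b F -> flow c a' b' F.
Proof. by move=> ab fF t /ab /fF. Qed.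

Lemma flow_eq c a b F G : flow c a b F -> (forall t, open_itv a b t -> F t = G t) ->
  flow c a b G.
Proof.
move=> fF FG t tab; apply: curve_near (fF t tab).
by apply: filterS (open_itv_nbhs tab) => r /FG.
Qed.

Section tame.
Context d (L : measurableType d) (mu : signed_measure L R) (Theta : set (lplane R * L)).

(** A real bound in place of the supremum over compact intervals, with an empty range if t < s; this
    form is easier to glue, and [tame_bounded] gives the equivalence. *)
Definition tame a b (F : R -> plane R -> plane R) : Prop :=
  forall s t : R, open_itv a b s -> open_itv a b t -> exists2 Lam : R, 0 < Lam &
    forall r, s <= r <= t -> (L_mu mu (push_set Theta (F r)) alpha <= Lam%:E)%E.

Lemma sub_tame a b a' b' F : open_itv a' b' `<=` open_itv a b -> tame a b F -> tame a' b' F.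
Proof. by move=> ab tF s t /ab sab /ab tab; exact: tF. Qed.

Lemma tame_eq a b F G : tame a b F -> (forall t, open_itv a b t -> F t = G t) -> tame a b G.
Proof.
move=> tF FG s t sab tab; have [Lam Lam0 H] := tF s t sab tab; exists Lam; first exact: Lam0.
by move=> r rst; rewrite -(FG r (open_itv_between sab tab rst)); exact: H.
Qed.

Lemma tame_base (t0 : R) a b F : (forall t : R, open_itv a b t -> exists2 Lam : R, 0 < Lam &
    forall r, t <= r <= t0 \/ t0 <= r <= t ->
      (L_mu mu (push_set Theta (F r)) alpha <= Lam%:E)%E) -> tame a b F.
Proof.
move=> H s t sab tab; have [l1 l10 H1] := H s sab; have [l2 l20 H2] := H t tab.
exists (Num.max l1 l2); first by rewrite lt_max l10.
move=> r /andP[sr rt]; case: (leP r t0) => [rt0|/ltW t0r].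
- apply: (le_trans (H1 r _)); first by left; rewrite sr.
  by rewrite lee_fin le_max lexx.
- apply: (le_trans (H2 r _)); first by right; rewrite t0r.
  by rewrite lee_fin le_max lexx orbT.
Qed.

Hypothesis cake : layer_cake mu Theta th0.

(** Before t0 both flows are reversed in time about t0, which changes [c] into - c. *)
Lemma flow_unique c a b F G (t0 : R) : flow c a b F -> tame a b F -> flow c a b G ->
  open_itv a b t0 -> F t0 = G t0 -> forall t, open_itv a b t -> F t = G t.
Proof.
move=> fF tF fG t0ab FG0 t tab; case: (leP t0 t) => [t0t|/ltW tt0].
  have [Lam Lam0 HL] := tF t0 t t0ab tab.
  have T0 : 0 <= t - t0 by rewrite subr_ge0.
  have key r : 0 <= r <= t - t0 -> t0 <= r + t0 <= t.
    by move=> /andP[r0 r1]; apply/andP; split; lra.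
  have := @curve_unique _ _ alpha_itv _ th0L _ _ _ _ cake c (fun r => F (r + t0))
    (fun r => G (r + t0)) _ _ T0 Lam0.
  rewrite subrK add0r; apply.
  - by move=> r /key h; apply: curve_shift; apply: fF; exact: (open_itv_between t0ab tab h).
  - by move=> r /key h; apply: curve_shift; apply: fG; exact: (open_itv_between t0ab tab h).
  - by move=> r /key h; exact: HL.
  - exact: FG0.
have [Lam Lam0 HL] := tF t t0 tab t0ab.
have T0 : 0 <= t0 - t by rewrite subr_ge0.
have key r : 0 <= r <= t0 - t -> t <= - (r - t0) <= t0.
  by move=> /andP[r0 r1]; apply/andP; split; lra.
have := @curve_unique _ _ alpha_itv _ th0L _ _ _ _ cake (- c) (fun r => F (- (r - t0)))
  (fun r => G (- (r - t0))) _ _ T0 Lam0.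
have -> : - (t0 - t - t0) = t by ring.
rewrite sub0r opprK; apply.
- move=> r /key h; apply: (curve_shift (F := fun u => F (- u))); apply: curve_reflect.
  by apply: fF; exact: (open_itv_between tab t0ab h).
- move=> r /key h; apply: (curve_shift (F := fun u => G (- u))); apply: curve_reflect.
  by apply: fG; exact: (open_itv_between tab t0ab h).
- by move=> r /key h; exact: HL.
- exact: FG0.
Qed.

Lemma flow_lipschitz c a b F (s t : R) : flow c a b F -> tame a b F ->
  open_itv a b 0 -> F 0 = id -> open_itv a b s -> open_itv a b t ->
  exists2 l : R, 1 <= l & forall r, s <= r <= t -> forall x y,
    enorm (F r x - F r y) <= l * enorm (x - y) /\ enorm (x - y) <= l * enorm (F r x - F r y).
Proof.
move=> fF tF ab0 F0 sab tab.
(* The range is enlarged to contain time 0, where the flow is the identity and distances are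
   compared. *)
pose s' := Num.min s 0; pose t' := Num.max t 0.
have s'ab : open_itv a b s' by rewrite /s'; case: leP.
have t'ab : open_itv a b t' by rewrite /t'; case: leP.
have s'0 : s' <= 0 by rewrite ge_min lexx orbT.
have t'0 : 0 <= t' by rewrite le_max lexx orbT.
have s's : s' <= s by rewrite ge_min lexx.
have tt' : t <= t' by rewrite le_max lexx.
have [Lam Lam0 HL] := tF s' t' s'ab t'ab.
have k0 : 0 <= 2 * (vel_const alpha c * Lam).
  rewrite mulr_ge0// mulr_ge0 ?(ltW Lam0)//.
  exact: le_trans ler01 (vel_const_ge1 alpha_itv c).
set k := 2 * _ in k0.
exists (expR (k * (t' - s'))).
  by rewrite -expR0 ler_expR mulr_ge0// subr_ge0 (le_trans s'0).
have mono (u p q : R) : 0 <= q -> u <= t' - s' -> p <= expR (k * u) * q ->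
    p <= expR (k * (t' - s')) * q.
  move=> q0 u1 h; apply: (le_trans h); rewrite ler_wpM2r// ler_expR ler_wpM2l//.
move=> r /andP[sr rt] x y; case: (leP 0 r) => [r0|/ltW r0].
  have key u : 0 <= u <= r -> s' <= u <= t'.
    by move=> /andP[u0 u1]; apply/andP; split; lra.
  have [h1 h2] := curve_lipschitz alpha_itv th0L cake x y r0 Lam0
    (fun u h => fF u (open_itv_between s'ab t'ab (key u h))) (fun u h => HL u (key u h)).
  by move: h1 h2; rewrite F0 /= -/k => h1 h2; split; [move: h1|move: h2]; apply: mono;
    rewrite ?enorm_ge0//; lra.
have key u : 0 <= u <= - r -> s' <= - u <= t'.
  by move=> /andP[u0 u1]; apply/andP; split; lra.
have r0' : 0 <= - r by rewrite oppr_ge0.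
have cF u (h : 0 <= u <= - r) : integral_curve alpha th0 (- c) (fun v => F (- v)) u.
  by apply: curve_reflect; apply: fF; exact: open_itv_between (key u h).
have [h1 h2] := curve_lipschitz alpha_itv th0L cake x y r0' Lam0 cF (fun u h => HL _ (key u h)).
move: h1 h2; rewrite opprK oppr0 F0 /= /vel_const normrN -/(vel_const alpha c) -/k => h1 h2.
by split; [move: h1|move: h2]; apply: mono; rewrite ?enorm_ge0//; lra.
Qed.

Lemma flow_union c a b a' b' F G (t0 : R) :
  flow c a b F -> tame a b F -> flow c a' b' G -> tame a' b' G ->
  open_itv a b t0 -> open_itv a' b' t0 -> F t0 = G t0 ->
  exists H : R -> plane R -> plane R,
    [/\ flow c (mine a a') (maxe b b') H, tame (mine a a') (maxe b b') H &
        forall t, open_itv a b t -> H t = F t].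
Proof.
move=> fF tF fG tG tab tab' FG0.
pose H t := if `[< open_itv a b t >] then F t else G t.
have HF t : open_itv a b t -> H t = F t by rewrite /H => h; case: asboolP.
have HG t : open_itv a' b' t -> H t = G t.
  move=> h; rewrite /H; case: asboolP => // h'.
  have i (u : R) : open_itv a b u -> open_itv a' b' u -> open_itv (maxe a a') (mine b b') u.
    by rewrite /open_itv /= gt_max lt_min => /andP[-> ->] /andP[-> ->].
  have i1 : open_itv (maxe a a') (mine b b') `<=` open_itv a b.
    by move=> u; rewrite /open_itv /= gt_max lt_min => /andP[/andP[-> _] /andP[-> _]].
  have i2 : open_itv (maxe a a') (mine b b') `<=` open_itv a' b'.
    by move=> u; rewrite /open_itv /= gt_max lt_min => /andP[/andP[_ ->] /andP[_ ->]].
  exact: (flow_unique (sub_flow i1 fF) (sub_tame i1 tF) (sub_flow i2 fG) (i _ tab tab') FG0 (i _ h' h)).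
have cover (t : R) : open_itv (mine a a') (maxe b b') t -> open_itv a b t \/ open_itv a' b' t.
  move: tab tab'; rewrite /open_itv /= gt_min lt_max.
  move=> /andP[a0 b0] /andP[a'0 b'0] /andP[/orP h1 /orP h2].
  case: (leP t t0) => [tt0|/ltW t0t].
  - case: h1 => h1; [left|right]; rewrite h1 /=.
      by apply: le_lt_trans b0; rewrite lee_fin.
    by apply: le_lt_trans b'0; rewrite lee_fin.
  - case: h2 => h2; [left|right]; rewrite h2 andbT.
      by apply: lt_le_trans a0 _; rewrite lee_fin.
    by apply: lt_le_trans a'0 _; rewrite lee_fin.
have fHF := flow_eq fF (fun t h => esym (HF t h)).
have fHG := flow_eq fG (fun t h => esym (HG t h)).
have tHF := tame_eq tF (fun t h => esym (HF t h)).
have tHG := tame_eq tG (fun t h => esym (HG t h)).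
exists H; split; last exact: HF.
- by move=> t /cover[/fHF|/fHG].
- apply: (tame_base (t0 := t0)) => t /cover[h|h].
  + have [l1 l10 H1] := tHF t t0 h tab; have [l2 l20 H2] := tHF t0 t tab h.
    exists (Num.max l1 l2); first by rewrite lt_max l10.
    move=> r [/H1|/H2] /le_trans; apply; by rewrite lee_fin le_max lexx ?orbT.
  + have [l1 l10 H1] := tHG t t0 h tab'; have [l2 l20 H2] := tHG t0 t tab' h.
    exists (Num.max l1 l2); first by rewrite lt_max l10.
    move=> r [/H1|/H2] /le_trans; apply; by rewrite lee_fin le_max lexx ?orbT.
Qed.

End tame.
End flows.

(** * Lagrangian solutions and the maximal interval *)

Section lagrangian.
Context {R : realType}.
Variable alpha : R.
Hypothesis alpha_itv : 0 < alpha < 1 / 2.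
Variable th0 : plane R -> R.
Hypothesis th0L : L1Linfty th0.
Implicit Types (Phi F : R -> plane R -> plane R) (theta : R -> plane R -> R) (a b : \bar R).
Local Notation c := (c_alpha alpha).

Lemma lagrangian_flow a b theta Phi : lagrangian_solution alpha th0 a b theta Phi ->
  [/\ flow alpha th0 c a b Phi, Phi 0 = id &
      forall t, open_itv a b t -> theta t = th0 \o inverse (Phi t)].
Proof.
move=> [mPhi _ Phi0 thE dPhi]; split.
- move=> t tab; split; first exact: mPhi.
  move=> x; have := dPhi t x tab; have [_ ->] := thE t tab.
  by rewrite (velocityE alpha_itv th0L (Phi t x) (mPhi t tab)).
- exact: Phi0.
- by move=> t /thE[].
Qed.

Lemma sup_dist_le (F G : plane R -> plane R) (M : R) :
  (forall x, `|F x - G x| <= M) -> (sup_dist F G <= (2 * M)%:E)%E.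
Proof.
move=> FG; apply: ge_ereal_sup => _ [x _ <-]; rewrite lee_fin.
by apply: (le_trans (ler_enorm_norm _)); rewrite ler_wpM2l.
Qed.

Lemma flow_lagrangian a b Phi : flow alpha th0 c a b Phi -> Phi 0 = id ->
  lagrangian_solution alpha th0 a b (fun t => th0 \o inverse (Phi t)) Phi.
Proof.
move=> fPhi Phi0; split.
- by move=> t /fPhi[].
- move=> t tab; pose M := vel_bound alpha th0L c.
  apply: (@squeeze_cvge _ _ _ _ (fun=> 0%E) _ (fun s => (2 * (M * `|s - t|))%:E)).
  + near=> s; apply/andP; split.
      by apply: (@le_trans _ _ (enorm (Phi s 0 - Phi t 0))%:E);
        [rewrite lee_fin enorm_ge0|apply: ereal_sup_ubound; exists 0].
    have sab : open_itv a b s by near: s; exact: open_itv_nbhs.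
    apply: sup_dist_le => x; case: (leP s t) => [st|/ltW ts].
      rewrite distrC (distrC s) (ger0_norm (x := t - s)) ?subr_ge0//.
      by apply: (curve_time alpha_itv th0L x st) => r /(open_itv_between sab tab); exact: fPhi.
    rewrite (ger0_norm (x := s - t)) ?subr_ge0//.
    by apply: (curve_time alpha_itv th0L x ts) => r /(open_itv_between tab sab); exact: fPhi.
  + exact: cvg_cst.
  + have h : 2 * (M * `|s - t|) @[s --> t] --> (0 : R).
      rewrite [X in _ --> X](_ : _ = 2 * (M * `|t - t|)); last by rewrite subrr normr0 !mulr0.
      apply: cvgM; first exact: cvg_cst.
      apply: cvgM; [exact: cvg_cst|apply: cvg_norm].
      by apply: cvgB; [exact: cvg_id|exact: cvg_cst].
    by apply: cvg_EFin; [exact: nearW|exact: h].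
- exact: Phi0.
- by move=> t /fPhi[mPhi _]; split => //; exact: L1Linfty_push.
- move=> t x /fPhi[mPhi dPhi]; rewrite (velocityE alpha_itv th0L (Phi t x) mPhi).
  exact: dPhi.
Unshelve. all: by end_near. Qed.

Section maximal.
Context d (L : measurableType d) (mu : signed_measure L R) (Theta : set (lplane R * L)).

Lemma lt_pinfty_bound (x : \bar R) : (x < +oo)%E -> exists2 r : R, 0 < r & (x <= r%:E)%E.
Proof.
case: x => [x _| |]//; last by exists 1 => //; rewrite leNye.
by exists (Num.max x 1); rewrite ?lt_max ?ltr01 ?orbT// lee_fin le_max lexx.
Qed.

Lemma tame_bounded a b Phi : tame alpha mu Theta a b Phi <->
  forall s t : R, s <= t -> `[s, t]%classic `<=` open_itv a b ->
    (ereal_sup [set L_mu mu (push_set Theta (Phi r)) alpha | r in `[s, t]%classic] < +oo)%E.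
Proof.
split=> [tP s t st sub|H s t sab tab].
  have sab : open_itv a b s by apply: sub; rewrite /= in_itv /= lexx st.
  have tab : open_itv a b t by apply: sub; rewrite /= in_itv /= lexx st.
  have [Lam _ HL] := tP s t sab tab.
  apply: (@le_lt_trans _ _ Lam%:E); last exact: ltry.
  by apply: ge_ereal_sup => _ [r /= rst <-]; apply: HL; move: rst; rewrite in_itv.
case: (leP s t) => [st|ts]; last first.
  by exists 1 => // r /andP[sr /(le_trans sr)]; rewrite leNgt ts.
have sub : `[s, t]%classic `<=` open_itv a b.
  by move=> r /=; rewrite in_itv /= => h; exact: open_itv_between h.
have [Lam Lam0 HL] := lt_pinfty_bound (H s t st sub).
exists Lam; first exact: Lam0.
move=> r rst; apply: le_trans HL; apply: ereal_sup_ubound; exists r; last by [].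
by rewrite /= in_itv.
Qed.

Definition tame_flow a b Phi : Prop :=
  [/\ flow alpha th0 c a b Phi, tame alpha mu Theta a b Phi & Phi 0 = id].

Lemma solution_tame_flow a b theta Phi :
  L_mu_solution alpha mu Theta th0 a b theta Phi -> tame_flow a b Phi.
Proof.
by move=> [/lagrangian_flow[fPhi Phi0 _] /tame_bounded tPhi].
Qed.

Lemma tame_flow_solution a b Phi : tame_flow a b Phi ->
  L_mu_solution alpha mu Theta th0 a b (fun t => th0 \o inverse (Phi t)) Phi.
Proof.
by move=> [fPhi tPhi Phi0]; split; [exact: flow_lagrangian|exact/tame_bounded].
Qed.

Lemma solution_itvP a b : solution_itv alpha mu Theta th0 a b <->
  (a < 0 < b)%E /\ exists Phi, tame_flow a b Phi.
Proof.
split=> -[ab].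
  by move=> [theta [Phi /solution_tame_flow h]]; split; [exact: ab|exists Phi].
move=> [Phi /tame_flow_solution h]; split; first exact: ab.
by eexists; exists Phi; exact: h.
Qed.

Hypothesis cake : layer_cake mu Theta th0.

(** Tameness is asked of [F] alone, so that [Phi] may come from another representation. The
    comparison takes place on the intersection of the two intervals. *)
Lemma tame_flow_unique a b a' b' F Phi (t : R) : (a < 0 < b)%E -> (a' < 0 < b')%E ->
  tame_flow a b F -> flow alpha th0 c a' b' Phi -> Phi 0 = id ->
  open_itv a b t -> open_itv a' b' t -> F t = Phi t.
Proof.
move=> ab ab' [fF tF F0] fP P0 tab tab'.
have i (u : R) : open_itv a b u -> open_itv a' b' u -> open_itv (maxe a a') (mine b b') u.
  by rewrite /open_itv /= gt_max lt_min => /andP[-> ->] /andP[-> ->].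
have i1 : open_itv (maxe a a') (mine b b') `<=` open_itv a b.
  by move=> u; rewrite /open_itv /= gt_max lt_min => /andP[/andP[-> _] /andP[-> _]].
have i2 : open_itv (maxe a a') (mine b b') `<=` open_itv a' b'.
  by move=> u; rewrite /open_itv /= gt_max lt_min => /andP[/andP[_ ->] /andP[_ ->]].
have FP : F 0 = Phi 0 by rewrite F0 P0.
exact: (flow_unique alpha_itv th0L cake (sub_flow i1 fF) (sub_tame i1 tF) (sub_flow i2 fP)
  (i 0 ab ab') FP (i t tab tab')).
Qed.

(** The same [tau] serves all times t: as long as [L_mu] is at most [Lam] at some t, the flow
    continues for tau beyond it, glued by uniqueness. *)
Lemma tame_flow_extend a b Phi (Lam : R) : 0 < Lam -> (a < 0 < b)%E ->
  tame_flow a b Phi -> exists2 tau : R, 0 < tau & forall t : R, open_itv a b t ->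
    (L_mu mu (push_set Theta (Phi t)) alpha <= Lam%:E)%E ->
    exists F, tame_flow (mine a (t - tau)%:E) (maxe b (t + tau)%:E) F.
Proof.
move=> Lam0 ab [fPhi tPhi Phi0].
have [tau tau0 H] := local_flow alpha_itv th0L cake c Lam0.
exists tau => // t tab Lt.
have [G [G0 LG dG]] := H (Phi t) (fPhi t tab).1 Lt.
have near_t (r : R) : open_itv (t - tau)%:E (t + tau)%:E r -> `|r - t| < tau.
  by rewrite /open_itv /= !lte_fin ltr_norml => /andP[h1 h2]; apply/andP; split; lra.
have fG : flow alpha th0 c (t - tau)%:E (t + tau)%:E (fun r => G (r - t)).
  move=> r /near_t h; apply: curve_shift; split; first exact: (LG _ h).1.
  by move=> x; exact: dG.
have tG : tame alpha mu Theta (t - tau)%:E (t + tau)%:E (fun r => G (r - t)).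
  move=> r s rt st; exists (4 * Lam); first by rewrite mulr_gt0.
  by move=> u h; exact: (LG _ (near_t _ (open_itv_between rt st h))).2.
have ttau : open_itv (t - tau)%:E (t + tau)%:E t.
  by rewrite /open_itv /= !lte_fin; apply/andP; split; lra.
have Gt : Phi t = G (t - t) by rewrite subrr G0.
have [F [fF tF FE]] := flow_union alpha_itv th0L cake fPhi tPhi fG tG tab ttau Gt.
exists F; split; [exact: fF|exact: tF|].
by rewrite FE.
Qed.

Hypothesis Lfin : (L_mu mu Theta alpha < +oo)%E.

Lemma push_set_id : push_set Theta id = Theta.
Proof.
apply/seteqP; split; first by move=> _ [[x l] h <-].
by move=> [x l] h; exists (x, l).
Qed.

Lemma exists_tame_flow : exists a b, (a < 0 < b)%E /\ exists F, tame_flow a b F.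
Proof.
have [Lam Lam0 HL] := lt_pinfty_bound Lfin.
have [tau tau0 H] := local_flow alpha_itv th0L cake c Lam0.
have mid : measure_preserving_homeo (@id (plane R)).
  by apply: (@homeo_of_borel _ id id) => // x; exact: cvg_id.
have Lid : (L_mu mu (push_set Theta id) alpha <= Lam%:E)%E by rewrite push_set_id.
have [G [G0 LG dG]] := H id mid Lid.
have near0 (r : R) : open_itv (- tau)%:E tau%:E r -> `|r| < tau.
  by rewrite /open_itv /= !lte_fin ltr_norml.
exists (- tau)%:E, tau%:E; split; first by rewrite !lte_fin oppr_lt0 tau0.
exists G; split; last exact: G0.
- by move=> t /near0 h; split; [exact: (LG _ h).1|move=> x; exact: dG].
- move=> r s rt st; exists (4 * Lam); first by rewrite mulr_gt0.
  by move=> u h; exact: (LG _ (near0 _ (open_itv_between rt st h))).2.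
Qed.

Let S := [set ab : \bar R * \bar R | (ab.1 < 0 < ab.2)%E /\ exists F, tame_flow ab.1 ab.2 F].

(** The extreme endpoints over all admissible intervals. Each time strictly between them lies in
    some admissible interval, as all of them contain 0. *)
Lemma exists_maximal_flow : exists a b, [/\ (a < 0 < b)%E,
  exists F, tame_flow a b F &
  forall a' b', (a' < 0 < b')%E -> (exists F, tame_flow a' b' F) -> (a <= a')%E /\ (b' <= b)%E].
Proof.
pose A := ereal_inf [set ab.1 | ab in S]; pose B := ereal_sup [set ab.2 | ab in S].
have SAB a' b' : S (a', b') -> (A <= a')%E /\ (b' <= B)%E.
  by move=> h; split; [apply: ereal_inf_lbound|apply: ereal_sup_ubound]; exists (a', b').
have AB : (A < 0 < B)%E.
  have [a [b [/andP[a0 b0] F]]] := exists_tame_flow.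
  have [h1 h2] : (A <= a)%E /\ (b <= B)%E by apply: SAB; split; [exact/andP|exact: F].
  by rewrite (le_lt_trans h1 a0) (lt_le_trans b0 h2).
exists A, B; split; [exact: AB| |by move=> a' b' h1 h2; exact: SAB].
(* One flow is chosen per time and evaluated at that time; by [agree] these values coincide with the
   flow chosen for t on its whole interval, which makes the properties local. *)
have /choice[f Hf] : forall t : R, exists f : \bar R * \bar R * (R -> plane R -> plane R),
    open_itv A B t -> [/\ (f.1.1 < 0 < f.1.2)%E, tame_flow f.1.1 f.1.2 f.2 & open_itv f.1.1 f.1.2 t].
  move=> t; have [/andP[At tB]|nt] := pselect (open_itv A B t); last by exists (0%E, 0%E, fun=> id) => /nt.
  case: (leP 0 t) => t0.
    have [_ [[a b] [/andP[a0 b0] [F HF]] <-] /= tb] := ereal_sup_gt tB.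
    exists (a, b, F) => _; split; [exact/andP|exact: HF|].
    by rewrite /open_itv /= tb andbT (lt_le_trans a0)// lee_fin.
  have [_ [[a b] [/andP[a0 b0] [F HF]] <-] /= ta] := ereal_inf_lt At.
  exists (a, b, F) => _; split; [exact/andP|exact: HF|].
  by rewrite /open_itv /= ta (lt_trans _ b0)// lte_fin.
pose Phi t := (f t).2 t.
have sub t : open_itv A B t -> open_itv (f t).1.1 (f t).1.2 `<=` open_itv A B.
  move=> /Hf[h1 h2 _] r /andP[r1 r2].
  have [h3 h4] : (A <= (f t).1.1)%E /\ ((f t).1.2 <= B)%E.
    by apply: SAB; split; [exact: h1|exists (f t).2].
  by rewrite /open_itv /= (le_lt_trans h3 r1) (lt_le_trans r2 h4).
have agree (t r : R) : open_itv A B t -> open_itv (f t).1.1 (f t).1.2 r -> (f t).2 r = Phi r.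
  move=> tAB rt; have rAB := sub t tAB r rt.
  have [h1 h2 h3] := Hf t tAB; have [h4 [h5 _ h7] h6] := Hf r rAB.
  exact: (tame_flow_unique h1 h4 h2 h5 h7 rt h6).
exists Phi; split.
- move=> t tAB; have [h1 [h2 _ _] h3] := Hf t tAB.
  exact: (flow_eq h2 (fun r => agree t r tAB)).
- apply: (tame_base (t0 := 0)) => t tAB; have [h1 [_ h2 _] h3] := Hf t tAB.
  have [l1 l10 H1] := tame_eq h2 (fun r => agree t r tAB) h3 h1.
  have [l2 l20 H2] := tame_eq h2 (fun r => agree t r tAB) h1 h3.
  exists (Num.max l1 l2); first by rewrite lt_max l10.
  by move=> r [/H1|/H2] /le_trans; apply; rewrite lee_fin le_max lexx ?orbT.
- by have [_ [_ _ h] _] := Hf 0 AB.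
Qed.

End maximal.
End lagrangian.

(** * Change of representation and blow-up *)

Section transfer.
Context {R : realType}.
Variable alpha : R.
Hypothesis alpha_itv : 0 < alpha < 1 / 2.
Variable th0 : plane R -> R.
Hypothesis th0L : L1Linfty th0.
Context d (L : measurableType d) (mu : signed_measure L R) (Theta : set (lplane R * L)).
Hypothesis cake : layer_cake mu Theta th0.
Implicit Types (F : plane R -> plane R) (Phi : R -> plane R -> plane R) (a b : \bar R).

(* Lipschitz bounds on the flow and its inverse make L_mu' finite along the     *)
(* flow for every other representation.                                        *)
Lemma tame_flow_transfer d' (L' : measurableType d') (mu' : signed_measure L' R)
    (Theta' : set (lplane R * L')) a b Phi : (a < 0 < b)%E ->
  (L_mu mu' Theta' alpha < +oo)%E ->
  tame_flow alpha th0 mu Theta a b Phi -> tame_flow alpha th0 mu' Theta' a b Phi.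
Proof.
move=> ab /lt_pinfty_bound[Lam' Lam'0 HL'] [fPhi tPhi Phi0]; split; [exact: fPhi| |exact: Phi0].
move=> s t sab tab.
have [l l1 Hl] := flow_lipschitz alpha_itv th0L cake fPhi tPhi ab Phi0 sab tab.
have l0 : 0 < l by apply: lt_le_trans l1.
exists (l * Lam'); first exact: mulr_gt0.
move=> r rst; have [mPhi _] := fPhi r (open_itv_between sab tab rst).
have mid : measure_preserving_homeo (@id (plane R)).
  by rewrite -Phi0; have [] := fPhi 0 ab.
apply: le_trans (L_mu_image alpha_itv mu' Theta' l1 mPhi mid _) _.
  by move=> x y; exact: (Hl r rst x y).2.
by rewrite push_set_id EFinM; apply: lee_wpmul2l; [rewrite lee_fin ltW|].
Qed.

Lemma lip_const_le F (l : R) : (forall x y, enorm (F x - F y) <= l * enorm (x - y)) ->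
  (lip_const F <= l%:E)%E.
Proof.
move=> Fl; apply: ge_ereal_sup => _ [[x y] /= xy <-]; rewrite lee_fin ler_pdivrMr//.
apply: lt_le_trans (ler_norm_enorm _); rewrite normr_gt0 subr_eq0; exact: xy.
Qed.

Lemma tame_flow_lip a b Phi (s t : R) : (a < 0 < b)%E -> tame_flow alpha th0 mu Theta a b Phi ->
  s <= t -> `[s, t]%classic `<=` open_itv a b ->
  (ereal_sup [set maxe (lip_const (Phi r)) (lip_const (inverse (Phi r))) |
              r in `[s, t]%classic] < +oo)%E.
Proof.
move=> ab [fPhi tPhi Phi0] st sub.
have sab : open_itv a b s by apply: sub; rewrite /= in_itv /= lexx st.
have tab : open_itv a b t by apply: sub; rewrite /= in_itv /= lexx st.
have [l l1 Hl] := flow_lipschitz alpha_itv th0L cake fPhi tPhi ab Phi0 sab tab.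
apply: (@le_lt_trans _ _ l%:E); last exact: ltry.
apply: ge_ereal_sup => _ [r /= rst <-]; rewrite in_itv /= in rst.
have [[bPhi _ _ _ _] _] := fPhi r (open_itv_between sab tab rst).
rewrite ge_max; apply/andP; split; apply: lip_const_le => x y; first exact: (Hl r rst x y).1.
by have := (Hl r rst (inverse (Phi r) x) (inverse (Phi r) y)).2; rewrite !inverseVK.
Qed.

(** If [L_mu] were at most [Lam] at some time within tau of T, the flow would extend past T, against
    maximality. This excludes every time close to T, whence a limit rather than a merely unbounded
    function. *)
Lemma tame_flow_blowup a b Phi (T : R) : (a < 0 < b)%E ->
  tame_flow alpha th0 mu Theta a b Phi -> ~ open_itv a b T ->
  (forall a' b', (a' < 0 < b')%E -> (exists G, tame_flow alpha th0 mu Theta a' b' G) ->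
     open_itv a' b' `<=` open_itv a b) ->
  L_mu mu (push_set Theta (Phi t)) alpha @[t --> within (open_itv a b) (nbhs T)] --> +oo%E.
Proof.
move=> ab hPhi nT Hmax; apply/cvgeyPge => A.
pose Lam := Num.max A 1; have Lam0 : 0 < Lam by rewrite lt_max ltr01 orbT.
have [tau tau0 H] := tame_flow_extend alpha_itv th0L cake Lam0 ab hPhi.
rewrite near_withinE; near=> t => tab.
rewrite leNgt; apply/negP => LA.
have [|F hF] := H t tab.
  by apply: ltW; apply: lt_le_trans LA _; rewrite lee_fin le_max lexx.
have tT : `|T - t| < tau by near: t; exact: (nbhsx_ballx T tau tau0).
apply: nT; apply: (Hmax (mine a (t - tau)%:E) (maxe b (t + tau)%:E)).
- by case/andP: ab => a0 b0; rewrite gt_min a0 lt_max b0.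
- by exists F.
- move: tT; rewrite ltr_norml => /andP[h1 h2]; rewrite /open_itv /= gt_min lt_max !lte_fin.
  by apply/andP; split; apply/orP; right; lra.
Unshelve. all: by end_near. Qed.

End transfer.

Theorem theorem1p3 (R : realType) (alpha : R) (theta0 : plane R -> R)
    (d : measure_display) (L : measurableType d)
    (mu : signed_measure L R) (Theta : set (lplane R * L)) :
  0 < alpha < 1 / 2 ->
  L1Linfty theta0 ->
  layer_cake mu Theta theta0 ->
  (L_mu mu Theta alpha < +oo)%E ->
  exists a b : \bar R,
    [/\ maximal_itv alpha mu Theta theta0 a b,
        (* uniqueness, and independence of the layer cake representation *)
        (forall theta Phi theta' Phi',
           L_mu_solution alpha mu Theta theta0 a b theta Phi ->
           L_mu_solution alpha mu Theta theta0 a b theta' Phi' ->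
           forall t, open_itv a b t -> theta t = theta' t),
        (forall (d' : measure_display) (L' : measurableType d')
             (mu' : signed_measure L' R) (Theta' : set (lplane R * L')),
           layer_cake mu' Theta' theta0 ->
           (L_mu mu' Theta' alpha < +oo)%E ->
           maximal_itv alpha mu' Theta' theta0 a b /\
           forall theta Phi theta' Phi',
             L_mu_solution alpha mu Theta theta0 a b theta Phi ->
             L_mu_solution alpha mu' Theta' theta0 a b theta' Phi' ->
             forall t, open_itv a b t -> theta t = theta' t) &
        forall theta Phi, L_mu_solution alpha mu Theta theta0 a b theta Phi ->
          (forall s t, s <= t -> `[s, t] `<=` open_itv a b ->
             (ereal_sup [set maxe (lip_const (Phi r))
                                  (lip_const (inverse (Phi r))) | r in `[s, t]]
               < +oo)%E) /\
          (forall T : \bar R, T = a \/ T = b ->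
             `|T|%E = +oo%E \/
             L_mu mu (push_set Theta (Phi t)) alpha
               @[t --> within (open_itv a b) (nbhs (fine T))] --> +oo%E)].
Proof.
move=> alpha_itv th0L cake Lfin.
have [a [b [ab [Phi hPhi] Hmax]]] := exists_maximal_flow alpha_itv th0L cake Lfin.
have Hsub a' b' : (a' < 0 < b')%E -> (exists F, tame_flow alpha theta0 mu Theta a' b' F) ->
    open_itv a' b' `<=` open_itv a b.
  move=> ab' hF t /andP[t1 t2]; have [h1 h2] := Hmax a' b' ab' hF.
  by apply/andP; split; [exact: le_lt_trans h1 t1|exact: lt_le_trans t2 h2].
have uniq theta Phi1 theta' Phi2 : L_mu_solution alpha mu Theta theta0 a b theta Phi1 ->
    lagrangian_solution alpha theta0 a b theta' Phi2 ->
    forall t, open_itv a b t -> theta t = theta' t.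
  move=> s1 s2 t tab; have [/lagrangian_flow-/(_ alpha_itv th0L)[_ _ ->//] _] := s1.
  have [f2 id2 ->//] := lagrangian_flow alpha_itv th0L s2.
  by rewrite (tame_flow_unique alpha_itv th0L cake ab ab
    (solution_tame_flow alpha_itv th0L s1) f2 id2 tab tab).
exists a, b; split.
- split; first by apply/(solution_itvP alpha_itv th0L); split => //; exists Phi.
  by move=> a' b' /(solution_itvP alpha_itv th0L)[]; exact: Hsub.
- by move=> theta1 Phi1 theta2 Phi2 s1 [s2 _]; exact: (uniq _ _ _ _ s1 s2).
- move=> d' L' mu' Theta' cake' Lfin'; split; last first.
    by move=> theta1 Phi1 theta2 Phi2 s1 [s2 _]; exact: (uniq _ _ _ _ s1 s2).
  split.
    apply/(solution_itvP alpha_itv th0L); split; first exact: ab.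
    exists Phi; exact: (tame_flow_transfer alpha_itv th0L cake ab Lfin' hPhi).
  (* Maximality for the other representation: its flows are tame for the original one by the
     transfer with the roles exchanged. *)
  move=> a' b' /(solution_itvP alpha_itv th0L)[ab' [F hF]]; apply: (Hsub _ _ ab').
  exists F; exact: (tame_flow_transfer alpha_itv th0L cake' ab' Lfin hF).
- move=> theta F /(solution_tame_flow alpha_itv th0L) hF; split.
    by move=> s t st sub; exact: (tame_flow_lip alpha_itv th0L cake ab hF st sub).
  move=> T TE; have [Tfin|Tinf] := boolP (T \is a fin_num); last first.
    by left; move: Tinf; rewrite fin_numE; case: (T).
  right; apply: (tame_flow_blowup alpha_itv th0L cake ab hF _ Hsub).
  by rewrite /open_itv /= fineK//; case: TE => -> /andP[]; rewrite ltxx.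
Qed.
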